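(* Let $g=dr^2+f(r)^2h_r$ be a generalized warped product metric on $(0,R)\times Y$. Then any unit speed geodesic $\gamma(t)=(r(t),y(t))$, $t\in I$, of $((0,R)\times Y,g)$ is of one of the following two types: \begin{itemize} \item \emph{radial}: $y$ is constant, and $\dot r$ is constant equal to $1$ or $-1$; \item \emph{winding}: $\dot y(t)\neq 0$ for all $t\in I$. \end{itemize} Suppose in addition that $f$ extends to a continuously differentiable function $f:[0,R)\to[0,\infty)$ with $f(0)=0$ and $f$ convex. If $R>0$ is small enough (that is, there is $R_0>0$ such that the following holds after replacing $R$ by any smaller number in $(0,R_0]$ and restricting $g$ accordingly), then any maximal winding geodesic $\gamma=(r,y):I\to(0,R)\times Y$ satisfies: (a) the function $t\mapsto r(t)$ is strictly convex; (b) $\gamma$ has finite length, i.e. $I=(T_-,T_+)$ with $T_\pm\in\mathbb{R}$; (c) $\gamma$ enters and leaves at $r=R$, i.e. $r(t)\to R$ as $t\to T_\pm$. In the warped product case ($h_r=h$ independent of $r$), for a winding geodesic $\gamma=(r,y)$ the curve $t\mapsto y(t)$ is a time-reparametrised geodesic of $(Y,h)$.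
   Context: Let $Y$ be a closed manifold (compact, without boundary) and $R>0$. A generalized warped product metric on $(0,R)\times Y$ is a smooth Riemannian metric of the form $g=dr^2+f(r)^2h_r$, where $r$ is the coordinate on $(0,R)$, $f:(0,R)\to(0,\infty)$ is continuously differentiable (the warping function), and for each $r\in[0,R)$, $h_r$ is a Riemannian metric on $Y$, depending continuously differentiably on $r$. If $h_r=h$ does not depend on $r$, $g$ is called a warped product metric. Standing regularity assumption: the metrics $h_r$ are uniformly positive definite and depend uniformly $C^1$ on $r$; equivalently, there is a constant $c\ge 0$ with $-2c\,h_r\le\partial_r h_r\le 2c\,h_r$ (as quadratic forms on $TY$) for all $r\in(0,R)$. Geodesics are parametrised by unit speed on an interval $I\subset\mathbb{R}$, $\dot{}=d/dt$; a geodesic is maximal if its domain $I$ cannot be enlarged (within $(0,R)\times Y$). *)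

(* Defs.v *)
From HB Require Import structures.
From mathcomp Require Import all_boot all_order all_algebra.
From mathcomp Require Import all_classical all_reals all_analysis.

Set Implicit Arguments.
Unset Strict Implicit.
Unset Printing Implicit Defensive.

Import Order.TTheory GRing.Theory Num.Theory.
Import numFieldNormedType.Exports.

Local Open Scope classical_set_scope.
Local Open Scope ring_scope.

(* Derivatives are taken within the set [A], hence are one-sided at an endpoint
   of an interval that contains it. *)
Section OneVariable.
Context {K : realType} {W : normedModType K}.
Implicit Types (A : set K) (u : K -> W).

Definition dquot u (t : K) : K -> W := fun s => (s - t)^-1 *: (u s - u t).

Definition is_deriv_in A u (t : K) (v : W) : Prop :=
  dquot u t @ within A t^' --> v.

Definition derivable_in A u (t : K) : Prop := exists v, is_deriv_in A u t v.

Definition deriv_in A u (t : K) : W := lim (dquot u t @ within A t^').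

Definition C1_on A u : Prop :=
  (forall t, A t -> derivable_in A u t) /\
  {within A, continuous (deriv_in A u)}.

End OneVariable.

Definition strictly_convex_on (K : realType) (A : set K) (u : K -> K) : Prop :=
  forall s t a, A s -> A t -> s < t -> 0 < a -> a < 1 ->
    u (a * s + (1 - a) * t) < a * u s + (1 - a) * u t.

Definition proper_interval (K : realType) (I : set K) : Prop :=
  is_interval I /\ exists s t, [/\ I s, I t & s < t].

Section Smooth.
Context {K : realType} {V W : normedModType K}.

Definition iter_derive (vs : seq V) (u : V -> W) : V -> W :=
  foldr (fun v w => 'D_v w) u vs.

(* C^infinity on the open set U, for V of finite dimension: all iterated
   directional derivatives are differentiable. *)
Definition smooth_on (U : set V) (u : V -> W) : Prop :=
  forall vs x, U x -> differentiable (iter_derive vs u) x.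

End Smooth.

(* Chart data modelled on row vectors: the i-th chart is [cmap i] on [cdom i],
   with inverse [cinv i]. The charts need not cover T: they describe the open
   subset [carrier] of T. Outside the relevant domains the values of [cmap],
   [cinv] and of tensors are irrelevant. *)
Record charts (K : realType) (n : nat) (T : topologicalType) := Charts {
  cidx : Type;
  cdom : cidx -> set T;
  cmap : cidx -> T -> 'rV[K]_n;
  cinv : cidx -> 'rV[K]_n -> T }.

Section Manifold.
Context {K : realType} {n : nat} {T : topologicalType} (C : charts K n T).
Implicit Types (i j : cidx C) (p : T).

Definition carrier : set T := \bigcup_(i in [set: cidx C]) cdom i.

Definition smooth_atlas : Prop :=
  [/\ forall i, open (cdom i) /\ open (cmap i @` cdom i),
      forall i p, cdom i p -> cinv i (cmap i p) = p,
      forall i, {within cdom i, continuous (cmap i)} /\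
                {within cmap i @` cdom i, continuous (cinv i)} &
      forall i j, smooth_on (cmap i @` (cdom i `&` cdom j))
                            (cmap j \o cinv i)].

Definition closed_manifold : Prop :=
  [/\ smooth_atlas, carrier = [set: T], hausdorff_space T &
      compact [set: T]].

(* A 2-tensor is given by its matrix in each chart, at each point. *)
Definition tensor := cidx C -> T -> 'M[K]_n.

Implicit Type g : tensor.

Definition qform g i p (v : 'rV[K]_n) : K := (v *m g i p *m v^T) 0 0.

Definition in_coord g i (x : 'rV[K]_n) : 'M[K]_n := g i (cinv i x).

(* Tangent vectors are rows, so the coordinate change acts by v |-> v *m J. *)
Definition riemannian g : Prop :=
  [/\ forall i p, cdom i p -> (g i p)^T = g i p,
      forall i p, cdom i p -> forall v, v != 0 -> 0 < qform g i p v,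
      forall i, smooth_on (cmap i @` cdom i) (in_coord g i) &
      forall i j p, cdom i p -> cdom j p ->
        let J := 'J (cmap j \o cinv i) (cmap i p) in
        g i p = J *m g j p *m J^T].

(* 'D_a (g_(b,c)) in the chart i at p *)
Definition partial g i p (a b c : 'I_n) : K :=
  'D_(delta_mx 0 a) (fun x => in_coord g i x b c : K) (cmap i p).

(* Gamma^k_(a,b) *)
Definition christoffel g i p (k a b : 'I_n) : K :=
  2^-1 * \sum_(l < n) invmx (g i p) k l *
    (partial g i p a b l + partial g i p b a l - partial g i p l a b).

Implicit Types (I : set K) (gam : K -> T).

Definition velocity i I gam : K -> 'rV[K]_n := deriv_in I (cmap i \o gam).

Definition acceleration i I gam : K -> 'rV[K]_n := deriv_in I (velocity i I gam).

Definition geodesic_eq g i I gam (t : K) : Prop :=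
  forall k, acceleration i I gam t 0 k +
    \sum_(a < n) \sum_(b < n) christoffel g i (gam t) k a b *
      velocity i I gam t 0 a * velocity i I gam t 0 b = 0.

(* Geodesics have unit speed; I need not be open. *)
Definition geodesic g I gam : Prop :=
  [/\ proper_interval I, {within I, continuous gam},
      forall t, I t -> carrier (gam t) &
      forall t i, I t -> cdom i (gam t) ->
        [/\ derivable_in I (cmap i \o gam) t,
            derivable_in I (velocity i I gam) t,
            geodesic_eq g i I gam t &
            qform g i (gam t) (velocity i I gam t) = 1]].

Definition maximal_geodesic g I gam : Prop :=
  geodesic g I gam /\
  forall J del, geodesic g J del -> I `<=` J -> {in I, del =1 gam} -> J = I.

Definition nonstationary I (y : K -> T) : Prop :=
  forall t i, I t -> cdom i (y t) ->
    exists2 v, is_deriv_in I (cmap i \o y) t v & v != 0.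

Definition reparam_geodesic g I (y : K -> T) : Prop :=
  exists J (tau : K -> K) z,
    [/\ geodesic g J z, C1_on I tau,
        forall t, I t -> 0 < deriv_in I tau t,
        tau @` I = J & {in I, y =1 z \o tau}].

End Manifold.

Arguments riemannian {K n T} C g.
Arguments geodesic {K n T} C g I gam.
Arguments maximal_geodesic {K n T} C g I gam.
Arguments reparam_geodesic {K n T} C g I y.

Section Warped.
Context {K : realType} {n : nat} {Y : topologicalType} (A : charts K n Y).

(* ]0, R[ x Y, as an open subset of K x Y. *)
Definition cylinder (R : K) : charts K (1 + n) (K * Y)%type :=
  @Charts K (1 + n) (K * Y)%type (cidx A)
    (fun i => `]0, R[ `*` cdom i)
    (fun i p => row_mx p.1%:M (cmap i p.2))
    (fun i x => (lsubmx x 0 0, cinv i (rsubmx x))).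

Implicit Types (R : K) (f : K -> K) (h : K -> tensor A).

(* dr^2 + f(r)^2 h_r, a tensor on [cylinder R] for each R *)
Definition warped_metric f h (i : cidx A) (p : K * Y) : 'M[K]_(1 + n) :=
  block_mx 1%:M 0 0 (f p.1 ^+ 2 *: h p.1 i p.2).

Definition dr_metric R h (r : K) : tensor A :=
  fun i y => deriv_in `[0, R[ (fun s => h s i y) r.

Definition C1_family R h : Prop :=
  forall i,
    let D := [set p : K * Y | `[0, R[%classic p.1 /\ cdom i p.2] in
    [/\ forall p, D p -> derivable_in `[0, R[ (fun s => h s i p.2) p.1,
        {within D, continuous (fun p => h p.1 i p.2)} &
        {within D, continuous (fun p => dr_metric R h p.1 i p.2)}].

Definition uniformly_C1_bound R h : Prop :=
  exists2 c, 0 <= c & forall r i y v, 0 < r < R -> cdom i y ->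
    - (2 * c) * qform (h r) i y v <= qform (dr_metric R h r) i y v
      <= 2 * c * qform (h r) i y v.

Definition generalized_warped_product R f h : Prop :=
  [/\ C1_on `]0, R[ f /\ (forall r, 0 < r < R -> 0 < f r),
      forall r, 0 <= r < R -> riemannian A (h r),
      C1_family R h,
      uniformly_C1_bound R h &
      riemannian (cylinder R) (warped_metric f h)].

Definition warped_product_case R h (h0 : tensor A) : Prop :=
  forall r i y, 0 <= r < R -> cdom i y -> h r i y = h0 i y.

(* f is meaningful on ]0, R[ only, so its value at 0 is not used. *)
Definition extends_convexly R f : Prop :=
  exists F : K -> K,
    [/\ forall r, 0 < r < R -> F r = f r,
        C1_on `[0, R[ F,
        F 0 = 0 &
        convex_function (`[0, R[%classic : set K^o) F].

Definition radial (I : set K) (gam : K -> K * Y) : Prop :=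
  (forall s t, I s -> I t -> (gam s).2 = (gam t).2) /\
  ((forall t, I t -> is_deriv_in I (fst \o gam) t 1) \/
   (forall t, I t -> is_deriv_in I (fst \o gam) t (-1))).

Definition winding (I : set K) (gam : K -> K * Y) : Prop :=
  nonstationary A I (snd \o gam).

End Warped.

(* Main.v *)
(* Write a unit speed geodesic as [gam = (r, y)], and put [p = r'] and
   [Q = 1 - p^2]. Unit speed says that [Q = f(r)^2 h_r(y', y')], and the radial
   component of the geodesic equation, paired with the metric so that no inverse
   matrix appears, reads
     [p' = f f'(r) h_r(y', y') + f(r)^2 (d_r h_r)(y', y') / 2],
   whence [|p' - (f'/f)(r) Q| <= c Q].

   Radial or winding: [|Q'| <= 2 (|f'/f| + c) Q], so by Gronwall [Q] vanishes
   everywhere or nowhere. If [Q = 0], then [p = 1] or [p = -1] throughout, and [y' = 0].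

   Small radius: convexity and [f(0) = 0] give [f'/f >= 1/r], so
   [p' >= (1/(2r) + 1) Q > 0] once [r (2c + 2) <= 1]. Hence [r] is strictly convex. The
   bound [p' >= Q] and [0 < r < R] make the domain bounded. At its right end, either
   [p > 0] somewhere, so that [r] increases and, if its limit is less than [R], [gam]
   stays in a compact subset; or [p <= 0] and [Q r] is nondecreasing, so again [gam]
   stays in a compact subset. A maximal geodesic leaves every compact subset: near a
   cluster point its velocity and acceleration are bounded in a chart, so that it
   converges and is continued by the Picard-Lindelof theorem. The left end follows by
   reversing time.

   Warped products: [f(r)^4 h(y', y') = f(r)^2 Q] is a constant [a^2] (Clairaut), and
   with [tau' = a / f(r)^2] the fibre components of the geodesic equation are those of
   the geodesic equation of [h] for [y] as a function of [tau]. *)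
Require Import Defs.
From HB Require Import structures.
From mathcomp Require Import all_boot all_order all_algebra.
From mathcomp Require Import all_classical all_reals all_analysis.
From mathcomp Require Import ring lra.

Set Implicit Arguments.
Unset Strict Implicit.
Unset Printing Implicit Defensive.

Import Order.TTheory GRing.Theory Num.Theory.
Import numFieldNormedType.Exports.

Local Open Scope classical_set_scope.
Local Open Scope ring_scope.

(** * Derivatives within a set *)

Section DerivIn.
Context {K : realType}.

(** [geodesic] imposes its conditions in every chart around a point, whereas a continuation is built
    in one chart; so the geodesic equation has to be shown independent of the chart. In the paired
    form this is a matrix identity in which the second derivatives of the transition map cancel by
    symmetry, and the transformation law of the Christoffel symbols never enters. The inverse metric
    returns only to solve for the acceleration, where Cramer's rule makes the right-hand side
    visibly locally Lipschitz. The paired form also has a variational reading: it prescribes the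
    derivative of the momentum. Its radial and fibre components yield the two equations used for
    warped products without computing any Christoffel symbol of the warped metric. In the radial
    one, [h_r] enters only through its [r]-derivative at a fixed point of [Y]. Domains may contain
    their ends, so derivatives are one-sided; monotonicity, uniqueness of primitives and Lipschitz
    bounds are all drawn from one mean value theorem on intervals. *)

Lemma mx_entry_le m n (M : 'M[K]_(m, n)) i j : `|M i j| <= `|M|.
Proof. by rewrite [`|M|]/Num.Def.normr/= mx_normrE; exact: (le_bigmax _ (fun i => `|M i.1 i.2|) (i, j)). Qed.

Lemma mx_norm_le m n (M : 'M[K]_(m, n)) e : 0 <= e -> (forall i j, `|M i j| <= e) -> `|M| <= e.
Proof.
by move=> e0 H; rewrite [`|M|]/Num.Def.normr/= mx_normrE; apply: bigmax_le => // -[i j] _ /=.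
Qed.

(** Clearing the denominator makes the estimate trivial at [s = t], so the puncture disappears and
    limits of quotients become inequalities near [t]. *)
Lemma is_deriv_inP {W : normedModType K} (A : set K) (u : K -> W) t v :
  is_deriv_in A u t v <->
  forall e, 0 < e -> \forall s \near t, A s ->
    `|u s - u t - (s - t) *: v| <= e * `|s - t|.
Proof.
rewrite /is_deriv_in; split.
- move=> /cvgrPdist_le H e e0; have {H} := H _ e0.
  rewrite near_withinE /dnbhs near_withinE => H.
  near=> s => As.
  have [->|st] := eqVneq s t; first by rewrite !subrr scale0r subr0 !normr0 mulr0.
  have st0 : s - t != 0 by rewrite subr_eq0.
  have : `|v - dquot u t s| <= e.
    by have : s != t -> A s -> `|v - dquot u t s| <= e; [near: s|apply].
  rewrite /dquot => h1.
  have -> : u s - u t - (s - t) *: v = - ((s - t) *: (v - (s - t)^-1 *: (u s - u t))).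
    by rewrite scalerBr scalerA divff// scale1r opprB.
  by rewrite normrN normrZ mulrC ler_wpM2r.
- move=> H; apply/cvgrPdist_le => e e0; have {}H := H _ e0.
  rewrite near_withinE /dnbhs near_withinE.
  near=> s => st As.
  have st0 : s - t != 0 by rewrite subr_eq0.
  have h1 : `|u s - u t - (s - t) *: v| <= e * `|s - t|.
    by move: As; near: s.
  have -> : v - dquot u t s = - ((s - t)^-1 *: (u s - u t - (s - t) *: v)).
    by rewrite /dquot [in RHS]scalerBr scalerA mulVf// scale1r opprB.
  by rewrite normrN normrZ normfV mulrC ler_pdivrMr// normr_gt0.
Unshelve. all: by end_near. Qed.

(** Only germs at [t] matter: near [t], [B] has to lie in [A] and the functions have to agree on
    [B]. This moves derivatives between a domain and its restrictions or continuations. *)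
Lemma is_deriv_in_near {W : normedModType K} (A B : set K) (u w : K -> W) t v :
  u t = w t -> (\forall s \near t, B s -> A s /\ u s = w s) ->
  is_deriv_in A u t v -> is_deriv_in B w t v.
Proof.
move=> uw AB /is_deriv_inP H; apply/is_deriv_inP => e e0.
have := H e e0; apply: filterS2 AB => s AB H1 Bs.
by have [As us] := AB Bs; rewrite -uw -us; exact: H1.
Qed.

Lemma is_deriv_inS {W : normedModType K} (A B : set K) (u : K -> W) t v :
  B `<=` A -> is_deriv_in A u t v -> is_deriv_in B u t v.
Proof. by move=> BA; apply: is_deriv_in_near => //; near=> s => /BA.
Unshelve. all: by end_near. Qed.

Lemma is_deriv_in_id (A : set K) t : is_deriv_in A (fun s : K => s) t 1.
Proof.
apply/is_deriv_inP => e e0; near=> s => _.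
by rewrite [_ *: 1]mulr1 subrr normr0 mulr_ge0// ltW.
Unshelve. all: by end_near. Qed.

Lemma is_deriv_in_cst {W : normedModType K} (A : set K) (c : W) t : is_deriv_in A (fun _ => c) t 0.
Proof.
apply/is_deriv_inP => e e0; near=> s => _.
by rewrite subrr scaler0 subr0 normr0 mulr_ge0// ltW.
Unshelve. all: by end_near. Qed.

Lemma is_deriv_inD {W : normedModType K} (A : set K) (u w : K -> W) t a b :
  is_deriv_in A u t a -> is_deriv_in A w t b ->
  is_deriv_in A (fun s => u s + w s) t (a + b).
Proof.
rewrite /is_deriv_in => ua wb.
rewrite (_ : dquot _ _ = dquot u t \+ dquot w t); first exact: cvgD.
by apply/funext => s; rewrite /dquot/= -scalerDr opprD addrACA.
Qed.

Lemma is_deriv_inZ {W : normedModType K} (A : set K) (u : K -> W) t (k : K) a :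
  is_deriv_in A u t a -> is_deriv_in A (fun s => k *: u s) t (k *: a).
Proof.
rewrite /is_deriv_in => ua.
rewrite (_ : dquot _ _ = (fun s => k *: dquot u t s)); first exact: cvgZl_tmp.
by apply/funext => s; rewrite /dquot/= -scalerBr !scalerA mulrC.
Qed.

Lemma is_deriv_inN {W : normedModType K} (A : set K) (u : K -> W) t a :
  is_deriv_in A u t a -> is_deriv_in A (fun s => - u s) t (- a).
Proof.
move=> /(is_deriv_inZ (k := -1)); rewrite scaleN1r.
by under eq_fun do rewrite scaleN1r.
Qed.

Lemma is_deriv_inB {W : normedModType K} (A : set K) (u w : K -> W) t a b :
  is_deriv_in A u t a -> is_deriv_in A w t b ->
  is_deriv_in A (fun s => u s - w s) t (a - b).
Proof. by move=> ua wb; apply: is_deriv_inD => //; exact: is_deriv_inN. Qed.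

Lemma is_deriv_in_sum {W : normedModType K} (A : set K) m (u : 'I_m -> K -> W) t a :
  (forall i, is_deriv_in A (u i) t (a i)) ->
  is_deriv_in A (fun s => \sum_(i < m) u i s) t (\sum_(i < m) a i).
Proof.
elim: m u a => [|m IH] u a ua.
  by under eq_fun do rewrite big_ord0; rewrite big_ord0; exact: is_deriv_in_cst.
under eq_fun do rewrite big_ord_recr/=; rewrite big_ord_recr/=.
by apply: is_deriv_inD => //; exact: IH.
Qed.

Lemma is_deriv_in_cvg {W : normedModType K} (A : set K) (u : K -> W) t v :
  is_deriv_in A u t v -> u @ within A (nbhs t) --> u t.
Proof.
move=> /is_deriv_inP /(_ 1 ltr01) H; apply/cvgrPdist_le => e e0.
rewrite near_withinE; near=> s => As.
have h1 : `|u s - u t - (s - t) *: v| <= 1 * `|s - t| by move: As; near: s.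
have h2 : `|s - t| <= e / (1 + `|v|).
  near: s; apply: cvgr_distC_le; first exact: cvg_id.
  by rewrite divr_gt0// ltr_pwDl.
have : `|u s - u t| <= `|s - t| * (1 + `|v|).
  rewrite -[u s - u t](subrK ((s - t) *: v)) mulrDr mulr1.
  apply: le_trans (ler_normD _ _) _.
  by rewrite normrZ lerD// -[leRHS]mul1r.
rewrite distrC => /le_trans; apply; rewrite -ler_pdivlMr// ltr_pwDl.
Unshelve. all: by end_near. Qed.

Lemma cvg_within_near {T : topologicalType} (A : set K) (u : K -> T) (t : K) (l : T) (P : set T) :
  u @ within A (nbhs t) --> l -> (\forall y \near l, P y) ->
  \forall s \near t, A s -> P (u s).
Proof. by move=> ul Pl; exact: (ul _ Pl). Qed.

Lemma within_continuous_near {T : topologicalType} (A : set K) (u : K -> T) (t : K) (P : set T) :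
  {within A, continuous u} -> A t -> (\forall y \near u t, P y) ->
  \forall s \near t, A s -> P (u s).
Proof.
move=> /subspace_continuousP cu At.
exact: (cvg_within_near (cu t At : u s @[s --> within A (nbhs t)] --> u t)).
Qed.

Lemma is_deriv_in_mxP m n (A : set K) (u : K -> 'M[K]_(m, n)) t v :
  is_deriv_in A u t v <-> forall i j, is_deriv_in A (fun s => u s i j) t (v i j).
Proof.
split=> [/is_deriv_inP H i j|H]; apply/is_deriv_inP => e e0.
- apply: filterS (H e e0) => s /[apply]; apply: le_trans.
  by have := mx_entry_le (u s - u t - (s - t) *: v) i j; rewrite !mxE.
- near=> s => As; apply: mx_norm_le => [|i j]; first by rewrite mulr_ge0// ltW.
  rewrite !mxE; move: As; move: i j; near: s.
  apply: filter_forall => i; apply: filter_forall => j.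
  by have /is_deriv_inP/(_ e e0) := H i j; apply: filterS => s; exact.
Unshelve. all: by end_near. Qed.

Lemma is_deriv_inM (A : set K) (u w : K -> K) t a b :
  is_deriv_in A u t a -> is_deriv_in A w t b ->
  is_deriv_in A (fun s => u s * w s) t (a * w t + u t * b).
Proof.
move=> ua wb; have := is_deriv_in_cvg ua.
move=> uc; rewrite /is_deriv_in.
rewrite (_ : dquot _ _ = (fun s => dquot u t s * w t + u s * dquot w t s)).
  apply: cvgD; first by apply: cvgM => //; exact: cvg_cst.
  apply: cvgM => //.
  apply: cvg_trans uc; apply: cvg_app => P.
  rewrite !nbhs_simpl/= /within/= => P1.
  rewrite near_withinE /=; apply: filterS P1 => x; by [].
apply/funext => s; rewrite /dquot/= /GRing.scale/=; ring.
Qed.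

Lemma is_deriv_in_mulmx m n p (A : set K) (u : K -> 'M[K]_(m, n))
    (w : K -> 'M[K]_(n, p)) t a b :
  is_deriv_in A u t a -> is_deriv_in A w t b ->
  is_deriv_in A (fun s => u s *m w s) t (a *m w t + u t *m b).
Proof.
move=> /is_deriv_in_mxP ua /is_deriv_in_mxP wb; apply/is_deriv_in_mxP => i j.
rewrite (_ : (fun s => _) = fun s => \sum_(k < n) u s i k * w s k j); last first.
  by apply/funext => s; rewrite mxE.
rewrite !mxE -big_split/=; apply: is_deriv_in_sum => k.
exact: is_deriv_inM.
Qed.

Lemma is_deriv_in_tr m n (A : set K) (u : K -> 'M[K]_(m, n)) t a :
  is_deriv_in A u t a -> is_deriv_in A (fun s => (u s)^T) t a^T.
Proof.
move=> /is_deriv_in_mxP ua; apply/is_deriv_in_mxP => i j.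
rewrite mxE; under eq_fun do rewrite mxE; exact: ua.
Qed.

Lemma differentiable_le {V W : normedModType K} (F : V -> W) x :
  differentiable F x -> forall e, 0 < e ->
  \forall y \near x, `|F y - F x - 'd F x (y - x)| <= e * `|y - x|.
Proof.
move=> /diff_locallyP[_ /eqaddoP H] e e0.
have := H e e0 => {}H; rewrite (near_shift 0)/=.
apply: filterS H => y /=.
by rewrite subr0 addrK !fctE/= opprD addrA.
Qed.

(** Near [t] the increment [u s - u t] is at most [(1 + |v|) |s - t|], which turns the linearisation
    error of [F] into one in [|s - t|]. *)
Lemma is_deriv_in_comp {V W : normedModType K} (A : set K) (u : K -> V) (F : V -> W) t v :
  differentiable F (u t) -> is_deriv_in A u t v ->
  is_deriv_in A (F \o u) t ('D_v F (u t)).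
Proof.
move=> dF ua; have uc := is_deriv_in_cvg ua; have /is_deriv_inP H := ua.
rewrite deriveE//; apply/is_deriv_inP => e e0.
have [k k0 Hk] := linear_lipschitz (diff_continuous dF).
have e2 : 0 < e / 2 by rewrite divr_gt0.
have v1 : 0 < 1 + `|v| by rewrite ltr_pwDl.
have := cvg_within_near uc (differentiable_le dF (divr_gt0 e2 v1)).
have := H _ (divr_gt0 e2 k0); have := H _ ltr01.
apply: filterS3 => s H1 H2 H3 As.
have {}H1 := H1 As; have {}H2 := H2 As; have {}H3 := H3 As.
have H4 : `|u s - u t| <= (1 + `|v|) * `|s - t|.
  rewrite -[u s - u t](subrK ((s - t) *: v)) mulrDl.
  by apply: le_trans (ler_normD _ _) _; rewrite normrZ [`|v| * _]mulrC lerD.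
rewrite -[_ - _ - _](subrKA ('d F (u t) (u s - u t))).
apply: le_trans (ler_normD _ _) _.
rewrite [e in leRHS]splitr mulrDl lerD//.
  apply: le_trans H3 _; apply: le_trans (ler_wpM2l _ H4) _.
    by rewrite divr_ge0// ltW.
  by rewrite mulrA divfK// gt_eqF.
rewrite -linearZ -linearB/=; apply: le_trans (Hk _) _.
by rewrite mulrC -ler_pdivlMr// mulrAC.
Qed.

End DerivIn.

(** * Uniqueness of derivatives and mean value theorems on intervals *)

Section DerivInInterval.
Context {K : realType}.

(** A nondegenerate interval accumulates at each of its points, hence limits within it are unique
    and [deriv_in] is the derivative, also at end points. *)
Lemma proper_interval_limit (A : set K) t : proper_interval A -> A t ->
  ProperFilter (within A t^').
Proof.
move=> [iA [a [b [Aa Ab ab]]]] At; split; last exact: within_filter.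
rewrite /within/= /dnbhs/= => -[e /= e0 H].
have [ta|at_] := ltP t b.
- pose s := Num.min b (t + e / 2).
  have ts : t < s by rewrite lt_min ta/= ltrDl divr_gt0.
  have se : s <= t + e / 2 by rewrite ge_min lexx orbT.
  apply: (H s); last 2 first.
  + by rewrite gt_eqF.
  + by apply: (iA t b) => //; rewrite (ltW ts) ge_min lexx.
  rewrite /ball_/= ltr0_norm ?subr_lt0// opprB; lra.
- pose s := Num.max a (t - e / 2).
  have ts : s < t by rewrite gt_max (lt_le_trans ab at_)/= gtrBl divr_gt0.
  have se : t - e / 2 <= s by rewrite le_max lexx orbT.
  apply: (H s); last 2 first.
  + by rewrite lt_eqF.
  + by apply: (iA a t) => //; rewrite (ltW ts) le_max lexx.
  rewrite /ball_/= gtr0_norm ?subr_gt0//; lra.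
Qed.

Lemma proper_intervalT : proper_interval [set: K].
Proof. by split; [by []|exists 0, 1]. Qed.

Lemma is_deriv_inE {W : normedModType K} (A : set K) (u : K -> W) t v :
  proper_interval A -> A t -> is_deriv_in A u t v -> deriv_in A u t = v.
Proof.
move=> pA At; have := proper_interval_limit pA At => PF.
by move=> /cvg_lim; apply; exact: norm_hausdorff.
Qed.

Lemma is_deriv_in_unique {W : normedModType K} (A : set K) (u : K -> W) t v v' :
  proper_interval A -> A t -> is_deriv_in A u t v -> is_deriv_in A u t v' -> v = v'.
Proof. by move=> pA At /(is_deriv_inE pA At) <- /(is_deriv_inE pA At) <-. Qed.

Lemma derivable_in_is_deriv {W : normedModType K} (A : set K) (u : K -> W) t :
  proper_interval A -> A t -> derivable_in A u t -> is_deriv_in A u t (deriv_in A u t).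
Proof. by move=> pA At [v uv]; rewrite (is_deriv_inE pA At uv). Qed.

Lemma is_deriv_in_is_derive {W : normedModType K} (A : set K) (u : K -> W) t v :
  (\forall s \near t, A s) -> is_deriv_in A u t v -> is_derive t 1 u v.
Proof.
move=> nA /is_deriv_inP H.
have : (fun h => h^-1 *: ((u \o shift t) (h *: (1 : K)) - u t)) @ 0^' --> v.
  apply/cvgrPdist_le => e e0; rewrite /dnbhs near_withinE.
  have : \forall s \near t, (A s -> `|u s - u t - (s - t) *: v| <= e * `|s - t|) /\ A s.
    by apply: filterI; [exact: H|].
  rewrite (near_shift 0)/= subr0.
  apply: filterS => h /= [H1 At] h0.
  have {H1} := H1 At; rewrite addrK => H1.
  rewrite [h *: 1]mulr1.
  have -> : v - h^-1 *: (u (h + t) - u t) = - (h^-1 *: (u (h + t) - u t - h *: v)).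
    by rewrite [in RHS]scalerBr scalerA mulVf// scale1r opprB.
  by rewrite normrN normrZ normfV mulrC ler_pdivrMr// normr_gt0.
move=> uv; split; first by apply/cvg_ex; exists v.
by apply: cvg_lim => //; exact: norm_hausdorff.
Qed.

Lemma is_deriv_in_line {V W : normedModType K} (A : set K) (F : V -> W) x v (t : K) :
  derivable F (x + t *: v) v -> is_deriv_in A (fun s => F (x + s *: v)) t ('D_v F (x + t *: v)).
Proof.
move=> dF; apply: (@is_deriv_inS _ _ setT) => //.
apply/is_deriv_inP => e e0.
have /cvgrPdist_le/(_ e e0) := dF; rewrite /dnbhs near_withinE => H.
rewrite (near_shift (0 : K))/=; apply: filterS H => h /= + _.
rewrite subr0 addrK -/(derive _ _ _).
have [->|h0 /(_ isT)] := eqVneq h 0.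
  by move=> _; rewrite add0r subrr scale0r subr0 !normr0 mulr0.
have -> : h *: v + (x + t *: v) = x + (h + t) *: v by rewrite scalerDl addrCA.
move=> H1.
set y := _ - _ - _; have -> : y = - (h *: ('D_v F (x + t *: v) - h^-1 *: (F (x + (h + t) *: v) - F (x + t *: v)))).
  by rewrite scalerBr scalerA divff// scale1r opprB.
by rewrite normrN normrZ mulrC ler_wpM2r.
Qed.

Lemma is_deriv_in_affine {V : normedModType K} (A : set K) (x v : V) (t : K) :
  is_deriv_in A (fun s => x + s *: v) t v.
Proof.
have := @is_deriv_in_line V V A id x v t; rewrite derive_id; apply.
exact: derivable_id.
Qed.

Lemma is_deriv_in_within_continuous {W : normedModType K} (A : set K) (u u' : K -> W) :
  (forall t, A t -> is_deriv_in A u t (u' t)) -> {within A, continuous u}.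
Proof.
move=> H; apply/subspace_continuousP => t At.
exact: is_deriv_in_cvg (H t At).
Qed.

(** Points strictly between [a] and [b] are interior to [A], so the derivatives are two-sided there
    and the classical theorem applies. *)
Lemma MVT_in (A : set K) (u u' : K -> K) a b : is_interval A ->
  (forall t, A t -> is_deriv_in A u t (u' t)) -> A a -> A b -> a < b ->
  exists2 c, a < c < b & u b - u a = u' c * (b - a).
Proof.
move=> iA H Aa Ab ab.
have sub : `[a, b] `<=` A.
  by move=> s /=; rewrite in_itv/= => sab; exact: (iA a b).
have cu : {within `[a, b], continuous u}.
  apply: (@is_deriv_in_within_continuous _ _ _ u') => t tab.
  by apply: is_deriv_inS (H t (sub _ tab)).
have [||c] := @MVT K u u' a b ab; [|exact: cu|by rewrite in_itv/= => *; exists c].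
move=> t tab; apply: is_deriv_in_is_derive (H t _).
  have : \forall s \near t, s \in `]a, b[%R.
    by apply: near_in_itvoo.
  apply: filterS => s; rewrite in_itv/= => /andP[*]; apply: sub.
  by rewrite /= in_itv/= !ltW.
by apply: sub; apply: subset_itv_oo_cc tab.
Qed.

Lemma le_MVT_in (A : set K) (u u' : K -> K) a b : is_interval A ->
  (forall t, A t -> is_deriv_in A u t (u' t)) -> A a -> A b -> a <= b ->
  (forall t, a <= t <= b -> 0 <= u' t) -> u a <= u b.
Proof.
move=> iA H Aa Ab; rewrite le_eqVlt => /predU1P[->//|ab] u0.
have [c /andP[ac cb] e] := MVT_in iA H Aa Ab ab.
by rewrite -subr_ge0 e mulr_ge0 ?subr_ge0 ?(ltW ab)// u0// !ltW.
Qed.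

Lemma lt_MVT_in (A : set K) (u u' : K -> K) : is_interval A ->
  (forall t, A t -> is_deriv_in A u t (u' t)) ->
  (forall t, A t -> 0 < u' t) ->
  forall a b, A a -> A b -> a < b -> u a < u b.
Proof.
move=> iA H u0 a b Aa Ab ab.
have [c /andP[ac cb] e] := MVT_in iA H Aa Ab ab.
rewrite -subr_gt0 e mulr_gt0 ?subr_gt0// u0//.
by apply: (iA a b) => //; rewrite !ltW.
Qed.

Lemma cst_MVT_in (A : set K) (u : K -> K) : is_interval A ->
  (forall t, A t -> is_deriv_in A u t 0) ->
  forall a b, A a -> A b -> u a = u b.
Proof.
move=> iA H; suff S : forall a b, A a -> A b -> a < b -> u a = u b.
  by move=> a b Aa Ab; case: (ltgtP a b) => [||->//] ab; [|symmetry]; exact: S.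
move=> a b Aa Ab ab; have [c /andP[ac cb] e] := MVT_in iA H Aa Ab ab.
by apply/eqP; rewrite eq_sym -subr_eq0 e mul0r.
Qed.

Lemma near_opp (P : set K) (t : K) :
  (\forall s \near t, P s) -> \forall s \near - t, P (- s).
Proof. by move=> H; apply: (@opp_continuous K (- t)); rewrite opprK. Qed.

Lemma is_deriv_in_reverse {W : normedModType K} (A : set K) (u : K -> W) t v :
  is_deriv_in A u t v ->
  is_deriv_in (-%R @^-1` A) (u \o -%R) (- t) (- v).
Proof.
move=> /is_deriv_inP H; apply/is_deriv_inP => e e0 /=.
have := near_opp (H e e0); apply: filterS => s /= H1 As.
have {H1} := H1 As; rewrite opprK => H1.
rewrite -(normrN (s + t)) opprD (_ : (s + t) *: - v = (- s - t) *: v)//.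
by rewrite scalerN -scaleNr opprD.
Qed.

(** The difference quotient of [u \o rho] at [tau s] is that of [u] divided by that of [tau], both
    taken at [s]; continuity of [rho] at [tau t] carries the limit over. *)
Lemma is_deriv_in_reparam {W : normedModType K} (A B : set K) (u : K -> W)
   (tau rho : K -> K) t v k : k != 0 -> 
  (forall s, A s -> rho (tau s) = s) -> A t -> tau @` A = B ->
  rho @ within B (nbhs (tau t)) --> t ->
  is_deriv_in A u t v -> is_deriv_in A tau t k ->
  is_deriv_in B (u \o rho) (tau t) (k^-1 *: v).
Proof.
move=> k0 rt At AB rc ua ta; rewrite /is_deriv_in.
have r' : rho @ within B (tau t)^' --> within A t^'.
  move=> P /=; rewrite /within/= /dnbhs /within/= => P1.
  have := cvg_within_near rc P1; apply: filterS => s H st Bs.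
  apply: (H Bs); last first.
    by move: Bs; rewrite -AB => -[s' As' <-]; rewrite rt.
  by apply: contra_neq st => <-; move: Bs; rewrite -AB => -[s' As' <-]; rewrite rt.
have t' : dquot tau t s @[s --> within A t^'] --> k by [].
have H3 : (dquot tau t s)^-1 *: dquot u t s @[s --> within A t^'] --> k^-1 *: v.
  by apply: cvgZ => //; exact: cvgV.
have := cvg_comp _ _ r' H3.
apply: cvg_trans; apply: near_eq_cvg.
rewrite near_withinE /dnbhs near_withinE; near=> s => st Bs.
move: Bs st; rewrite -AB => -[s' As' <-] st.
rewrite /dquot/= !rt//.
rewrite scalerA; congr (_ *: _).
rewrite /GRing.scale/= invfM invrK mulrAC mulfV ?mul1r// subr_eq0.
by apply: contra_neq st => ->.
Unshelve. all: by end_near. Qed.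

(** The mean value theorem is applied to each entry; as the norm is the maximum over the entries,
    the constant [M] is kept. *)
Lemma lipschitz_of_deriv_bound m (A : set K) (u u' : K -> 'rV[K]_m) M : is_interval A -> 0 <= M ->
  (forall t, A t -> is_deriv_in A u t (u' t)) -> (forall t, A t -> `|u' t| <= M) ->
  forall s s', A s -> A s' -> `|u s - u s'| <= M * `|s - s'|.
Proof.
move=> iA M0 Hu Hb.
suff S s s' : A s -> A s' -> s < s' -> `|u s - u s'| <= M * `|s - s'|.
  move=> s s' As As'; have [ss|ss|->] := ltgtP s s'; first exact: S.
    by rewrite distrC (distrC s); exact: S.
  by rewrite !subrr !normr0 mulr0.
move=> As As' ss; rewrite distrC (distrC s); apply: mx_norm_le => [|i j]; first exact: mulr_ge0.
have Hj t : A t -> is_deriv_in A (fun t => u t 0 j) t (u' t 0 j).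
  by move=> At; have /is_deriv_in_mxP := Hu t At; exact.
have [c /andP[sc cs] E] := MVT_in iA Hj As As' ss.
rewrite ord1 !mxE E normrM ler_wpM2r//.
apply: le_trans (mx_entry_le _ _ _) (Hb _ _).
by apply: (iA s s') => //; rewrite !ltW.
Qed.

End DerivInInterval.

(** * Symmetry of second derivatives *)

Section Schwarz.
Context {K : realType} {V : normedModType K}.

(** The mean value theorem for [th |-> F (x + s w + th u) - F (x + th u)] on [[0, s]] leaves a
    difference of two values of ['D_u F], which the first-order expansion of ['D_u F] at [x]
    evaluates. *)
Lemma second_difference (F : V -> K) (x u w : V) :
  (\forall y \near x, derivable F y u) -> differentiable ('D_u F) x ->
  forall e, 0 < e -> \forall s \near 0^'+,
    `|F (x + s *: u + s *: w) - F (x + s *: u) - (F (x + s *: w) - F x)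
      - s * (s * 'D_w ('D_u F) x)| <= e * (s * s).
Proof.
move=> nd dd e e0.
(* All points used below are within [s * M] of [x]; the summand [1] keeps [M] positive. Two
   expansion errors [e / (2 * M) * (s * M)] add up to [e * s]. *)
pose M := `|u| + `|w| + 1.
have M0 : 0 < M by rewrite ltr_wpDl// addr_ge0.
have e'0 : 0 < e / (2 * M) by rewrite divr_gt0// mulr_gt0.
have [r /= r0 Hr] : exists2 r, 0 < r & forall y, `|y - x| < r ->
    derivable F y u /\ `|'D_u F y - 'D_u F x - 'd ('D_u F) x (y - x)| <= e / (2 * M) * `|y - x|.
  have : \forall y \near x, derivable F y u /\
      `|'D_u F y - 'D_u F x - 'd ('D_u F) x (y - x)| <= e / (2 * M) * `|y - x|.
    by apply: filterI => //; exact: differentiable_le.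
  move=> /nbhs_ballP[r r0 H].
  exists r => // y yx; apply: H.
  by rewrite -ball_normE/= distrC.
(* The boolean says whether the shift by [s *: w] is present; points of both kinds occur. *)
have bnd s th : 0 < s -> s * M < r -> 0 <= th <= s -> forall b : bool,
    `|x + th *: u + (b%:R * s) *: w - x| <= s * M.
  move=> s0 sr /andP[th0 ths] b.
  rewrite [X in `|X|](_ : _ = th *: u + (b%:R * s) *: w); last first.
    by rewrite -[x + _ + _]addrA [x + _]addrC addrK.
  apply: le_trans (ler_normD _ _) _; rewrite !normrZ /M !mulrDr mulr1.
  rewrite -[leLHS]addr0 !lerD ?ler_wpM2r//.
  - by rewrite ger0_norm.
  - by rewrite (gtr0_norm s0) normr_nat; case: b; rewrite ?mul1r ?mul0r// ltW.
  - exact: ltW.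
near=> s.
have s0 : 0 < s by [].
have sr : s * M < r by rewrite -ltr_pdivlMr//; near: s; apply: nbhs_right_lt; rewrite divr_gt0.
pose k := fun th : K => F (x + s *: w + th *: u) - F (x + th *: u).
have dk th : 0 <= th <= s -> is_deriv_in setT k th
    ('D_u F (x + s *: w + th *: u) - 'D_u F (x + th *: u)).
  move=> ths; apply: is_deriv_inB; apply: is_deriv_in_line.
  - have := bnd s th s0 sr ths true; rewrite mul1r [x + th *: u + _]addrAC => b1.
    exact: (Hr _ (le_lt_trans b1 sr)).1.
  - have := bnd s th s0 sr ths false; rewrite mul0r scale0r addr0 => b1.
    exact: (Hr _ (le_lt_trans b1 sr)).1.
pose k' := fun th : K => 'D_u F (x + s *: w + th *: u) - 'D_u F (x + th *: u).
have [c /andP[c0 cs]] : exists2 c, 0 < c < s & k s - k 0 = k' c * (s - 0).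
  apply: (@MVT_in K `[0, s]) => //=; first exact: interval_is_interval.
  - move=> t; rewrite in_itv/= => ts; apply: is_deriv_inS (dk t ts); exact: subsetT.
  - by rewrite in_itv/= lexx ltW.
  - by rewrite in_itv/= lexx ltW.
rewrite /k /k' !scale0r !addr0 subr0 => E.
have cs' : 0 <= c <= s by rewrite !ltW.
have b1 := bnd s c s0 sr cs' true; have b2 := bnd s c s0 sr cs' false.
move: b1 b2; rewrite mul1r mul0r scale0r addr0 => b1 b2.
have [_ h1] := Hr _ (le_lt_trans b1 sr); have [_ h2] := Hr _ (le_lt_trans b2 sr).
have -> : x + s *: u + s *: w = x + s *: w + s *: u by rewrite addrAC.
have -> : F (x + s *: w + s *: u) - F (x + s *: u) - (F (x + s *: w) - F x) =
  s * ('D_u F (x + c *: u + s *: w) - 'D_u F (x + c *: u)).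
  by rewrite E mulrC [x + c *: u + _]addrAC.
rewrite -mulrBr normrM gtr0_norm// mulrCA ler_pM2l//.
rewrite (deriveE w dd).
have -> : s * 'd ('D_u F) x w = 'd ('D_u F) x (x + c *: u + s *: w - x) - 'd ('D_u F) x (x + c *: u - x).
  rewrite -linearB/= opprB addrA subrK [x + c *: u + _]addrC addrK linearZ//.
set A := 'D_u F _; set B := 'D_u F _; set a := 'd _ _ _; set b := 'd _ _ _.
have -> : A - B - (a - b) = (A - 'D_u F x - a) - (B - 'D_u F x - b) by ring.
apply: le_trans (ler_normB _ _) _.
apply: le_trans (lerD (le_trans h1 (ler_wpM2l (ltW e'0) b1)) (le_trans h2 (ler_wpM2l (ltW e'0) b2))) _.
rewrite le_eqVlt; apply/orP; left; apply/eqP; field.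
exact: lt0r_neq0.
Unshelve. all: by end_near. Qed.

(** The second difference along [u] and [w] is symmetric, and after division by [s * s] it tends to
    both iterated derivatives. *)
Lemma derive_comm (F : V -> K) (x u w : V) :
  (\forall y \near x, differentiable F y) ->
  differentiable ('D_u F) x -> differentiable ('D_w F) x ->
  'D_w ('D_u F) x = 'D_u ('D_w F) x.
Proof.
move=> nF du dw; apply/eqP; rewrite -subr_eq0 -normr_le0; apply/ler_addgt0Pr => e e0.
rewrite add0r.
have e2 : 0 < e / 2 by rewrite divr_gt0.
have nd z : \forall y \near x, derivable F y z.
  by apply: filterS nF => y; exact: diff_derivable.
have H1 := second_difference w (nd u) du e2.
have H2 := second_difference u (nd w) dw e2.
have [s [h1 [h2 s0]]] := filter_ex (filterI H1 (filterI H2 (nbhs_right_gt 0))).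
move: h1 h2; rewrite [x + s *: w + s *: u]addrAC.
set A := F _; set B := F _; set C := F _; set D := F _.
set P := 'D_w _ _; set Q := 'D_u _ _ => h1 h2.
rewrite -(@ler_pM2r _ (s * s)) ?mulr_gt0//.
have -> : `|P - Q| * (s * s) = `|(A - C - (B - D) - s * (s * Q)) - (A - B - (C - D) - s * (s * P))|.
  rewrite -[X in _ * X]gtr0_norm ?mulr_gt0// -normrM; congr `|_|; ring.
apply: le_trans (ler_normB _ _) _.
by rewrite [e in leRHS]splitr mulrDl; exact: lerD h2 h1.
Qed.

End Schwarz.

(** * The geodesic equation and changes of charts *)

Section LoweredEquation.
Context {K : realType} {n : nat}.

(* The geodesic equation paired by the metric [G] with a test vector [u]; in this
   form it does not involve the inverse metric. *)
Definition geo_form (G : 'rV[K]_n -> 'M[K]_n) (x v a u : 'rV[K]_n) : K :=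
  (a *m G x *m u^T) 0 0 + (v *m 'D_v G x *m u^T) 0 0
  - 2^-1 * (v *m 'D_u G x *m v^T) 0 0.

(** The Christoffel symbols of the first kind contracted twice with [v], so that
    [a *m G x + lowered_christoffel G x v] is the covariant acceleration with its index lowered. *)
Definition lowered_christoffel (G : 'rV[K]_n -> 'M[K]_n) (x v : 'rV[K]_n) : 'rV[K]_n :=
  \row_l ((v *m 'D_v G x) 0 l - 2^-1 * (v *m 'D_(delta_mx 0 l) G x *m v^T) 0 0).

Lemma derive_delta (W : normedModType K) (G : 'rV[K]_n -> W) x v : differentiable G x ->
  'D_v G x = \sum_a v 0 a *: 'D_(delta_mx 0 a) G x.
Proof.
move=> dG; rewrite deriveE// {1}[v]row_sum_delta linear_sum/=.
by apply: eq_bigr => a _; rewrite linearZ deriveE.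
Qed.

Lemma geo_formE G x v a u : differentiable G x ->
  geo_form G x v a u = ((a *m G x + lowered_christoffel G x v) *m u^T) 0 0.
Proof.
move=> dG; rewrite /geo_form mulmxDl [in RHS]mxE -addrA; congr (_ + _).
rewrite [in RHS]mxE [in X in X - _]mxE.
under [RHS]eq_bigr do rewrite [lowered_christoffel _ _ _ _ _]mxE mulrBl.
rewrite sumrB; congr (_ - _).
rewrite (derive_delta _ dG) mulmx_sumr mulmx_suml summxE mulr_sumr.
apply: eq_bigr => l _.
by rewrite -scalemxAr -scalemxAl [in LHS]mxE [_^T _ _]mxE mulrCA mulrC.
Qed.

Variables (T : topologicalType) (C : charts K n T) (g : tensor C) (i : cidx C) (p : T).
Hypotheses (gsym : (g i p)^T = g i p) (gU : g i p \in unitmx)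
  (cK : cinv i (cmap i p) = p) (dG : differentiable (in_coord g i) (cmap i p)).

Lemma partialE a b c : partial g i p a b c = 'D_(delta_mx 0 a) (in_coord g i) (cmap i p) b c.
Proof. by rewrite derive_mx ?mxE//; exact: diff_derivable. Qed.

(** Contraction with the symmetric [v 0 a * v 0 b] identifies the first two of the three terms of
    [christoffel]; together they absorb the factor [2^-1]. *)
Lemma christoffel_sum (v : 'rV[K]_n) k :
  \sum_(a < n) \sum_(b < n) christoffel g i p k a b * v 0 a * v 0 b =
  (lowered_christoffel (in_coord g i) (cmap i p) v *m invmx (g i p)) 0 k.
Proof.
set G := in_coord g i; set x := cmap i p.
rewrite mxE.
transitivity (\sum_(l < n) invmx (g i p) k l *
   (2^-1 * (\sum_(a < n) \sum_(b < n) (partial g i p a b l + partial g i p b a l - partial g i p l a b) * v 0 a * v 0 b))).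
  under [RHS]eq_bigr do rewrite 2!mulr_sumr.
  rewrite [RHS]exchange_big/=; apply: eq_bigr => a _.
  under [RHS]eq_bigr do rewrite 2!mulr_sumr.
  rewrite [RHS]exchange_big/=; apply: eq_bigr => b _.
  rewrite /christoffel mulr_sumr !mulr_suml; apply: eq_bigr => l _; ring.
apply: eq_bigr => l _; rewrite mulrC; congr (_ * _); last first.
  by rewrite -[in LHS]gsym -trmx_inv mxE.
rewrite mxE.
have E1 : \sum_(a < n) \sum_(b < n) partial g i p a b l * v 0 a * v 0 b = (v *m 'D_v G x) 0 l.
  rewrite exchange_big mxE; apply: eq_bigr => b _ /=.
  rewrite (derive_delta _ dG) summxE mulr_sumr; apply: eq_bigr => a _.
  by rewrite partialE mxE; ring.
have E2 : \sum_(a < n) \sum_(b < n) partial g i p b a l * v 0 a * v 0 b = (v *m 'D_v G x) 0 l.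
  rewrite -E1 exchange_big; apply: eq_bigr => b _ /=; apply: eq_bigr => a _; ring.
have E3 : \sum_(a < n) \sum_(b < n) partial g i p l a b * v 0 a * v 0 b =
    (v *m 'D_(delta_mx 0 l) G x *m v^T) 0 0.
  rewrite mxE exchange_big; apply: eq_bigr => b _ /=.
  rewrite !mxE mulr_suml; apply: eq_bigr => a _.
  by rewrite partialE; ring.
under eq_bigr => a _.
  under eq_bigr do rewrite !mulrBl !mulrDl.
  rewrite sumrB big_split/=; over.
rewrite sumrB big_split/= E1 E2 E3; by field.
Qed.

(** By [geo_formE] the form is the pairing of a fixed row with [u], so it vanishes for all [u]
    exactly when the row does; the invertible metric passes between the lowered row and the raised
    one. *)
Lemma geo_form_christoffel (v a : 'rV[K]_n) :
  (forall k, a 0 k + \sum_(b < n) \sum_(c < n) christoffel g i p k b c * v 0 b * v 0 c = 0) <->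
  (forall u, geo_form (in_coord g i) (cmap i p) v a u = 0).
Proof.
set L := lowered_christoffel (in_coord g i) (cmap i p) v.
have Gx : in_coord g i (cmap i p) = g i p by rewrite /in_coord cK.
split=> H.
- move=> u; rewrite geo_formE// Gx.
  have -> : a *m g i p + L = 0; last by rewrite mul0mx mxE.
  have -> : L = (L *m invmx (g i p)) *m g i p by rewrite mulmxKV.
  rewrite -mulmxDl (_ : a + _ = 0) ?mul0mx//.
  by apply/rowP => k; rewrite !mxE -[RHS](H k) christoffel_sum mxE.
- move=> k; rewrite christoffel_sum.
  have E : a *m g i p + L = 0.
    apply/rowP => l; have := H (delta_mx 0 l); rewrite geo_formE// Gx trmx_delta.
    by rewrite -colE !mxE.
  move: E => /eqP; rewrite addr_eq0 => /eqP E.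
  by rewrite -/L -[L]opprK -E mulNmx mulmxK// mxE subrr.
Qed.

End LoweredEquation.

(** * The paired equation under changes of coordinates *)

Section ChangeOfCoordinates.
Context {K : realType}.

Lemma differentiable_entry {V : normedModType K} m n (F : V -> 'M[K]_(m, n)) x i j :
  differentiable F x -> differentiable (fun y => F y i j) x.
Proof.
move=> dF; apply: (@differentiable_comp _ _ _ _ F (fun M : 'M[K]_(m, n) => M i j)) => //.
exact: differentiable_coord.
Qed.

Lemma derive_entry {V : normedModType K} m n (F : V -> 'M[K]_(m, n)) x v i j :
  differentiable F x -> ('D_v F x) i j = 'D_v (fun y => F y i j) x.
Proof. by move=> dF; rewrite derive_mx ?mxE//; exact: diff_derivable. Qed.

Lemma near_differentiable {V W : normedModType K} (F G : V -> W) x :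
  (\forall y \near x, F y = G y) -> differentiable F x -> differentiable G x.
Proof.
move=> FG dF.
have E : G \o shift x = cst (G x) + 'd F x +o_ 0 id.
  apply/eqaddoP => e e0.
  have /diff_locallyP[_ /eqaddoP/(_ e e0) H] := dF.
  have := FG; rewrite (near_shift 0)/= subr0 => FG0.
  near=> h.
  have -> : (G \o shift x - (cst (G x) + 'd F x)) h = (F \o shift x - (cst (F x) + 'd F x)) h.
    rewrite !fctE/= -(nbhs_singleton FG); congr (_ - _); symmetry.
    by near: h.
  by near: h.
apply/diff_locallyP; have dE := diff_unique (diff_continuous dF) E.
by rewrite dE; split=> //; exact: diff_continuous.
Unshelve. all: by end_near. Qed.

Lemma jacobianE n m (phi : 'rV[K]_n -> 'rV[K]_m) x k l : differentiable phi x ->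
  'J phi x k l = 'D_(delta_mx 0 k) phi x 0 l.
Proof. by move=> dphi; rewrite deriveEjacobian// -rowE [RHS]mxE. Qed.

(** The derivative of the Jacobian in direction [w]: for regular [phi], [u *m hessian phi x w] is
    the second derivative of [phi] in the directions [u] and [w]. *)
Definition hessian n m (phi : 'rV[K]_n -> 'rV[K]_m) x w : 'M[K]_(n, m) :=
  \matrix_(k, l) 'D_w ('D_(delta_mx 0 k) phi) x 0 l.

Lemma hessian_sym n m (phi : 'rV[K]_n -> 'rV[K]_m) x u w :
  (\forall y \near x, differentiable phi y) ->
  (forall z, differentiable ('D_z phi) x) ->
  u *m hessian phi x w = w *m hessian phi x u.
Proof.
move=> nd d2; apply/rowP => l.
have E z y : differentiable phi y -> 'D_z phi y 0 l = 'D_z (fun y => phi y 0 l) y.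
  by move=> dy; rewrite derive_entry.
have S a b : 'D_a ('D_b phi) x 0 l = 'D_b ('D_a phi) x 0 l.
  have N z : \forall y \near x, 'D_z phi y 0 l = 'D_z (fun y => phi y 0 l) y.
    by apply: filterS nd => y; exact: E.
  have E2 c d : 'D_c ('D_d phi) x 0 l = 'D_c ('D_d (fun y => phi y 0 l)) x.
    exact: etrans (derive_entry c 0 l (d2 d)) (near_eq_derive c (N d)).
  have dd z : differentiable ('D_z (fun y => phi y 0 l)) x.
    apply: near_differentiable (differentiable_entry 0 l (d2 z)); exact: N.
  apply: etrans (E2 a b) (etrans _ (esym (E2 b a))).
  apply: derive_comm (dd b) (dd a).
  by apply: filterS nd => y; exact: differentiable_entry.
have D a b : 'D_a ('D_b phi) x 0 l = \sum_k a 0 k * 'D_(delta_mx 0 k) ('D_b phi) x 0 l.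
  by rewrite derive_delta// summxE; apply: eq_bigr => k _; rewrite mxE.
have [B HB symB] : exists2 B : 'I_n -> 'I_n -> K,
    forall (a : 'rV[K]_n) k, hessian phi x a k l = \sum_j a 0 j * B j k & forall j k, B j k = B k j.
  exists (fun j k => 'D_(delta_mx 0 j) ('D_(delta_mx 0 k) phi) x 0 l) => [a k|j k]; last exact: S.
  have H1 : hessian phi x a k l = 'D_a ('D_(delta_mx 0 k) phi) x 0 l by rewrite /hessian mxE.
  exact: etrans H1 (D a _).
clear S D E; move: (hessian phi x) HB => H HB; rewrite [LHS]mxE [RHS]mxE.
under eq_bigr do rewrite HB mulr_sumr.
under [RHS]eq_bigr do rewrite HB mulr_sumr.
rewrite exchange_big; apply: eq_bigr => k _ /=; apply: eq_bigr => b _.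
by rewrite mulrCA symB.
Qed.

Variables (n : nat).
Implicit Types (phi : 'rV[K]_n -> 'rV[K]_n) (G : 'rV[K]_n -> 'M[K]_n).

Lemma is_deriv_in_jacobian phi (A : set K) (c : K -> 'rV[K]_n) t v :
  (\forall y \near c t, differentiable phi y) ->
  (forall z, differentiable ('D_z phi) (c t)) ->
  is_deriv_in A c t v ->
  is_deriv_in A (fun s => 'J phi (c s)) t (hessian phi (c t) v).
Proof.
move=> nd d2 cv; apply/is_deriv_in_mxP => k l; rewrite mxE.
have := is_deriv_in_comp (d2 (delta_mx 0 k)) cv.
move=> /is_deriv_in_mxP/(_ 0 l).
apply: is_deriv_in_near => /=.
  by rewrite jacobianE//; exact: nbhs_singleton nd.
have := cvg_within_near (is_deriv_in_cvg cv) nd.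
by apply: filterS => s H As; rewrite jacobianE//; exact: H.
Qed.

Lemma mulmx_sym_form (M : 'M[K]_n) (a b : 'rV[K]_n) : M^T = M ->
  (a *m M *m b^T) 0 0 = (b *m M *m a^T) 0 0.
Proof.
move=> symM; rewrite -[in LHS](trmxK (a *m M *m b^T)) [in LHS]mxE.
by rewrite !trmx_mul trmxK symM mulmxA.
Qed.

(** All factors are followed along the line [x + s w], where the product rule applies; uniqueness of
    the derivative identifies the result. *)
Lemma derive_pullback phi G G' x w : 
  (\forall y \near x, differentiable phi y) ->
  (forall z, differentiable ('D_z phi) x) ->
  differentiable G x -> differentiable G' (phi x) ->
  (\forall y \near x, G y = 'J phi y *m G' (phi y) *m ('J phi y)^T) ->
  'D_w G x = hessian phi x w *m G' (phi x) *m ('J phi x)^T +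
    'J phi x *m 'D_(w *m 'J phi x) G' (phi x) *m ('J phi x)^T +
    'J phi x *m G' (phi x) *m (hessian phi x w)^T.
Proof.
move=> nd d2 dG dG' E.
pose c := fun s : K => x + s *: w.
have c0 : c 0 = x by rewrite /c scale0r addr0.
have cw : is_deriv_in setT c 0 w by exact: is_deriv_in_affine.
have dphi : differentiable phi x by exact: nbhs_singleton nd.
have H1 : is_deriv_in setT (G \o c) 0 ('D_w G x).
  have dGc : differentiable G (c 0) by rewrite c0.
  by have := is_deriv_in_comp dGc cw; rewrite c0.
have HJ : is_deriv_in setT (fun s => 'J phi (c s)) 0 (hessian phi x w).
  have := @is_deriv_in_jacobian phi setT c 0 w.
  by rewrite c0; exact.
have Hphi : is_deriv_in setT (phi \o c) 0 (w *m 'J phi x).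
  have dpc : differentiable phi (c 0) by rewrite c0.
  by have := is_deriv_in_comp dpc cw; rewrite c0 deriveEjacobian.
have HG' : is_deriv_in setT (G' \o (phi \o c)) 0 ('D_(w *m 'J phi x) G' (phi x)).
  have dGc : differentiable G' ((phi \o c) 0) by rewrite /= c0.
  by have := is_deriv_in_comp dGc Hphi; rewrite /= c0.
apply: (is_deriv_in_unique proper_intervalT I H1).
have := is_deriv_in_mulmx (is_deriv_in_mulmx HJ HG') (is_deriv_in_tr HJ).
rewrite /= c0 mulmxDl; apply: is_deriv_in_near => /=.
  by rewrite c0; symmetry; exact: nbhs_singleton E.
have := cvg_within_near (is_deriv_in_cvg cw); rewrite c0 => /(_ _ E).
by apply: filterS => s H As; split=> //; rewrite H.
Qed.

Lemma mx11D (X Y : 'M[K]_1) : (X + Y) 0 0 = X 0 0 + Y 0 0.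
Proof. by rewrite mxE. Qed.

(** Here [J] stands for the Jacobian, [Hv] and [Hu] for its derivatives. Besides the tensorial
    terms, the product rule produces one term that is absorbed in the new acceleration
    [a *m J + v *m Hv], and three terms equal to [X]: a whole one, and two with coefficient
    [- 2^-1]. *)
Lemma pullback_form_identity (M J Hv Hu Dv Du : 'M[K]_n) (v a u : 'rV[K]_n) : M^T = M ->
  v *m Hu = u *m Hv ->
  (a *m (J *m M *m J^T) *m u^T) 0 0 +
  (v *m (Hv *m M *m J^T + J *m Dv *m J^T + J *m M *m Hv^T) *m u^T) 0 0 -
  2^-1 * (v *m (Hu *m M *m J^T + J *m Du *m J^T + J *m M *m Hu^T) *m v^T) 0 0 =
  ((a *m J + v *m Hv) *m M *m (u *m J)^T) 0 0 +
  (v *m J *m Dv *m (u *m J)^T) 0 0 -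
  2^-1 * (v *m J *m Du *m (v *m J)^T) 0 0.
Proof.
move=> symM HS.
pose X := (v *m J *m M *m (u *m Hv)^T) 0 0.
have e1 : (v *m (Hu *m M *m J^T) *m v^T) 0 0 = X.
  rewrite /X -(mulmx_sym_form (u *m Hv) (v *m J) symM) -HS trmx_mul.
  by rewrite !mulmxA.
have e2 : (v *m (J *m M *m Hu^T) *m v^T) 0 0 = X by rewrite /X -HS trmx_mul !mulmxA.
have e3 : (v *m (J *m M *m Hv^T) *m u^T) 0 0 = X by rewrite /X trmx_mul !mulmxA.
rewrite !(mulmxDr, mulmxDl) !mx11D e1 e2 e3 !trmx_mul !mulmxA.
by field.
Qed.

Lemma geo_form_change phi G G' x v a u :
  (\forall y \near x, differentiable phi y) ->
  (forall z, differentiable ('D_z phi) x) ->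
  differentiable G x -> differentiable G' (phi x) -> (G' (phi x))^T = G' (phi x) ->
  (\forall y \near x, G y = 'J phi y *m G' (phi y) *m ('J phi y)^T) ->
  geo_form G x v a u =
  geo_form G' (phi x) (v *m 'J phi x) (a *m 'J phi x + v *m hessian phi x v) (u *m 'J phi x).
Proof.
move=> nd d2 dG dG' symG' E; rewrite /geo_form.
rewrite !(derive_pullback _ nd d2 dG dG' E) (nbhs_singleton E).
exact: pullback_form_identity (hessian_sym v u nd d2).
Qed.

End ChangeOfCoordinates.

(** * Geodesics in overlapping charts *)

Section ChartGeodesics.
Context {K : realType} {n : nat} {T : topologicalType} (C : charts K n T).
Hypothesis atlasC : smooth_atlas C.

Lemma near_cdom i p : cdom i p -> \forall q \near p, cdom (c := C) i q.
Proof. by have [/(_ i)[oi _] _ _ _] := atlasC; move=> ip; apply: open_nbhs_nbhs. Qed.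

Lemma cmap_cvg i p : cdom (c := C) i p -> cmap i q @[q --> p] --> cmap i p.
Proof.
have [/(_ i)[oi _] _ /(_ i)[ci _] _] := atlasC => ip.
move/subspace_continuousP : ci => /(_ _ ip) ci P /ci.
by apply: (filterS2 _ _ (near_cdom ip)) => q iq; exact.
Qed.

Lemma near_image i p : cdom (c := C) i p -> \forall x \near cmap i p, (cmap i @` cdom i) x.
Proof.
have [/(_ i)[_ oi] _ _ _] := atlasC => ip; apply: open_nbhs_nbhs; split=> //.
Qed.

Lemma cinv_cvg i p : cdom (c := C) i p -> cinv i x @[x --> cmap i p] --> p.
Proof.
have [/(_ i)[_ oi] cK /(_ i)[_ ci] _] := atlasC => ip.
move/subspace_continuousP : ci => /(_ (cmap i p)) ci P Pp.
have : within (cmap i @` cdom i) (nbhs (cmap i p)) (cinv i @^-1` P).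
  by apply: ci; [exists p|rewrite /from_subspace cK].
by apply: (filterS2 _ _ (near_image ip)) => q iq; exact.
Qed.

Lemma image_cinv i x : (cmap i @` cdom (c := C) i) x -> cmap i (cinv i x) = x /\ cdom i (cinv i x).
Proof. by have [_ cK _ _] := atlasC => -[p ip <-]; rewrite cK. Qed.

Lemma near_chart i p (P : set T) : cdom (c := C) i p -> (\forall q \near p, P q) ->
  \forall x \near cmap i p, [/\ cmap i (cinv i x) = x, cdom i (cinv i x) & P (cinv i x)].
Proof.
move=> ip nP; have Pi : \forall x \near cmap i p, P (cinv i x) by exact: cinv_cvg ip _ nP.
by have := near_image ip; apply: filterS2 Pi => x Px /image_cinv[].
Qed.

Variable (g : tensor C).
Hypothesis riemg : riemannian C g.

Lemma metric_unit i p : cdom i p -> g i p \in unitmx.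
Proof.
have [_ pos _ _] := riemg => ip; rewrite -row_free_unit -kermx_eq0.
apply/rowV0P => v /sub_kermxP vg0; have [//|v0] := eqVneq v 0.
by have := pos _ _ ip _ v0; rewrite /qform vg0 mul0mx mxE ltxx.
Qed.

Lemma in_coord_differentiable i p : cdom i p -> differentiable (in_coord g i) (cmap i p).
Proof. by have [_ _ /(_ i)/(_ [::]) sm _] := riemg => ip; apply: sm; exists p. Qed.

Lemma geodesic_eqP i I gam t : cdom i (gam t) ->
  geodesic_eq g i I gam t <->
  forall u, geo_form (in_coord g i) (cmap i (gam t)) (velocity i I gam t)
     (acceleration i I gam t) u = 0.
Proof.
have [sg _ _ _] := riemg; have [_ cK _ _] := atlasC => ip.
apply: geo_form_christoffel; rewrite ?sg ?metric_unit ?cK//.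
exact: in_coord_differentiable.
Qed.

Section Transition.
Variables (i j : cidx C) (p : T).
Hypotheses (ip : cdom i p) (jp : cdom j p).
Let phi : 'rV[K]_n -> 'rV[K]_n := cmap j \o cinv i.

Lemma transition_point : phi (cmap i p) = cmap j p.
Proof. by have [_ cK _ _] := atlasC; rewrite /phi/= cK. Qed.

Lemma near_transition_image : \forall x \near cmap i p, (cmap i @` (cdom i `&` cdom j)) x.
Proof.
have := near_chart ip (near_cdom jp); apply: filterS => x [xE xi xj].
by exists (cinv i x).
Qed.

Lemma transition_differentiable vs :
  \forall x \near cmap i p, differentiable (iter_derive vs phi) x.
Proof.
have [_ _ _ sm] := atlasC; apply: filterS near_transition_image => x xij.
exact: sm.
Qed.

Lemma transition_differentiable1 : \forall x \near cmap i p, differentiable phi x.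
Proof. exact: (transition_differentiable [::]). Qed.

Lemma transition_differentiable2 z : differentiable ('D_z phi) (cmap i p).
Proof. exact: nbhs_singleton (transition_differentiable [:: z]). Qed.

Lemma near_metric_pullback : \forall x \near cmap i p,
  in_coord g i x = 'J phi x *m in_coord g j (phi x) *m ('J phi x)^T.
Proof.
have [_ _ _ tr] := riemg; have [_ cK _ _] := atlasC.
have := near_chart ip (near_cdom jp); apply: filterS => x [xE xi xj].
by rewrite /in_coord {1}(tr _ _ _ xi xj) xE /phi/= cK.
Qed.

Lemma geo_form_transition v a u :
  geo_form (in_coord g i) (cmap i p) v a u =
  geo_form (in_coord g j) (cmap j p) (v *m 'J phi (cmap i p))
   (a *m 'J phi (cmap i p) + v *m hessian phi (cmap i p) v) (u *m 'J phi (cmap i p)).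
Proof.
have [sg _ _ _] := riemg; have [_ cK _ _] := atlasC.
rewrite -transition_point; apply: geo_form_change.
- exact: transition_differentiable1.
- exact: transition_differentiable2.
- exact: in_coord_differentiable.
- by rewrite transition_point; exact: in_coord_differentiable.
- by rewrite transition_point /in_coord cK// sg.
- exact: near_metric_pullback.
Qed.

(** The pullback formula writes the invertible matrix of [g] in the chart [i] as a product with the
    Jacobian as a factor. *)
Lemma transition_jacobian_unit : 'J phi (cmap i p) \in unitmx.
Proof.
have [_ cK _ _] := atlasC.
have := metric_unit ip; have := nbhs_singleton near_metric_pullback.
rewrite /in_coord cK// => ->.
by rewrite !unitmx_mul => /andP[/andP[]].
Qed.

Variables (I : set K) (gam : K -> T) (t : K).
Hypotheses (pI : proper_interval I) (It : I t) (pE : gam t = p)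
  (cg : gam s @[s --> within I (nbhs t)] --> gam t)
  (ni : \forall s \near t, I s -> derivable_in I (cmap i \o gam) s).

(** Stated on a neighbourhood of [t], because the velocity is differentiated once more. *)
Lemma near_velocity_transition : \forall s \near t, I s ->
  is_deriv_in I (cmap j \o gam) s (velocity i I gam s *m 'J phi (cmap i (gam s))).
Proof.
have [_ cK _ _] := atlasC.
have cg' := cg; rewrite pE in cg'.
have ij : \forall s \near t, I s -> cdom i (gam s) /\ cdom j (gam s).
  apply: (cvg_within_near (P := fun q => cdom i q /\ cdom j q) cg').
  by apply: filterI; exact: near_cdom.
have dphi : \forall s \near t, I s -> differentiable phi (cmap i (gam s)).
  apply: (cvg_within_near (P := fun q => differentiable phi (cmap i q)) cg').
  exact: (cmap_cvg ip transition_differentiable1).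
have /near_join ij' := ij.
near=> s => Is.
have ds : differentiable phi ((cmap i \o gam) s) by move: Is; near: s.
have nis : derivable_in I (cmap i \o gam) s by move: Is; near: s.
have := is_deriv_in_comp ds (derivable_in_is_deriv pI Is nis).
rewrite deriveEjacobian//; apply: is_deriv_in_near => /=.
  have [ii _] : cdom i (gam s) /\ cdom j (gam s) by move: Is; near: s.
  by rewrite /phi/= cK.
have : \forall s' \near s, I s' -> cdom i (gam s') /\ cdom j (gam s') by near: s.
by apply: filterS => s' H Is'; split=> //; rewrite /phi/= cK//; case: (H Is').
Unshelve. all: by end_near. Qed.

Hypotheses (d2 : derivable_in I (velocity i I gam) t)
  (eq_i : geodesic_eq g i I gam t) (unit_i : qform g i (gam t) (velocity i I gam t) = 1).

(** This is what allows a curve constructed in one chart to be checked there only: at a given time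
    the conditions pass from the chart [i] to any other chart [j] at the same point. *)
Lemma geodesic_transition : 
  [/\ derivable_in I (cmap j \o gam) t,
      derivable_in I (velocity j I gam) t,
      geodesic_eq g j I gam t &
      qform g j (gam t) (velocity j I gam t) = 1].
Proof.
have [sg _ _ _] := riemg; have [_ cK _ _] := atlasC.
have nv := near_velocity_transition.
have it := nbhs_singleton nv It; rewrite pE in it.
have vE : \forall s \near t, I s -> velocity j I gam s = velocity i I gam s *m 'J phi (cmap i (gam s)).
  by apply: filterS nv => s /[swap] Is /(_ Is); exact: is_deriv_inE.
have vt : velocity j I gam t = velocity i I gam t *m 'J phi (cmap i p).
  by rewrite (nbhs_singleton vE It) pE.
have ai : is_deriv_in I (velocity i I gam) t (acceleration i I gam t).
  exact: derivable_in_is_deriv.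
have vi : is_deriv_in I (cmap i \o gam) t (velocity i I gam t).
  by apply: derivable_in_is_deriv => //; exact: nbhs_singleton ni It.
have cit : (cmap i \o gam) t = cmap i p by rewrite /= pE.
have aj : is_deriv_in I (velocity j I gam) t
   (acceleration i I gam t *m 'J phi (cmap i p) +
    velocity i I gam t *m hessian phi (cmap i p) (velocity i I gam t)).
  have := @is_deriv_in_jacobian _ _ phi I (cmap i \o gam) t (velocity i I gam t).
  rewrite cit => /(_ transition_differentiable1 transition_differentiable2 vi) H.
  have := is_deriv_in_mulmx ai H; rewrite /= pE.
  apply: is_deriv_in_near; first by rewrite vt pE.
  by apply: filterS vE => s H1 Is; split; [exact: Is|exact: esym (H1 Is)].
split.
- by eexists; exact: it.
- by eexists; exact: aj.
- apply/geodesic_eqP; first by rewrite pE.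
  rewrite /acceleration (is_deriv_inE pI It aj) pE vt => u.
  have /geodesic_eqP := eq_i; rewrite pE => /(_ ip) E.
  (* The Jacobian is invertible, so each test vector in the chart [j] is the image of one in the
     chart [i]. *)
  rewrite -[u](mulmxKV transition_jacobian_unit) -geo_form_transition.
  exact: E.
- move: unit_i; rewrite /qform pE vt => <-.
  have := nbhs_singleton near_metric_pullback.
  rewrite transition_point /in_coord !cK// => ->.
  by rewrite trmx_mul !mulmxA.
Qed.

End Transition.
End ChartGeodesics.

(** * Local existence of geodesics *)

Section Primitives.
Context {K : realType}.

(** The retraction of the line onto [[a, b]]; composition with it extends continuous functions from
    a segment to the line. *)
Definition clamp (a b t : K) : K := Num.max a (Num.min b t).

Lemma clamp_in a b t : a <= b -> a <= clamp a b t <= b.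
Proof. by move=> ab; rewrite /clamp le_max lexx/= ge_max ab ge_min lexx. Qed.

Lemma clamp_id a b t : a <= t <= b -> clamp a b t = t.
Proof. by move=> /andP[at_ tb]; rewrite /clamp (min_idPr tb) (max_idPr at_). Qed.

Lemma clamp_lipschitz a b s t : a <= b -> `|clamp a b s - clamp a b t| <= `|s - t|.
Proof.
wlog st : s t / s <= t => [H ab|ab].
  by have [st|/ltW st] := leP s t; [|rewrite distrC (distrC s)]; exact: H.
rewrite /clamp /Num.max /Num.min (distrC s) (ger0_norm (x := t - s)) ?subr_ge0// ler_norml.
by repeat case: ifPn; rewrite -?leNgt => *; apply/andP; split; lra.
Qed.

Lemma clamp_continuous a b : a <= b -> continuous (clamp a b).
Proof.
move=> ab t; apply/cvgrPdist_le => e e0; near=> s.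
apply: le_trans (clamp_lipschitz _ _ ab) _.
by near: s; apply: cvgr_dist_le => //; exact: cvg_id.
Unshelve. all: by end_near. Qed.

Lemma comp_clamp_continuous (T : topologicalType) (w : K -> T) a b : a <= b ->
  {within `[a, b], continuous w} -> continuous (w \o clamp a b).
Proof.
move=> ab /subspace_continuousP cw t.
have /cw : `[a, b]%classic (clamp a b t) by rewrite /= in_itv/= clamp_in.
move=> cw'; have {cw'}cwt : w x @[x --> within `[a, b] (nbhs (clamp a b t))] --> w (clamp a b t) by exact: cw'.
move=> P Pw.
have := clamp_continuous ab (cvg_within_near cwt Pw).
rewrite nbhs_simpl /=; apply: filterS => s /=; apply.
by rewrite in_itv/= clamp_in.
Qed.

Lemma primitive_segment (w : K -> K) a b t0 : a <= b -> a <= t0 <= b ->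
  {within `[a, b], continuous w} ->
  exists2 W, W t0 = 0 & forall t, a <= t <= b -> is_deriv_in `[a, b] W t (w t).
Proof.
move=> ab t0ab /(comp_clamp_continuous ab).
set wc := w \o clamp a b => cwc.
pose mu := @lebesgue_measure K.
(* Integration starts at [a - 1] so that every point of [[a, b]], the end [a] included, is interior
   to the segment of integrability. *)
pose Phi := fun x => (\int[mu]_(t in `[a - 1, x]) wc t)%R.
exists (fun x => Phi x - Phi t0); first by rewrite subrr.
move=> t tab; rewrite -[w t]subr0; apply: is_deriv_inB; last exact: is_deriv_in_cst.
have intw : mu.-integrable `[a - 1, b + 1] (EFin \o wc).
  apply: continuous_compact_integrable; first exact: segment_compact.
  exact: continuous_subspaceT.
have t1 : t < b + 1 by move: tab => /andP[_ tb]; lra.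
have at1 : a - 1 < t by move: tab => /andP[ta _]; lra.
have [dP PE] := continuous_FTC1_closed t1 intw at1 (cwc t).
have := @is_deriv_in_line K _ _ `[a, b] Phi 0 1 t.
rewrite add0r [t *: 1]mulr1 => /(_ dP); rewrite -derive1E PE /wc/= clamp_id//.
rewrite (_ : (fun s => Phi _) = Phi)//.
by apply/funext => s; rewrite add0r [_ *: 1]mulr1.
Qed.

(** If [I] has points beyond [t], the segment is taken past [t]; otherwise it may end at [t]. Either
    way it is a neighbourhood of [t] relative to [I], which turns results on compact segments into
    local results on [I]. *)
Lemma near_sub_segment (I : set K) t t0 : I t -> I t0 -> 
  exists a b, [/\ I a, I b, a <= t0 <= b, a <= t <= b & \forall s \near t, I s -> a <= s <= b].
Proof.
move=> It It0.
have [b [Ib bt bt0 nb]] : exists b, [/\ I b, t <= b, t0 <= b & \forall s \near t, I s -> s <= b].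
  have [[s [Is ts]]|H] := pselect (exists s, I s /\ t < s).
    exists (Num.max s t0); split; rewrite ?le_max ?lexx ?orbT ?(ltW ts)//.
      by rewrite /Num.max; case: ifP.
    near=> x => _; rewrite le_max; apply/orP; left; apply: ltW; near: x.
    exact: lt_nbhsl.
  exists t; split=> //.
    by rewrite leNgt; apply/negP => tt0; apply: H; exists t0.
  by near=> x => Ix; rewrite leNgt; apply/negP => tx; apply: H; exists x.
have [a [Ia at_ at0 na]] : exists a, [/\ I a, a <= t, a <= t0 & \forall s \near t, I s -> a <= s].
  have [[s [Is ts]]|H] := pselect (exists s, I s /\ s < t).
    exists (Num.min s t0); split; rewrite ?ge_min ?lexx ?orbT ?(ltW ts)//.
      by rewrite /Num.min; case: ifP.
    near=> x => _; rewrite ge_min; apply/orP; left; apply: ltW; near: x.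
    exact: lt_nbhsr.
  exists t; split=> //.
    by rewrite leNgt; apply/negP => tt0; apply: H; exists t0.
  by near=> x => Ix; rewrite leNgt; apply/negP => tx; apply: H; exists x.
exists a, b; split; rewrite ?at_ ?bt ?at0 ?bt0//.
by apply: filterS2 na nb => s ha hb Is; rewrite ha// hb.
Unshelve. all: by end_near. Qed.

Lemma primitive_unique (A : set K) (w W W' : K -> K) t0 : is_interval A -> A t0 ->
  (forall t, A t -> is_deriv_in A W t (w t)) ->
  (forall t, A t -> is_deriv_in A W' t (w t)) -> W t0 = W' t0 ->
  forall t, A t -> W t = W' t.
Proof.
move=> iA At0 HW HW' E t At; apply/eqP; rewrite -subr_eq0; apply/eqP.
have <- : W t0 - W' t0 = 0 by rewrite E subrr.
apply: (@cst_MVT_in K A (fun s => W s - W' s)) => // s As.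
by rewrite -(subrr (w s)); apply: is_deriv_inB; auto.
Qed.

Lemma primitive_interval (I : set K) (w : K -> K) t0 : is_interval I -> I t0 ->
  {within I, continuous w} ->
  exists2 W, W t0 = 0 & forall t, I t -> is_deriv_in I W t (w t).
Proof.
move=> iI It0 cw.
have subI a b : I a -> I b -> `[a, b] `<=` I.
  by move=> Ia Ib s; rewrite /= in_itv/=; exact: iI.
have P a b : exists W, I a -> I b -> a <= t0 <= b ->
    W t0 = 0 /\ forall t, a <= t <= b -> is_deriv_in `[a, b] W t (w t).
  have [[[Ia Ib] t0ab]|H] := pselect ((I a /\ I b) /\ a <= t0 <= b); last first.
    by exists (fun=> 0) => Ia Ib ab; case: H.
  have ab : a <= b by move: t0ab => /andP[]; exact: le_trans.
  have [|W W0 HW] := @primitive_segment w a b t0 ab t0ab.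
    by apply: continuous_subspaceW cw; exact: subI.
  by exists W.
pose Phi a b := sval (cid (P a b)).
have PhiP a b : I a -> I b -> a <= t0 <= b -> Phi a b t0 = 0 /\
    forall t, a <= t <= b -> is_deriv_in `[a, b] (Phi a b) t (w t).
  exact: (svalP (cid (P a b))).
(* The value at [t] is read on the smallest segment containing [t0] and [t]; by uniqueness of
   primitives every larger segment gives the same value. *)
pose tau t := Phi (Num.min t0 t) (Num.max t0 t) t.
have tauE a b t : I a -> I b -> a <= t0 <= b -> a <= t <= b -> tau t = Phi a b t.
  move=> Ia Ib t0ab tab; rewrite /tau.
  set a' := Num.min _ _; set b' := Num.max _ _.
  have It : I t by exact: (iI a b).
  have Ia' : I a' by rewrite /a' /Num.min; case: ifP.
  have Ib' : I b' by rewrite /b' /Num.max; case: ifP.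
  have t0' : a' <= t0 <= b' by rewrite ge_min le_max lexx.
  have t' : a' <= t <= b' by rewrite ge_min le_max lexx !orbT.
  have [E1 H1] := PhiP _ _ Ia Ib t0ab; have [E2 H2] := PhiP _ _ Ia' Ib' t0'.
  apply: (@primitive_unique `[a', b'] w _ _ t0).
  - exact: interval_is_interval.
  - by rewrite /= in_itv.
  - by move=> s; rewrite /= in_itv/=; exact: H2.
  - move=> s; rewrite /= in_itv/= => sab'.
    move: t0ab tab sab' => /andP[x1 x2] /andP[y1 y2] /andP[z1 z2].
    have xa : a <= a' by rewrite le_min x1.
    have xb : b' <= b by rewrite ge_max x2.
    apply: (@is_deriv_inS _ _ `[a, b]).
      move=> r /=; rewrite !in_itv/= => /andP[r1 r2].
      by rewrite (le_trans xa)// (le_trans r2).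
    by apply: H1; rewrite (le_trans xa)// (le_trans z2).
  - by rewrite E1 E2.
  - by rewrite /= in_itv.
exists tau; first by rewrite /tau minxx maxxx; by apply: (PhiP _ _ _ _ _).1 => //; rewrite lexx.
move=> t It; have [a [b [Ia Ib t0ab tab nt]]] := near_sub_segment It It0.
have [_ /(_ _ tab)] := PhiP _ _ Ia Ib t0ab.
apply: is_deriv_in_near; first by rewrite -(tauE a b).
by apply: filterS nt => s H Is; rewrite /= in_itv/= -(tauE a b)//; [split=> //; exact: H|exact: H].
Qed.

End Primitives.

(** * The Picard-Lindelof theorem *)

Section Picard.
Context {K : realType}.

Lemma lip_continuous {V W : normedModType K} (F : V -> W) (L : K) : 0 < L ->
  (forall x y, `|F x - F y| <= L * `|x - y|) -> continuous F.
Proof.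
move=> L0 lipF x; apply/cvgrPdist_le => e e0; near=> y.
apply: le_trans (lipF _ _) _; rewrite mulrC -ler_pdivlMr//.
by near: y; apply: cvgr_dist_le; [exact: cvg_id|exact: divr_gt0].
Unshelve. all: by end_near. Qed.

Lemma geometric_small (C e : K) : 0 <= C -> 0 < e -> exists k, 2 * C * 2^-1 ^+ k <= e.
Proof.
move=> C0 e0; have C1 : 0 < 2 * C + 1 by rewrite ltr_wpDl// mulr_ge0.
have : (2^-1 : K) ^+ k @[k --> \oo] --> 0 by apply: cvg_expr; rewrite gtr0_norm//; lra.
move=> /cvgrPdist_le/(_ _ (divr_gt0 e0 C1)) [N _ /(_ N (leqnn N))] /=.
rewrite sub0r normrN ger0_norm ?exprn_ge0// ler_pdivlMr// => H; exists N.
by apply: le_trans H; rewrite mulrC ler_wpM2l ?exprn_ge0//; lra.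
Qed.

(** Telescoping: a tail of the geometric series of ratio [2^-1] is twice its first term, whence the
    explicit rate [2 * C]. *)
Lemma geometric_limit m (a : nat -> 'rV[K]_m) C : (forall k, `|a k.+1 - a k| <= C * 2^-1 ^+ k) ->
  exists l, forall k, `|a k - l| <= 2 * C * 2^-1 ^+ k.
Proof.
move=> H.
have C0 : 0 <= C by have := le_trans (normr_ge0 _) (H 0); rewrite expr0 mulr1.
have H2 k j : `|a (k + j)%N - a k| <= 2 * C * 2^-1 ^+ k - 2 * C * 2^-1 ^+ (k + j).
  elim: j => [|j IH]; first by rewrite addn0 !subrr normr0.
  rewrite addnS -(subrKA (a (k + j)%N)); apply: le_trans (ler_normD _ _) _.
  by have := H (k + j)%N; rewrite exprS; set y := 2^-1 ^+ (k + j) in IH *; lra.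
have H3 k j : (k <= j)%N -> `|a j - a k| <= 2 * C * 2^-1 ^+ k.
  move=> /subnKC <-; apply: le_trans (H2 k _) _.
  by rewrite lerBlDr lerDl !mulr_ge0// exprn_ge0.
have : cvg (a @ \oo).
  apply/cauchy_cvgP/cauchy_exP => e /= e0.
  have e2 : 0 < e / 2 by rewrite divr_gt0.
  have [N HN] := geometric_small C0 e2.
  exists (a N); rewrite /= nbhs_simpl/=; exists N => // j /= Nj.
  by rewrite -ball_normE/= distrC; apply: le_lt_trans (H3 _ _ Nj) _; lra.
move=> /cvg_ex[l /cvgrPdist_le al]; exists l => k; apply/ler_addgt0Pr => e e0.
have [N _ HN] := al e e0.
have h := HN (maxn N k) (leq_maxl _ _); have h' := H3 k (maxn N k) (leq_maxr _ _).
rewrite distrC -(subrKA (a (maxn N k))) addrC.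
by apply: le_trans (ler_normD _ _) _; exact: lerD.
Qed.

Variables (m : nat) (F : 'rV[K]_m -> 'rV[K]_m) (L : K) (z0 : 'rV[K]_m) (t0 : K).
Hypotheses (L0 : 0 < L) (lipF : forall x y, `|F x - F y| <= L * `|x - y|).

Lemma primitive_rV (u : K -> 'rV[K]_m) : continuous u ->
  exists2 W : K -> 'rV[K]_m, W t0 = 0 & forall t, is_deriv_in setT W t (u t).
Proof.
move=> cu.
have P j : exists W, W t0 = 0 /\ forall t, is_deriv_in setT W t (u t 0 j).
  have [|||W W0 HW] := @primitive_interval K setT (fun t => u t 0 j) t0.
  - by move=> *.
  - by [].
  - apply: continuous_subspaceT => t.
    apply: (@continuous_comp _ _ _ u (fun M : 'rV[K]_m => M 0 j)); [exact: cu|].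
    exact: coord_continuous.
  - by exists W; split=> // t; exact: HW.
pose W t := \row_j sval (cid (P j)) t.
exists W.
  by apply/rowP => j; rewrite /W !mxE; case: (svalP (cid (P j))).
move=> t; apply/is_deriv_in_mxP => i j; rewrite ord1.
have [_ /(_ t)] := svalP (cid (P j)).
by rewrite /W; under [in X in _ -> X]eq_fun do rewrite mxE.
Qed.

(** With this radius [eps * L] is [2^-1]: one step of the iteration halves the distance between two
    iterates. *)
Let eps : K := (2 * L)^-1.

Let eps0 : 0 < eps. Proof. by rewrite invr_gt0 mulr_gt0. Qed.

Lemma deriv_bound (W w : K -> 'rV[K]_m) B : 0 <= B -> W t0 = 0 ->
  (forall t, is_deriv_in setT W t (w t)) ->
  (forall t, `|t - t0| <= eps -> `|w t| <= B) -> forall t, `|t - t0| <= eps -> `|W t| <= eps * B.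
Proof.
move=> B0 W0 HW Hw t tt; have e0 := ltW eps0.
pose A := `[t0 - eps, t0 + eps]%classic.
have AE s : A s <-> `|s - t0| <= eps.
  by rewrite /A /= in_itv/= ler_norml; split=> /andP[? ?]; apply/andP; split; lra.
have := @lipschitz_of_deriv_bound _ _ A W w B (@interval_is_interval _ _) B0
  (fun s _ => is_deriv_inS (@subsetT _ _) (HW s)) (fun s As => Hw s ((AE s).1 As)) t t0.
rewrite W0 subr0 mulrC => /(_ ((AE t).2 tt)) H; apply: le_trans (H _) _.
  by apply/AE; rewrite subrr normr0.
by rewrite ler_wpM2r.
Qed.

Lemma deriv_continuous (W w : K -> 'rV[K]_m) :
  (forall t, is_deriv_in setT W t (w t)) -> continuous W.
Proof.
move=> HW t P Pt; have := cvg_within_near (is_deriv_in_cvg (HW t)) Pt.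
by rewrite nbhs_simpl/=; apply: filterS => s; exact.
Qed.

(** Successive approximation. As [F] is globally Lipschitz, all iterates are defined on the whole
    line, while the estimates concern the times within [eps] of [t0]. *)
Lemma picard_lindelof : exists z : K -> 'rV[K]_m,
  z t0 = z0 /\ forall t, `|t - t0| <= eps -> is_deriv_in setT z t (F (z t)).
Proof.
(* The premise of continuity stands inside the existential, so that [choice] yields a Picard map
   defined on all functions, with irrelevant values at discontinuous ones. *)
have step (u : K -> 'rV[K]_m) : exists W, continuous u -> [/\ W t0 = z0, continuous W &
    forall t, is_deriv_in setT W t (F (u t))].
  have [cu|ncu] := pselect (continuous u); last by exists u.
  have [|W W0 HW] := @primitive_rV (F \o u).
    by move=> t; apply: continuous_comp; [exact: cu|exact: (lip_continuous L0 lipF)].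
  have HW' t : is_deriv_in setT (fun t => z0 + W t) t (F (u t)).
    by rewrite -[F _]add0r; apply: is_deriv_inD; [exact: is_deriv_in_cst|exact: HW].
  exists (fun t => z0 + W t) => _; split=> //; first by rewrite W0 addr0.
  exact: deriv_continuous HW'.
have [P HP] := choice step.
pose z k := iter k P (fun=> z0).
have cz k : continuous (z k).
  elim: k => [|k IH] /=; first exact: cst_continuous.
  by have [] := HP _ IH.
have dz k t : is_deriv_in setT (z k.+1) t (F (z k t)) by have [_ _] := HP _ (cz k); exact.
have zt0 k : z k t0 = z0 by case: k => [//|k]; have [] := HP _ (cz k).
pose C := eps * `|F z0|.
have C0 : 0 <= C by rewrite mulr_ge0// ltW.
have Hz k t : `|t - t0| <= eps -> `|z k.+1 t - z k t| <= C * 2^-1 ^+ k.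
  elim: k t => [|k IH] t tt.
    rewrite expr0 mulr1.
    have := @deriv_bound (fun t => z 1 t - z 0 t) (fun t => F z0 - 0) `|F z0| (normr_ge0 _).
    apply => //.
    - by rewrite !zt0 subrr.
    - by move=> s; apply: is_deriv_inB; [exact: dz|exact: is_deriv_in_cst].
    - by move=> s _; rewrite subr0.
  have -> : C * 2^-1 ^+ k.+1 = eps * (L * (C * 2^-1 ^+ k)).
    rewrite exprS /eps; field; exact: lt0r_neq0.
  have := @deriv_bound (fun t => z k.+2 t - z k.+1 t) (fun t => F (z k.+1 t) - F (z k t)) (L * (C * 2^-1 ^+ k)).
  apply => //.
  - by rewrite !mulr_ge0// ?exprn_ge0// ltW.
  - by rewrite !zt0 subrr.
  - by move=> s; apply: is_deriv_inB; exact: dz.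
  - by move=> s ss; apply: le_trans (lipF _ _) _; rewrite ler_pM2l// IH.
clearbody C.
have lim t : exists l : 'rV[K]_m, `|t - t0| <= eps -> forall k, `|z k t - l| <= 2 * C * 2^-1 ^+ k.
  have [tt|ntt] := pselect (is_true (`|t - t0| <= eps)); last by exists 0.
  by have [l Hl] := geometric_limit (fun k => Hz k t tt); exists l.
have [zl Hzl] := choice lim.
pose cl := clamp (t0 - eps) (t0 + eps).
have cl_in t : `|cl t - t0| <= eps.
  have : t0 - eps <= cl t <= t0 + eps by apply: clamp_in; have := eps0; lra.
  by rewrite ler_norml => /andP[? ?]; apply/andP; split; lra.
have cl_id t : `|t - t0| <= eps -> cl t = t.
  by rewrite ler_norml => /andP[? ?]; apply: clamp_id; apply/andP; split; lra.
(* The limit [zl] is controlled only within [eps] of [t0]; freezing it outside gives a continuous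
   function, to which the Picard map applies. *)
pose zh := zl \o cl.
have czh : continuous zh.
  move=> t; apply/cvgrPdist_le => e e0.
  have e3 : 0 < e / 3 by rewrite divr_gt0.
  have [k Hk] := geometric_small C0 e3.
  have ccl : continuous (z k \o cl).
    move=> s; apply: continuous_comp; last exact: cz.
    by apply: clamp_continuous; have := eps0; lra.
  have /cvgrPdist_le/(_ _ e3) := ccl t; apply: filterS => s /= Hs.
  have h1 := le_trans (Hzl _ (cl_in t) k) Hk.
  have h2 := le_trans (Hzl _ (cl_in s) k) Hk.
  rewrite /zh/= -(subrKA (z k (cl t))) -[X in _ + X](subrKA (z k (cl s))).
  rewrite distrC in h1.
  apply: le_trans (ler_normD _ _) _; apply: le_trans (lerD h1 (ler_normD _ _)) _.
  by have := lerD Hs h2; lra.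
have [y0 cy dy] := HP _ czh.
exists (P zh); split=> // t tt.
(* It remains to see that [zh] is a fixed point near [t0]: by [yz] and [Hzl] both sides are limits
   of the iterates. *)
suff yE : P zh t = zh t by rewrite [X in F X]yE; exact: dy.
have yz k s : `|s - t0| <= eps -> `|P zh s - z k.+1 s| <= eps * (L * (2 * C * 2^-1 ^+ k)).
  move=> ss.
  have := @deriv_bound (fun t => P zh t - z k.+1 t) (fun t => F (zh t) - F (z k t)) (L * (2 * C * 2^-1 ^+ k)).
  apply => //.
  - by rewrite !mulr_ge0// ?exprn_ge0// ltW.
  - by rewrite y0 zt0 subrr.
  - by move=> r; apply: is_deriv_inB; [exact: dy|exact: dz].
  - move=> r rr; apply: le_trans (lipF _ _) _; rewrite ler_pM2l//.
    by rewrite /zh/= cl_id// distrC; exact: Hzl.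
apply/eqP; rewrite -subr_eq0 -normr_le0; apply/ler_addgt0Pr => e e0; rewrite add0r.
have e2 : 0 < e / 2 by rewrite divr_gt0.
have [k Hk] := geometric_small C0 e2.
rewrite -(subrKA (z k.+1 t)).
apply: le_trans (ler_normD _ _) _; rewrite [e in leRHS]splitr.
apply: lerD.
  apply: le_trans (yz k t tt) _; apply: le_trans _ Hk.
  rewrite mulrA (_ : eps * L = 2^-1) ?ler_piMl//; [|lra|].
    by rewrite !mulr_ge0// exprn_ge0.
  by rewrite /eps; field; exact: lt0r_neq0.
rewrite /zh/= cl_id//; apply: le_trans (Hzl _ tt k.+1) _; apply: le_trans _ Hk.
rewrite exprS; have : 0 <= 2 * C * 2^-1 ^+ k by rewrite !mulr_ge0// exprn_ge0.
lra.
Qed.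

End Picard.

(** * Locally Lipschitz functions and local solutions *)

Section LocallyLipschitz.
Context {K : realType}.

Lemma near_forall {V : topologicalType} {I : finType} (x : V) (P : I -> V -> Prop) :
  (forall i, \forall y \near x, P i y) -> \forall y \near x, forall i, P i y.
Proof. by move=> H; apply: filter_forall. Qed.

(** This class contains the entries of a smooth metric and of its derivatives and is closed under
    sums, products, inverses and determinants; hence it contains the geodesic field written by
    Cramer's rule. *)
Definition locally_lipschitz {V : normedModType K} (u : V -> K) (x0 : V) : Prop :=
  exists L U, [/\ 0 <= L, nbhs x0 U & forall x y, U x -> U y -> `|u x - u y| <= L * `|x - y|].

Section Closure.
Context {V : normedModType K}.
Implicit Types (u w : V -> K).

Lemma locally_lipschitz_cvg u (x0 : V) : locally_lipschitz u x0 -> u x @[x --> x0] --> u x0.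
Proof.
move=> [L [U [L0 nU H]]]; apply/cvgrPdist_le => e e0.
have L1 : 0 < L + 1 by rewrite ltr_wpDl.
have nx : \forall x \near x0, `|x0 - x| <= e / (L + 1).
  apply/nbhs_ballP; exists (e / (L + 1)); first exact: divr_gt0.
  by move=> x; rewrite -ball_normE/= => /ltW.
have Ux0 := nbhs_singleton nU.
apply: filterS2 nU nx => x Ux xe.
apply: le_trans (H _ _ Ux0 Ux) _.
apply: (@le_trans _ _ ((L + 1) * `|x0 - x|)); first by rewrite ler_wpM2r// lerDl.
by rewrite mulrC -ler_pdivlMr.
Qed.

Lemma near_norm_bound {W : normedModType K} (F : V -> W) (x0 : V) :
  F x @[x --> x0] --> F x0 -> \forall x \near x0, `|F x| <= `|F x0| + 1.
Proof.
move=> /cvgrPdist_le/(_ 1 ltr01); apply: filterS => x vx.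
rewrite -lerBlDl; apply: le_trans vx; rewrite distrC.
exact: le_trans (ler_norm _) (ler_dist_dist _ _).
Qed.

Lemma locally_lipschitz_bounded u (x0 : V) :
  locally_lipschitz u x0 -> \forall x \near x0, `|u x| <= `|u x0| + 1.
Proof. by move/locally_lipschitz_cvg; exact: near_norm_bound. Qed.

Lemma locally_lipschitz_near u w (x0 : V) : (\forall x \near x0, u x = w x) ->
  locally_lipschitz u x0 -> locally_lipschitz w x0.
Proof.
move=> E [L [U [L0 nU H]]]; exists L, (U `&` [set x | u x = w x]); split=> //.
  exact: filterI.
by move=> x y [Ux <-] [Uy <-]; exact: H.
Qed.

Lemma locally_lipschitz_cst c (x0 : V) : locally_lipschitz (fun=> c) x0.
Proof.
exists 0, setT; split=> //; first exact: filterT.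
by move=> x y _ _; rewrite subrr normr0 mul0r.
Qed.

Lemma locally_lipschitzD u w (x0 : V) : locally_lipschitz u x0 -> locally_lipschitz w x0 ->
  locally_lipschitz (fun x => u x + w x) x0.
Proof.
move=> [L [U [L0 nU H]]] [M [W [M0 nW H']]].
exists (L + M), (U `&` W); split; [exact: addr_ge0|exact: filterI|].
move=> x y [Ux Wx] [Uy Wy]; rewrite opprD addrACA mulrDl.
by apply: le_trans (ler_normD _ _) _; rewrite lerD// ?H ?H'.
Qed.

Lemma locally_lipschitzM u w (x0 : V) : locally_lipschitz u x0 -> locally_lipschitz w x0 ->
  locally_lipschitz (fun x => u x * w x) x0.
Proof.
move=> uL wL.
have nu := locally_lipschitz_bounded uL; have nw := locally_lipschitz_bounded wL.
move: uL wL => [L [U [L0 nU H]]] [M [W [M0 nW H']]].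
exists (L * (`|w x0| + 1) + (`|u x0| + 1) * M),
  ((U `&` W) `&` ([set x | `|u x| <= `|u x0| + 1] `&` [set x | `|w x| <= `|w x0| + 1])).
split; [by rewrite addr_ge0// mulr_ge0// addr_ge0|by do 2!apply: filterI|].
move=> x y [[Ux Wx] [bu bw]] [[Uy Wy] [bu' bw']].
have -> : u x * w x - u y * w y = (u x - u y) * w x + u y * (w x - w y) by ring.
apply: le_trans (ler_normD _ _) _; rewrite !normrM mulrDl; apply: lerD.
  by rewrite mulrAC; apply: ler_pM => //; exact: H.
by rewrite -mulrA; apply: ler_pM => //; exact: H'.
Qed.

Lemma locally_lipschitzN u (x0 : V) : locally_lipschitz u x0 -> locally_lipschitz (fun x => - u x) x0.
Proof.
move=> [L [U [L0 nU H]]]; exists L, U; split=> // x y Ux Uy.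
by rewrite -opprD normrN; exact: H.
Qed.

Lemma locally_lipschitzV u (x0 : V) : u x0 != 0 -> locally_lipschitz u x0 ->
  locally_lipschitz (fun x => (u x)^-1) x0.
Proof.
move=> u0 uL; have c := locally_lipschitz_cvg uL.
have u2 : 0 < `|u x0| / 2 by rewrite divr_gt0// normr_gt0.
have nb : \forall x \near x0, `|u x0| / 2 <= `|u x|.
  move/cvgrPdist_le/(_ _ u2) : c; apply: filterS => x h.
  have := ler_dist_dist (u x0) (u x); have := ler_norm (`|u x0| - `|u x|); lra.
move: uL => [L [U [L0 nU H]]].
exists (L / ((`|u x0| / 2) * (`|u x0| / 2))), (U `&` [set x | `|u x0| / 2 <= `|u x|]).
split; [by rewrite divr_ge0// mulr_ge0// ltW|exact: filterI|].
move=> x y [Ux bx] [Uy b_y].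
have x0' : u x != 0 by rewrite -normr_gt0 (lt_le_trans u2).
have y0' : u y != 0 by rewrite -normr_gt0 (lt_le_trans u2).
have -> : (u x)^-1 - (u y)^-1 = (u y - u x) / (u x * u y) by field; rewrite x0' y0'.
rewrite normrM normfV normrM mulrAC distrC; apply: ler_pM => //; first exact: H.
by rewrite lef_pV2 ?posrE ?mulr_gt0 ?normr_gt0//; apply: ler_pM => //; exact: ltW.
Qed.

Lemma locally_lipschitz_sum (I : Type) (r : seq I) (P : pred I) (u : I -> V -> K) (x0 : V) :
  (forall i, locally_lipschitz (u i) x0) ->
  locally_lipschitz (fun x => \sum_(i <- r | P i) u i x) x0.
Proof.
move=> H; elim: r => [|i r IH].
  by under eq_fun do rewrite big_nil; exact: locally_lipschitz_cst.
under eq_fun do rewrite big_cons; case: (P i) => //.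
exact: locally_lipschitzD.
Qed.

Lemma locally_lipschitz_prod (I : Type) (r : seq I) (P : pred I) (u : I -> V -> K) (x0 : V) :
  (forall i, locally_lipschitz (u i) x0) ->
  locally_lipschitz (fun x => \prod_(i <- r | P i) u i x) x0.
Proof.
move=> H; elim: r => [|i r IH].
  by under eq_fun do rewrite big_nil; exact: locally_lipschitz_cst.
under eq_fun do rewrite big_cons; case: (P i) => //.
exact: locally_lipschitzM.
Qed.

Lemma locally_lipschitz_det k (M : V -> 'M[K]_k) (x0 : V) :
  (forall i j, locally_lipschitz (fun x => M x i j) x0) ->
  locally_lipschitz (fun x => \det (M x)) x0.
Proof.
move=> H; rewrite /determinant; apply: locally_lipschitz_sum => s.
apply: locally_lipschitzM; first exact: locally_lipschitz_cst.
exact: locally_lipschitz_prod.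
Qed.

Lemma locally_lipschitz_adj k (M : V -> 'M[K]_k) (x0 : V) i j :
  (forall i j, locally_lipschitz (fun x => M x i j) x0) ->
  locally_lipschitz (fun x => (\adj (M x)) i j) x0.
Proof.
move=> H; under eq_fun do rewrite mxE /cofactor.
apply: locally_lipschitzM; first exact: locally_lipschitz_cst.
by apply: locally_lipschitz_det => a b; under eq_fun do rewrite !mxE.
Qed.

Lemma locally_lipschitz_comp (V' : normedModType K) (P : V' -> V) u (x0 : V') :
  (forall x y, `|P x - P y| <= `|x - y|) ->
  locally_lipschitz u (P x0) -> locally_lipschitz (fun x => u (P x)) x0.
Proof.
move=> PL [L [U [L0 nU H]]]; exists L, (P @^-1` U); split=> //.
  have : continuous P by apply: (lip_continuous ltr01) => x y; rewrite mul1r.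
  by move=> /(_ x0); apply.
move=> x y Ux Uy; apply: le_trans (H _ _ Ux Uy) _.
by rewrite ler_wpM2l.
Qed.

End Closure.

Lemma mulmx_norm_le m n p (A : 'M[K]_(m, n)) (B : 'M[K]_(n, p)) :
  `|A *m B| <= n%:R * (`|A| * `|B|).
Proof.
apply: mx_norm_le => [|i j]; first by rewrite !mulr_ge0.
rewrite mxE; apply: le_trans (ler_norm_sum _ _ _) _.
rewrite mulr_natl -[X in _ *+ X]card_ord -sumr_const; apply: ler_sum => k _.
by rewrite normrM ler_pM// mx_entry_le.
Qed.

Lemma lsubmx_lip n1 n2 (x y : 'rV[K]_(n1 + n2)) : `|lsubmx x - lsubmx y| <= `|x - y|.
Proof.
apply: mx_norm_le => // i j; have := mx_entry_le (x - y) i (lshift n2 j).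
by rewrite !mxE.
Qed.

Lemma rsubmx_lip n1 n2 (x y : 'rV[K]_(n1 + n2)) : `|rsubmx x - rsubmx y| <= `|x - y|.
Proof.
apply: mx_norm_le => // i j; have := mx_entry_le (x - y) i (rshift n1 j).
by rewrite !mxE.
Qed.

Lemma coord_locally_lipschitz n (x0 : 'rV[K]_n) i : locally_lipschitz (fun x : 'rV[K]_n => x 0 i) x0.
Proof.
exists 1, setT; split=> //; first exact: filterT.
move=> x y _ _; rewrite mul1r; have := mx_entry_le (x - y) 0 i.
by rewrite !mxE.
Qed.

(** Differentiability of the partial derivatives at [x0] bounds them near [x0]; the mean value
    theorem on segments inside a ball does the rest. *)
Lemma C1_locally_lipschitz n (u : 'rV[K]_n -> K) x0 :
  (\forall x \near x0, differentiable u x) ->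
  (forall a, differentiable ('D_(delta_mx 0 a) u) x0) ->
  locally_lipschitz u x0.
Proof.
move=> nd d2.
pose M := \big[Num.max/0]_a (`|'D_(delta_mx 0 a) u x0| + 1) : K.
have M0 : 0 <= M.
  by apply: bigmax_ge_id.
have nM : \forall x \near x0, forall a, `|'D_(delta_mx 0 a) u x| <= M.
  apply: near_forall => a.
  have /differentiable_continuous/near_norm_bound := d2 a.
  apply: filterS => x h.
  exact: le_trans h (le_bigmax _ _ a).
have : \forall x \near x0, differentiable u x /\ forall a, `|'D_(delta_mx 0 a) u x| <= M.
  exact: filterI.
move=> /nbhs_ballP[r r0 Hr].
exists (n%:R * M), (ball x0 r); split; [exact: mulr_ge0|exact: nbhsx_ballx|].
move=> x y bx b_y.
have seg s : 0 <= s <= 1 -> ball x0 r (y + s *: (x - y)).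
  move=> /andP[s0 s1]; move: bx b_y; rewrite -!ball_normE/= => bx b_y.
  have -> : x0 - (y + s *: (x - y)) = s *: (x0 - x) + (1 - s) *: (x0 - y).
    by apply/rowP => k; rewrite !mxE; ring.
  apply: le_lt_trans (ler_normD _ _) _; rewrite !normrZ ger0_norm// (ger0_norm (x := 1 - s)) ?subr_ge0//.
  rewrite le_eqVlt in s0; case/predU1P : s0 => [<-|s0]; first by rewrite mul0r add0r subr0 mul1r.
  have -> : r = s * r + (1 - s) * r by ring.
  by rewrite ltr_leD ?ltr_pM2l// ler_wpM2l ?subr_ge0// ltW.
pose k s := u (y + s *: (x - y)).
pose k' s := 'D_(x - y) u (y + s *: (x - y)).
have [c /andP[c0 c1]] : exists2 c, 0 < c < 1 & k 1 - k 0 = k' c * (1 - 0).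
  apply: (@MVT_in K `[0, 1]) => //.
  - exact: interval_is_interval.
  - move=> s; rewrite /= in_itv/= => s01; apply: is_deriv_in_line; apply: diff_derivable.
    exact: (Hr _ (seg _ s01)).1.
  - by rewrite /= in_itv/= lexx ler01.
  - by rewrite /= in_itv/= lexx ler01.
rewrite /k /k' scale1r scale0r addr0 subr0 mulr1 [y + _]addrC subrK => ->.
have c01 : 0 <= c <= 1 by rewrite !ltW.
have [dc Mc] := Hr _ (seg _ c01).
rewrite derive_delta//; apply: le_trans (ler_norm_sum _ _ _) _.
rewrite -mulrA mulr_natl -[X in _ *+ X]card_ord -sumr_const; apply: ler_sum => a _.
rewrite [leLHS]normrZ [M * _]mulrC; apply: ler_pM => //; exact: mx_entry_le.
Qed.

Lemma clamp_bound (a r t : K) : 0 <= r -> `|clamp (a - r) (a + r) t - a| <= r.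
Proof.
move=> r0; have : a - r <= clamp (a - r) (a + r) t <= a + r by apply: clamp_in; lra.
by rewrite ler_norml => /andP[? ?]; apply/andP; split; lra.
Qed.

(** Balls of the maximum norm are cubes, and clamping each entry retracts onto the cube without
    increasing distances. Precomposing [F] with this retraction makes it globally Lipschitz; by
    continuity the solution stays in the cube for a short time, and there the retraction is the
    identity. *)
Lemma local_solution m (F : 'rV[K]_m -> 'rV[K]_m) z0 t0 :
  (forall j, locally_lipschitz (fun z => F z 0 j) z0) ->
  exists e z, [/\ 0 < e, z t0 = z0 &
    forall t, `|t - t0| < e -> is_deriv_in setT z t (F (z t))].
Proof.
move=> FL.
have [L [r [L0 r0 Hr]]] : exists L r, [/\ 0 < L, 0 < r & forall x y,
    `|x - z0| <= r -> `|y - z0| <= r -> `|F x - F y| <= L * `|x - y|].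
  have [L HL] := choice FL.
  pose M := \big[Num.max/0]_j L j.
  have M0 : 0 <= M by apply: bigmax_ge_id.
    have [U HU] := choice HL.
  have : \forall z \near z0, forall j, U j z.
    by apply: near_forall => j; have [] := HU j.
  move=> /nbhs_ballP[r /= r0 Hr].
  exists (M + 1), (r / 2); split; [exact: ltr_wpDl|exact: divr_gt0|].
  move=> x y xr yr.
  have inU w : `|w - z0| <= r / 2 -> forall j, U j w.
    move=> wr; apply: Hr; rewrite -ball_normE/= distrC; apply: le_lt_trans wr _; lra.
  apply: mx_norm_le => [|i j]; first by rewrite mulr_ge0// addr_ge0.
  rewrite ord1 !mxE; have [_ _ H] := HU j.
  apply: le_trans (H _ _ (inU _ xr j) (inU _ yr j)) _.
  rewrite ler_wpM2r//; apply: (@le_trans _ _ M); last by rewrite lerDl.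
  exact: le_bigmax.
pose c (z : 'rV[K]_m) : 'rV[K]_m := \row_j clamp (z0 0 j - r) (z0 0 j + r) (z 0 j).
have c_in z : `|c z - z0| <= r.
  by apply: mx_norm_le => [|i j]; [exact: ltW|rewrite ord1 !mxE; apply: clamp_bound; exact: ltW].
have c_lip x y : `|c x - c y| <= `|x - y|.
  apply: mx_norm_le => // i j; rewrite ord1 !mxE.
  apply: le_trans (clamp_lipschitz _ _ _) _; first by lra.
  by have := mx_entry_le (x - y) 0 j; rewrite !mxE.
have c_id z : `|z - z0| <= r -> c z = z.
  move=> zr; apply/rowP => j; rewrite mxE; apply: clamp_id.
  have := le_trans (mx_entry_le (z - z0) 0 j) zr; rewrite !mxE ler_norml.
  by move=> /andP[? ?]; apply/andP; split; lra.
have FcL x y : `|F (c x) - F (c y)| <= L * `|x - y|.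
  by apply: le_trans (Hr _ _ (c_in x) (c_in y)) _; rewrite ler_pM2l.
have [z [zt0 dz]] := picard_lindelof z0 t0 L0 FcL.
have e0 : 0 < (2 * L)^-1 by rewrite invr_gt0 mulr_gt0.
have dz0 := dz t0; rewrite subrr normr0 ltW// in dz0.
have /cvgrPdist_le/(_ r r0) := is_deriv_in_cvg (dz0 isT).
rewrite near_withinE => /nbhs_ballP[e1 /= e10 He1].
exists (Num.min e1 (2 * L)^-1), z; split=> //; first by rewrite lt_min e10.
move=> t; rewrite lt_min => /andP[te1 te2].
have := dz t (ltW te2); rewrite c_id//.
have := He1 t; rewrite -ball_normE/= distrC => /(_ te1 I).
by rewrite zt0 distrC.
Qed.

End LocallyLipschitz.

(** * The geodesic equation solved for the acceleration *)

Section GeodesicField.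
Context {K : realType} {n : nat}.
Implicit Types (G : 'rV[K]_n -> 'M[K]_n) (x v : 'rV[K]_n).

(* The second derivative prescribed by the geodesic equation, with the inverse
   matrix written by Cramer's rule. *)
Definition geo_field G x v : 'rV[K]_n :=
  - (lowered_christoffel G x v *m ((\det (G x))^-1 *: \adj (G x))).

Lemma geo_field_form G x v u : differentiable G x -> G x \in unitmx ->
  geo_form G x v (geo_field G x v) u = 0.
Proof.
move=> dG GU; rewrite geo_formE// /geo_field.
have := GU; rewrite unitmxE unitfE => d0.
rewrite mulNmx -mulmxA -scalemxAl mul_adj_mx scale_scalar_mx mulVf// mulmx1.
by rewrite addNr mul0mx mxE.
Qed.

Lemma geo_form_unique G x v a : differentiable G x -> G x \in unitmx ->
  (forall u, geo_form G x v a u = 0) -> a = geo_field G x v.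
Proof.
move=> dG GU H.
have P (w : 'rV[K]_n) : (forall u : 'rV[K]_n, (w *m u^T) 0 0 = 0) -> w = 0.
  move=> Hw; apply/rowP => l; have := Hw (delta_mx 0 l).
  by rewrite trmx_delta -colE !mxE.
have E1 : a *m G x + lowered_christoffel G x v = 0.
  by apply: P => u; rewrite -geo_formE.
have E2 : geo_field G x v *m G x + lowered_christoffel G x v = 0.
  by apply: P => u; rewrite -geo_formE// geo_field_form.
have := etrans E1 (esym E2) => /addIr E.
by rewrite -[LHS](mulmxK GU) E mulmxK.
Qed.

Variables (G : 'rV[K]_n -> 'M[K]_n) (x0 : 'rV[K]_n).
Hypotheses (smG : forall vs, \forall x \near x0, differentiable (iter_derive vs G) x)
  (G0 : G x0 \in unitmx).

Let dG : \forall x \near x0, differentiable G x. Proof. exact: (smG [::]). Qed.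

Lemma metric_derive_lipschitz vs i j : locally_lipschitz (fun x => iter_derive vs G x i j) x0.
Proof.
apply: C1_locally_lipschitz.
  by apply: filterS (smG vs) => x; exact: differentiable_entry.
move=> a; apply: (@near_differentiable _ _ _ (fun x => iter_derive (delta_mx 0 a :: vs) G x i j)).
  by apply: filterS (smG vs) => x dx; exact: derive_entry.
exact/differentiable_entry/(nbhs_singleton (smG (_ :: vs))).
Qed.

Let metric_entry_lipschitz := metric_derive_lipschitz [::].
Let metric_deriv_entry_lipschitz a := metric_derive_lipschitz [:: delta_mx 0 a].

Lemma cramer_lipschitz i j :
  locally_lipschitz (fun x => ((\det (G x))^-1 *: \adj (G x)) i j) x0.
Proof.
under eq_fun do rewrite mxE.
apply: locally_lipschitzM; last exact: locally_lipschitz_adj metric_entry_lipschitz.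
apply: locally_lipschitzV; last exact: locally_lipschitz_det metric_entry_lipschitz.
by rewrite -unitfE -unitmxE.
Qed.

Lemma geo_field_lipschitz (v0 : 'rV[K]_n) k :
  locally_lipschitz (fun z : 'rV[K]_(n + n) => geo_field G (lsubmx z) (rsubmx z) 0 k) (row_mx x0 v0).
Proof.
have xE : lsubmx (row_mx x0 v0) = x0 by rewrite row_mxKl.
have LG (u : 'rV[K]_n -> K) : locally_lipschitz u x0 ->
    locally_lipschitz (fun z : 'rV[K]_(n + n) => u (lsubmx z)) (row_mx x0 v0).
  by move=> uL; apply: locally_lipschitz_comp; [exact: lsubmx_lip|rewrite xE].
have Lv i : locally_lipschitz (fun z : 'rV[K]_(n + n) => (rsubmx z) 0 i) (row_mx x0 v0).
  apply: (locally_lipschitz_comp (P := fun z : 'rV[K]_(n + n) => rsubmx z) (u := fun x => x 0 i)); first exact: rsubmx_lip.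
  exact: coord_locally_lipschitz.
(* This is [geo_field] with ['D_v G] expanded in partial derivatives, built from functions already
   known to be locally Lipschitz; it agrees with the field wherever [G] is differentiable. *)
pose E (z : 'rV[K]_(n + n)) := - \sum_l (\sum_b (rsubmx z) 0 b * (\sum_a (rsubmx z) 0 a * 'D_(delta_mx 0 a) G (lsubmx z) b l)
   - 2^-1 * \sum_b (\sum_a (rsubmx z) 0 a * 'D_(delta_mx 0 l) G (lsubmx z) a b) * (rsubmx z) 0 b) *
   ((\det (G (lsubmx z)))^-1 *: \adj (G (lsubmx z))) l k.
apply: (@locally_lipschitz_near _ _ E); last first.
  apply: locally_lipschitzN; apply: locally_lipschitz_sum => l.
  apply: locally_lipschitzM; last first.
    exact: LG (cramer_lipschitz l k).
  apply: locally_lipschitzD.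
    apply: locally_lipschitz_sum => b; apply: locally_lipschitzM => //.
    apply: locally_lipschitz_sum => a; apply: locally_lipschitzM => //.
    exact: (LG _ (metric_deriv_entry_lipschitz a b l)).
  apply: locally_lipschitzN; apply: locally_lipschitzM; first exact: locally_lipschitz_cst.
  apply: locally_lipschitz_sum => b; apply: locally_lipschitzM => //.
  apply: locally_lipschitz_sum => a; apply: locally_lipschitzM => //.
  exact: (LG _ (metric_deriv_entry_lipschitz l a b)).
have cl : continuous (fun z : 'rV[K]_(n + n) => lsubmx z : 'rV[K]_n).
  by apply: (lip_continuous ltr01) => x y; rewrite mul1r; exact: lsubmx_lip.
have dG' : \forall x \near (lsubmx (row_mx x0 v0) : 'rV[K]_n), differentiable G x by rewrite xE.
have dz : \forall z \near row_mx x0 v0, differentiable G (lsubmx z).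
  exact: (cl (row_mx x0 v0) _ dG').
apply: filterS dz => z dz.
rewrite /E /geo_field [in RHS]mxE; congr (- _); rewrite mxE; apply: eq_bigr => l _.
congr (_ * _).
rewrite [lowered_christoffel _ _ _ _ _]mxE (derive_delta (rsubmx z) dz); congr (_ - _ * _).
  rewrite mxE; apply: eq_bigr => b _; congr (_ * _).
  by rewrite summxE; apply: eq_bigr => a _; rewrite [RHS]mxE.
rewrite mxE; apply: eq_bigr => b _; rewrite [_^T _ _]mxE; congr (_ * _).
by rewrite [RHS]mxE.
Qed.

(** The second-order equation is solved as a first-order system for the row [row_mx x v]. *)
Lemma local_geodesic_flow (v0 : 'rV[K]_n) (t0 : K) : exists (e : K) (x v : K -> 'rV[K]_n), [/\ 0 < e, x t0 = x0, v t0 = v0,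
   forall t, `|t - t0| < e -> is_deriv_in setT x t (v t) &
   forall t, `|t - t0| < e -> is_deriv_in setT v t (geo_field G (x t) (v t))].
Proof.
pose F (z : 'rV[K]_(n + n)) : 'rV[K]_(n + n) := row_mx (rsubmx z) (geo_field G (lsubmx z) (rsubmx z)).
have [j|e [z [e0 z0 dz]]] := @local_solution K _ F (row_mx x0 v0) t0.
  rewrite /F; case: (split_ordP j) => i ->.
    under eq_fun do rewrite row_mxEl.
    apply: (locally_lipschitz_comp (P := fun z : 'rV[K]_(n + n) => rsubmx z) (u := fun x => x 0 i)); first exact: rsubmx_lip.
    exact: coord_locally_lipschitz.
  under eq_fun do rewrite row_mxEr.
  exact: geo_field_lipschitz.
exists e, (fun t => lsubmx (z t)), (fun t => rsubmx (z t)).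
rewrite z0 row_mxKl row_mxKr; split=> // t te; have /is_deriv_in_mxP H := dz t te.
  apply/is_deriv_in_mxP => i j; rewrite ord1.
  have := H 0 (lshift n j); rewrite row_mxEl.
  by under [in X in _ -> X]eq_fun do rewrite mxE.
apply/is_deriv_in_mxP => i j; rewrite ord1.
have := H 0 (rshift n j); rewrite row_mxEr.
by under [in X in _ -> X]eq_fun do rewrite mxE.
Qed.

Lemma lowered_christoffel_le : exists2 B, 0 <= B & \forall x \near x0, forall v,
  `|lowered_christoffel G x v| <= B * (`|v| * `|v|).
Proof.
pose D := \big[Num.max/0]_a (`|'D_(delta_mx 0 a) G x0| + 1) : K.
have D0 : 0 <= D by apply: bigmax_ge_id.
have nD : \forall x \near x0, forall a, `|'D_(delta_mx 0 a) G x| <= D.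
  apply: near_forall => a.
  have := differentiable_continuous (nbhs_singleton (smG [:: delta_mx 0 a])).
  move=> /near_norm_bound; apply: filterS => x h; exact: le_trans h (le_bigmax _ _ a).
exists (2 * (n%:R * n%:R * D)); first by rewrite !mulr_ge0.
have := nD; apply: filterS2 dG => x dx Dx v.
have X0 : 0 <= n%:R * n%:R * D * (`|v| * `|v|) by rewrite !mulr_ge0.
have h1 : `|v *m 'D_v G x| <= n%:R * n%:R * D * (`|v| * `|v|).
  apply: le_trans (mulmx_norm_le _ _) _.
  have -> : n%:R * n%:R * D * (`|v| * `|v|) = n%:R * (`|v| * (n%:R * (`|v| * D))) by ring.
  rewrite !ler_wpM2l// (derive_delta _ dx); apply: le_trans (ler_norm_sum _ _ _) _.
  rewrite mulr_natl -[X in _ *+ X]card_ord -sumr_const; apply: ler_sum => a _.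
  by rewrite normrZ ler_pM// mx_entry_le.
have vT : `|v^T| <= `|v| by apply: mx_norm_le => // i j; rewrite mxE mx_entry_le.
have h2 l : `|v *m 'D_(delta_mx 0 l) G x *m v^T| <= n%:R * n%:R * D * (`|v| * `|v|).
  apply: le_trans (mulmx_norm_le _ _) _.
  have -> : n%:R * n%:R * D * (`|v| * `|v|) = n%:R * ((n%:R * (`|v| * D)) * `|v|) by ring.
  rewrite ler_wpM2l// ler_pM//; apply: le_trans (mulmx_norm_le _ _) _.
  by rewrite !ler_wpM2l.
apply: mx_norm_le => [|i l]; first by rewrite !mulr_ge0.
rewrite [lowered_christoffel _ _ _ _ _]mxE.
apply: le_trans (ler_normB _ _) _; rewrite normrM gtr0_norm ?invr_gt0//.
have := le_trans (mx_entry_le _ 0 l) h1; have := le_trans (mx_entry_le _ 0 0) (h2 l).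
rewrite -mulrA; lra.
Qed.

(** The field is quadratic in [v] with coefficients bounded near [x0]; a bound on velocities
    therefore gives one on accelerations. *)
Lemma geo_field_le : exists2 B, 0 <= B & \forall x \near x0, forall v,
  `|geo_field G x v| <= B * (`|v| * `|v|).
Proof.
have [B B0 nB] := lowered_christoffel_le.
pose M x := (\det (G x))^-1 *: \adj (G x).
have nM i j : \forall x \near x0, `|M x i j| <= `|M x0| + 1.
  have := cramer_lipschitz i j.
  move=> /locally_lipschitz_bounded; apply: filterS => x h; apply: le_trans h _.
  by rewrite lerD2r mx_entry_le.
have nM' : \forall x \near x0, forall i j, `|M x i j| <= `|M x0| + 1.
  by apply: near_forall => i; apply: near_forall => j; exact: nM.
exists (n%:R * (B * (`|M x0| + 1))); first by rewrite !mulr_ge0// addr_ge0.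
apply: filterS2 nB nM' => x Bx Mx v.
rewrite /geo_field normrN; apply: le_trans (mulmx_norm_le _ _) _.
rewrite -[leRHS]mulrA ler_wpM2l// mulrAC ler_pM//.
by apply: mx_norm_le => //; exact: addr_ge0.
Qed.

End GeodesicField.

(** * Extension of geodesics *)

Section EndpointCalculus.
Context {K : realType}.

(** The supremum of the times up to which [P] holds throughout satisfies [P] by the closing
    hypothesis, and by the opening one it could be increased. *)
Lemma interval_induction (a b : K) (P : K -> Prop) : P a ->
  (forall t, a <= t < b -> P t -> \forall s \near t, t <= s < b -> P s) ->
  (forall t, a < t < b -> (forall s, a <= s < t -> P s) -> P t) ->
  forall t, a <= t < b -> P t.
Proof.
move=> Pa opn cls t /andP[at_ tb]; apply: contrapT => nPt.
pose E := [set s | a <= s <= t /\ forall r, a <= r <= s -> P r].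
have Ea : E a.
  by split=> [|r /andP[ar ra]]; [rewrite lexx|rewrite (@le_anti _ _ r a) ?ar ?ra].
have ubE : ubound E t by move=> s [/andP[]].
have sE : has_sup E by split; [exists a|exists t].
pose c := sup E.
have ac : a <= c by apply: ub_le_sup => //; exact: sE.2.
have ct : c <= t by apply: ge_sup => //; exact: sE.1.
have below s : a <= s < c -> P s.
  move=> /andP[as_ sc]; have cs0 : 0 < c - s by rewrite subr_gt0.
  have [r [_ Hr] sr] := sup_adherent cs0 sE.
  apply: Hr; rewrite as_ ltW//.
  by move: sr; rewrite -/c subKr.
have Pc : P c.
  have [<-//|ac'] := eqVneq a c.
  by apply: cls => //; rewrite lt_neqAle ac' ac/= (le_lt_trans ct).
have ct' : c < t by rewrite lt_neqAle ct andbT; apply: contra_notN nPt => /eqP <-.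
have := opn c; rewrite ac (lt_trans ct' tb) => /(_ isT Pc) /nbhs_ballP[e /= e0 He].
pose d := Num.min t (c + e / 2).
have cd : c < d by rewrite lt_min ct' ltrDl divr_gt0.
have : E d.
  split; first by rewrite (le_trans ac (ltW cd)) ge_min lexx.
  move=> r /andP[ar rd]; have [rc|cr] := ltP r c; first by apply: below; rewrite ar.
  apply: He; last by rewrite cr (le_lt_trans rd)// (le_lt_trans _ tb)// ge_min lexx.
  rewrite -ball_normE/= ler0_norm ?subr_le0// opprB.
  have : d <= c + e / 2 by rewrite ge_min lexx orbT.
  lra.
move=> /(ub_le_sup sE.2); rewrite -/c; lra.
Qed.

(** The Lipschitz bound gives the Cauchy property at [b] from the left; letting [s'] tend to [b] in
    the same bound gives the rate. *)
Lemma lipschitz_left_limit m (u : K -> 'rV[K]_m) (M a b : K) : a < b ->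
  (forall s s', a <= s < b -> a <= s' < b -> `|u s - u s'| <= M * `|s - s'|) ->
  exists l, forall s, a <= s < b -> `|l - u s| <= M * (b - s).
Proof.
move=> ab H.
have nb e : 0 < e -> \forall s \near b^'-, a <= s < b /\ b - s <= e.
  move=> e0; near=> s; have sb : s < b by near: s; exact: nbhs_left_lt.
  split; first by rewrite sb andbT ltW//; near: s; exact: nbhs_left_gt.
  have : b - e < s by near: s; apply: nbhs_left_gt; rewrite ltrBlDr ltrDl.
  lra.
have Hb s s' : a <= s < b -> a <= s' < b -> s <= s' -> `|u s - u s'| <= M * (s' - s).
  by move=> hs hs' ss'; apply: le_trans (H _ _ hs hs') _; rewrite distrC ger0_norm// subr_ge0.
have M0 : 0 <= M.
  have h1 : a <= a < b by rewrite lexx.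
  have h2 : a <= (a + b) / 2 < b by apply/andP; split; lra.
  have := le_trans (normr_ge0 _) (Hb _ _ h1 h2 ltac:(lra)); rewrite pmulr_lge0//; lra.
have nb1 := nb 1 ltr01.
have M1 : 0 < M + 1 by rewrite ltr_wpDl.
have : cvg (u @ b^'-).
  apply/cauchy_cvgP/cauchy_exP => e /= e0.
  have e1 : 0 < e / (M + 1) / 2 by rewrite !divr_gt0.
  near b^'- => s.
  have [hs be] : a <= s < b /\ b - s <= e / (M + 1) / 2 by near: s; exact: nb.
  exists (u s); rewrite /= nbhs_simpl/=; near=> s'.
  have [hs' _] : a <= s' < b /\ b - s' <= 1 by near: s'; exact: nb1.
  have ss' : s < s' by near: s'; apply: nbhs_left_gt; case/andP: hs.
  rewrite -ball_normE/=; apply: le_lt_trans (Hb _ _ hs hs' (ltW ss')) _.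
  apply: (@le_lt_trans _ _ ((M + 1) * (b - s))).
    have /andP[_ s'b] := hs'; apply: ler_pM => //; first by rewrite subr_ge0 ltW.
      by rewrite lerDl.
    by rewrite lerD2r ltW.
  rewrite mulrC -ltr_pdivlMr//; apply: le_lt_trans be _; rewrite gtr_pMr ?divr_gt0//; lra.
move=> /cvg_ex[l /cvgrPdist_le ul]; exists l => s hs; apply/ler_addgt0Pr => e e0.
near b^'- => s'.
have [hs' _] : a <= s' < b /\ b - s' <= 1 by near: s'; exact: nb1.
have ss' : s < s' by near: s'; apply: nbhs_left_gt; case/andP: hs.
rewrite -(subrKA (u s')) addrC; apply: le_trans (ler_normD _ _) _; apply: lerD.
  rewrite distrC; apply: le_trans (Hb _ _ hs hs' (ltW ss')) _.
  by rewrite ler_wpM2l// lerD2r ltW//; case/andP: hs'.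
by near: s'; exact: ul.
Unshelve. all: by end_near. Qed.

(** A one-sided derivative at an end is the limit of the derivatives, by the mean value theorem on
    [[s, b]] in each entry. It serves to differentiate a curve, and then its velocity, at an added
    end point. *)
Lemma is_deriv_in_left_limit m (I J : set K) (u u' w : K -> 'rV[K]_m) (a b : K) l : a < b ->
  (forall t, a <= t < b -> I t) ->
  (forall t, a <= t < b -> is_deriv_in I u t (u' t)) ->
  u t @[t --> b^'-] --> w b -> u' t @[t --> b^'-] --> l ->
  (forall t, a <= t < b -> w t = u t) -> (forall t, J t -> t <= b) ->
  is_deriv_in J w b l.
Proof.
move=> ab sub Hu ub u'b wu Jb; apply/is_deriv_in_mxP => i j; rewrite ord1 => {i}.
apply/is_deriv_inP => e e0.
have /cvgrPdist_le/(_ e e0) := u'b; rewrite near_withinE => /nbhs_ballP[d /= d0 Hd].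
near=> s => Js; have as_ : a < s by near: s; exact: lt_nbhsr.
have ds : b - d < s by near: s; apply: lt_nbhsr; rewrite ltrBlDr ltrDl.
have := Jb s Js; rewrite le_eqVlt => /predU1P[->|sb].
  by rewrite !subrr scale0r subr0 !normr0 mulr0.
have dw t : a < t < b -> is_derive t 1 (fun t => w t 0 j) (u' t 0 j).
  move=> /andP[at_ tb]; have nt : \forall r \near t, a < r < b.
    by apply: filterS2 (lt_nbhsr at_) (lt_nbhsl tb) => r -> ->.
  apply: (@is_deriv_in_is_derive _ _ `]a, b[); first by apply: filterS nt => r; rewrite /= in_itv.
  have /is_deriv_in_mxP/(_ 0 j) := Hu t ltac:(by rewrite (ltW at_)).
  apply: is_deriv_in_near; first by rewrite wu ?(ltW at_).
  by apply: filterS nt => r /andP[ar rb] _; rewrite wu ?(ltW ar)//; split=> //; apply: sub; rewrite (ltW ar).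
have cw t : a < t < b -> {for t, continuous (fun t => w t 0 j)}.
  move=> /dw dt; apply: differentiable_continuous; apply/derivable1_diffP; exact: ex_derive.
have [||c + E] := MVT sb (df := fun t => u' t 0 j) (f := fun t => w t 0 j).
- by move=> t; rewrite in_itv/= => /andP[st tb]; apply: dw; rewrite tb (lt_trans as_).
- apply/(continuous_within_itvP _ sb); split.
  + by move=> t; rewrite in_itv/= => /andP[st tb]; apply: cw; rewrite tb (lt_trans as_).
  + by apply: cvg_at_right_filter; apply: cw; rewrite as_.
  + apply/cvgrPdist_le => x x0; have /cvgrPdist_le/(_ x x0) ux := ub.
    near=> t; have tb : t < b by near: t; exact: nbhs_left_lt.
    have at_ : a < t by near: t; exact: nbhs_left_gt.
    have ux' : `|w b - u t| <= x by near: t.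
    have := le_trans (mx_entry_le _ 0 j) ux'; by rewrite !mxE (wu t)// tb ltW.
rewrite in_itv/= => /andP[sc cb].
have -> : w s 0 j - w b 0 j - (s - b) *: l 0 j = (b - s) * (l - u' c) 0 j.
  rewrite -(opprB (w b 0 j)) E (_ : (s - b) *: l 0 j = (s - b) * l 0 j)//.
  have -> : (l - u' c) 0 j = l 0 j - u' c 0 j by rewrite !mxE.
  ring.
have bs : 0 < b - s by rewrite subr_gt0.
rewrite normrM (distrC s) (gtr0_norm bs) mulrC ler_pM2r//.
apply: le_trans (mx_entry_le _ _ _) (Hd c _ cb); rewrite -ball_normE/= gtr0_norm; lra.
Unshelve. all: by end_near. Qed.

Lemma is_deriv_in_glue {W : normedModType K} (I J : set K) (u w z : K -> W) b l :
  is_deriv_in I u b l -> is_deriv_in setT w b l -> z b = u b -> z b = w b ->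
  (\forall s \near b, J s -> if s <= b then I s /\ z s = u s else z s = w s) ->
  is_deriv_in J z b l.
Proof.
move=> /is_deriv_inP ul /is_deriv_inP wl zu zw E; apply/is_deriv_inP => e e0.
apply: filterS3 E (ul e e0) (wl e e0) => s H1 H2 H3 Js.
have {H1} := H1 Js; case: ifP => _ => [[Is ->]|->].
  by rewrite zu; exact: H2.
by rewrite zw; exact: H3.
Qed.

End EndpointCalculus.

Section PositiveForms.
Context {K : realType} {n : nat}.

Lemma posdef_cauchy_schwarz (M : 'M[K]_n) (v w : 'rV[K]_n) : M^T = M ->
  (forall v : 'rV[K]_n, v != 0 -> 0 < (v *m M *m v^T) 0 0) ->
  (v *m M *m w^T) 0 0 ^+ 2 <= (v *m M *m v^T) 0 0 * (w *m M *m w^T) 0 0.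
Proof.
move=> symM pos.
have [->|w0] := eqVneq w 0.
  by rewrite trmx0 !(mulmx0, mul0mx) mxE expr0n mulr0.
have := pos w w0; set c := (w *m M *m w^T) 0 0 => c0.
set b := (v *m M *m w^T) 0 0.
have pos0 (x : 'rV[K]_n) : 0 <= (x *m M *m x^T) 0 0.
  have [->|x0] := eqVneq x 0; first by rewrite !mul0mx mxE.
  exact: ltW (pos _ x0).
have E := mulmx_sym_form w v symM; rewrite -/b in E.
have := pos0 (v - (b / c) *: w).
have mxB (X Y : 'M[K]_1) : (X - Y) 0 0 = X 0 0 - Y 0 0 by rewrite !mxE.
have mxZ k (X : 'M[K]_1) : (k *: X) 0 0 = k * X 0 0 by rewrite !mxE.
have -> : (v - (b / c) *: w)^T = v^T - (b / c) *: w^T by rewrite linearB linearZ.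
rewrite !mulmxBl !mulmxBr -!scalemxAl -!scalemxAr.
rewrite !(mxB, mxZ) E -/b -/c => H.
rewrite -subr_ge0 (_ : _ - _ = c * ((v *m M *m v^T) 0 0 - b / c * b - (b / c * b - b / c * (b / c * c)))).
  by rewrite mulr_ge0// ltW.
by field; exact: lt0r_neq0.
Qed.

(** Cauchy-Schwarz with [w] equal to the [k]-th row of the inverse matrix: then [v M w^T] is [v_k],
    and [w M w^T] is the [k]-th diagonal entry of the inverse. *)
Lemma posdef_entry_bound (M : 'M[K]_n) (v : 'rV[K]_n) k : M^T = M ->
  (forall v : 'rV[K]_n, v != 0 -> 0 < (v *m M *m v^T) 0 0) -> M \in unitmx ->
  v 0 k ^+ 2 <= (v *m M *m v^T) 0 0 * (invmx M) k k.
Proof.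
move=> symM pos MU.
have := posdef_cauchy_schwarz v (delta_mx 0 k *m invmx M) symM pos.
rewrite !trmx_mul trmx_inv symM trmx_delta !mulmxA.
rewrite -(mulmxA _ M (invmx M)) mulmxV// mulmx1 -colE mxE.
by rewrite mulmxKV// -(mulmxA _ _ (delta_mx k 0)) -colE -rowE !mxE.
Qed.

End PositiveForms.

(** * Continuation past an end that belongs to the domain *)

Section LocalGeodesics.
Context {K : realType} {n : nat} {T : topologicalType} (C : charts K n T).
Variable g : tensor C.
Hypotheses (atlasC : smooth_atlas C) (riemg : riemannian C g).

Lemma within_near_cvg (A : set K) (u : K -> T) (t : K) (l : T) :
  (forall P : set T, nbhs l P -> \forall s \near t, A s -> P (u s)) ->
  u s @[s --> within A (nbhs t)] --> l.
Proof. by move=> H P /H. Qed.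

(** The conditions of [geodesic] at [t] in a single chart. Derivability of the position is asked
    near [t], since the velocity at nearby times enters its derivative at [t]. *)
Definition geodesic_at i (J : set K) (del : K -> T) (t : K) : Prop :=
  [/\ cdom i (del t),
      \forall s \near t, J s -> derivable_in J (cmap i \o del) s,
      derivable_in J (velocity i J del) t,
      geodesic_eq g i J del t &
      qform g i (del t) (velocity i J del t) = 1].

Lemma geodesic_atP (I : set K) gam t i : geodesic C g I gam -> I t -> cdom i (gam t) ->
  geodesic_at i I gam t.
Proof.
move=> [pI cI _ H] It ip; have [_ d2 eqi ui] := H t i It ip; split=> //.
have := within_continuous_near cI It (near_cdom atlasC ip).
by apply: filterS => s ips Is; have [] := H s i Is (ips Is).
Qed.

Lemma geodesic_of_local (J : set K) (del : K -> T) : proper_interval J ->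
  (forall t, J t -> del s @[s --> within J (nbhs t)] --> del t) ->
  (forall t, J t -> exists i, geodesic_at i J del t) -> geodesic C g J del.
Proof.
move=> pJ cJ H; split=> //.
- exact/subspace_continuousP.
- by move=> t Jt; have [i [ip _ _ _ _]] := H t Jt; exists i.
- move=> t j Jt jp; have [i [ip ni d2 eqi ui]] := H t Jt.
  exact: (geodesic_transition atlasC riemg ip jp pJ Jt erefl (cJ t Jt) ni d2 eqi ui).
Qed.

Lemma geodesic_at_near i (I J : set K) gam del t : proper_interval I -> proper_interval J ->
  I t -> J t -> del t = gam t ->
  (\forall s \near t, (J s <-> I s) /\ (I s -> del s = gam s)) ->
  geodesic_at i I gam t -> geodesic_at i J del t.
Proof.
move=> pI pJ It Jt E nE [ip ni [a Ha] eqi ui].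
have nn := near_join nE.
have nv : \forall s \near t, J s -> is_deriv_in J (cmap i \o del) s (velocity i I gam s).
  apply: filterS3 nn nE ni => s H1 [H2 H2'] H3 Js.
  have Is : I s by apply/H2.
  have := derivable_in_is_deriv pI Is (H3 Is).
  apply: is_deriv_in_near; first by rewrite /= H2'.
  apply: filterS H1 => r [r1 r2] Jr; have Ir : I r by exact/r1.
  by split=> //=; rewrite r2.
have vE : \forall s \near t, J s -> velocity i J del s = velocity i I gam s.
  by apply: filterS nv => s H Js; apply: is_deriv_inE => //; exact: H.
have vt : velocity i J del t = velocity i I gam t by exact: (nbhs_singleton vE Jt).
have Ja : is_deriv_in J (velocity i J del) t a.
  apply: is_deriv_in_near Ha; first by rewrite vt.
  by apply: filterS2 nE vE => s [H1 _] H2 Js; split; [exact/H1|rewrite H2].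
have aE : acceleration i J del t = acceleration i I gam t.
  by rewrite /acceleration (is_deriv_inE pI It Ha) (is_deriv_inE pJ Jt Ja).
split.
- by rewrite E.
- by apply: filterS nv => s H Js; exists (velocity i I gam s); exact: H.
- by exists a.
- by move=> k; rewrite E vt aE; exact: eqi.
- by rewrite E vt.
Qed.

Lemma metric_smooth_near i p : cdom i p ->
  forall vs, \forall x \near cmap i p, differentiable (iter_derive vs (in_coord g i)) x.
Proof.
have [_ _ sm _] := riemg => ip vs; apply: filterS (near_image atlasC ip) => x ix.
exact: sm.
Qed.

Lemma in_coordE i p : cdom i p -> in_coord g i (cmap i p) = g i p.
Proof. by have [_ cK _ _] := atlasC => ip; rewrite /in_coord cK. Qed.

Lemma acceleration_geo_field i (I : set K) gam t : cdom i (gam t) -> geodesic_eq g i I gam t ->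
  acceleration i I gam t = geo_field (in_coord g i) (cmap i (gam t)) (velocity i I gam t).
Proof.
move=> ip /(geodesic_eqP atlasC riemg I ip) H; apply: geo_form_unique => //.
- exact: in_coord_differentiable.
- by rewrite in_coordE//; exact: metric_unit.
Qed.

(** Each entry of [v] is controlled by a diagonal entry of the inverse metric, which Cramer's rule
    keeps bounded near the point. *)
Lemma unit_velocity_bound i p : cdom i p ->
  exists2 M, 0 <= M & \forall x \near cmap i p, forall v : 'rV[K]_n,
    (v *m in_coord g i x *m v^T) 0 0 = 1 -> `|v| <= M.
Proof.
move=> ip; have [sg pos _ _] := riemg.
have U0 : in_coord g i (cmap i p) \in unitmx by rewrite in_coordE// (metric_unit riemg).
have smG := metric_smooth_near ip.
pose E x : 'M[K]_n := (\det (in_coord g i x))^-1 *: \adj (in_coord g i x).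
have nE : \forall x \near cmap i p, forall k, `|E x k k| <= `|E (cmap i p)| + 1.
  apply: near_forall => k.
  have := cramer_lipschitz smG U0 k k.
  move=> /locally_lipschitz_bounded; apply: filterS => x h; apply: le_trans h _.
  by rewrite lerD2r mx_entry_le.
(* If [s] is the norm of [E] at the point, the squared entries of [v] are at most [s + 1], which is
   below [(s + 2)^2]. *)
exists (`|E (cmap i p)| + 2); first by rewrite addr_ge0.
apply: filterS2 nE (near_image atlasC ip) => x Ex [q iq qx] v v1.
apply: mx_norm_le => [|a k]; first by rewrite addr_ge0.
rewrite ord1.
have xq : in_coord g i x = g i q by rewrite -qx in_coordE.
have Uq : g i q \in unitmx by exact: metric_unit riemg _ _ iq.
have := posdef_entry_bound v k (sg _ _ iq) (pos _ _ iq) Uq.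
rewrite -xq v1 mul1r.
have -> : invmx (in_coord g i x) = E x by rewrite /invmx xq Uq /E xq.
move=> h; have h2 := le_trans h (le_trans (ler_norm _) (Ex k)).
rewrite leNgt; apply/negP => h3.
have : (`|E (cmap i p)| + 2) ^+ 2 < v 0 k ^+ 2.
  by rewrite -[X in _ < X]real_normK ?num_real// ltr_pXn2r// nnegrE addr_ge0.
have := normr_ge0 (E (cmap i p)); nra.
Qed.

(** The derivative of the squared speed is twice [geo_form] tested on the velocity itself, which
    vanishes for the geodesic field. *)
Lemma deriv_unit_speed i (J : set K) (x v : K -> 'rV[K]_n) t :
  differentiable (in_coord g i) (x t) -> in_coord g i (x t) \in unitmx ->
  (in_coord g i (x t))^T = in_coord g i (x t) ->
  is_deriv_in J x t (v t) -> is_deriv_in J v t (geo_field (in_coord g i) (x t) (v t)) ->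
  is_deriv_in J (fun s => (v s *m in_coord g i (x s) *m (v s)^T) 0 0) t 0.
Proof.
move=> dG GU symG dx dv.
have := is_deriv_in_mulmx (is_deriv_in_mulmx dv (is_deriv_in_comp dG dx)) (is_deriv_in_tr dv).
move=> /is_deriv_in_mxP/(_ 0 0) /=.
have := geo_field_form (v t) (v t) dG GU; rewrite /geo_form.
set G := in_coord g i (x t); set a := geo_field _ _ _; set D := 'D_(v t) _ _ => E.
have symE := mulmx_sym_form (v t) a symG.
rewrite mulmxDl [X in is_deriv_in _ _ _ X]mx11D [X in is_deriv_in _ _ _ (X + _)]mx11D symE.
rewrite (_ : _ + _ = 0)//.
move: E; set X := (a *m G *m (v t)^T) 0 0; set Y := (v t *m D *m (v t)^T) 0 0.
lra.
Qed.

Lemma cinv_comp_cvg i p (A : set K) (x : K -> 'rV[K]_n) t : cdom (c := C) i p -> x t = cmap i p ->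
  x s @[s --> within A (nbhs t)] --> x t -> (cinv i (x s) : T) @[s --> within A (nbhs t)] --> p.
Proof.
by move=> ip xt; rewrite xt => xc; apply: cvg_comp xc _; exact: cinv_cvg.
Qed.

Lemma proper_interval_setU (I : set K) b e : proper_interval I -> I b -> (forall t, I t -> t <= b) ->
  0 < e -> proper_interval (I `|` `[b, b + e[%classic).
Proof.
move=> [iI [s0 [t0 [Is It st]]]] Ib Hb e0; split; last first.
  by exists s0, t0; split=> //; left.
move=> x y + + z /andP[xz zy]; rewrite /setU/= !in_itv/= => Hx Hy.
have [zb|bz] := leP z b; last first.
  right; rewrite (ltW bz)/=.
  case: Hy => [Iy|/andP[_ yb]]; last exact: le_lt_trans yb.
  by have := Hb _ Iy; lra.
case: Hx => [Ix|/andP[bx _]]; last by right; rewrite (le_trans bx)//=; lra.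
by left; apply: (iI x b) => //; rewrite xz.
Qed.

(* At a right end point that belongs to its domain, a geodesic is continued by
   the solution of the geodesic equation with the same position and velocity. *)
Lemma geodesic_extend_closed (I : set K) gam b : geodesic C g I gam -> I b ->
  (forall t, I t -> t <= b) ->
  exists e del, [/\ 0 < e, geodesic C g (I `|` `[b, b + e[%classic) del & {in I, del =1 gam}].
Proof.
move=> geoI Ib Hb; have [pI cI carI HI] := geoI.
have [_ cK _ _] := atlasC; have [sg _ _ _] := riemg.
have [i _ ip] := carI b Ib.
have Gi := geodesic_atP geoI Ib ip.
set p := gam b in ip.
have U0 : in_coord g i (cmap i p) \in unitmx by rewrite in_coordE// (metric_unit riemg).
have [e1 [x [v [e10 x0 v0 Hx Hv]]]] :=
  local_geodesic_flow (metric_smooth_near ip) U0 (velocity i I gam b) b.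
have [_ _ d2b eqb ub] := Gi.
have cx : x s @[s --> within setT (nbhs b)] --> x b.
  by apply: is_deriv_in_cvg (Hx b _); rewrite subrr normr0.
have := near_image atlasC ip; rewrite -x0 => /(cvg_within_near cx) /nbhs_ballP[e2 /= e20 Hx2].
pose e := Num.min e1 e2.
have e0 : 0 < e by rewrite lt_min e10.
have in_e t : b <= t < b + e -> `|t - b| < e1 /\ (cmap i @` cdom i) (x t).
  move=> /andP[bt te]; have te' : t - b < e by lra.
  have [te1 te2] : t - b < e1 /\ t - b < e2 by move: te'; rewrite lt_min => /andP[].
  by split; [rewrite ger0_norm; lra|apply: Hx2 => //; rewrite -ball_normE/= ler0_norm; lra].
pose J := I `|` `[b, b + e[%classic.
pose del t := if t <= b then gam t else cinv i (x t).
have pJ : proper_interval J by exact: proper_interval_setU.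
have delI : {in I, del =1 gam} by move=> t; rewrite inE => It; rewrite /del Hb.
have iJ t : J t -> b < t -> b <= t < b + e.
  move=> [/Hb|]; first lra.
  by rewrite /= in_itv.
have delb : del b = p by rewrite /del lexx.
have xdel t : b <= t < b + e -> cmap i (del t) = x t /\ cdom i (del t).
  move=> bt; have [_ ix] := in_e t bt; rewrite /del; case: ifP => [tb|_].
    have -> : t = b by apply/le_anti; rewrite tb; move: bt => /andP[].
    by rewrite x0.
  exact: image_cinv.
have Jb : J b by left.
have nJb : \forall s \near b, J s -> s < b + e.
  by near=> s => _; near: s; apply: lt_nbhsl; rewrite ltrDl.
have It_lt t : I t -> t < b -> \forall s \near t, (J s <-> I s) /\ (I s -> del s = gam s).
  move=> It tb; have : \forall s \near t, s < b by exact: lt_nbhsl.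
  apply: filterS => s sb; split; last by move=> _; rewrite /del ltW.
  split; last by left.
  by case=> //=; rewrite in_itv/=; lra.
exists e, del; split; [exact: e0| |exact: delI]; apply: geodesic_of_local; [exact: pJ| |].
- move=> t Jt; have [tb|bt|tb] := ltgtP t b.
  + have It : I t by case: Jt => //=; rewrite in_itv/=; lra.
    rewrite {2}/del (ltW tb); apply: within_near_cvg => P Pg.
    have := within_continuous_near cI It Pg.
    apply: filterS2 (It_lt t It tb) => s [h1 h2] h3 Js.
    by have Is := h1.1 Js; rewrite (h2 Is); exact: h3.
  + have := iJ t Jt bt => bte; have [te1 ix] := in_e t bte.
    have [xt dt] := xdel t bte.
    have xc : x s @[s --> within J (nbhs t)] --> x t.
      by apply: is_deriv_in_cvg (is_deriv_inS _ (Hx t te1)); exact: subsetT.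
    have dc := cinv_comp_cvg dt (esym xt) xc; apply: within_near_cvg => P Pt.
    have bn : \forall s \near t, b < s by exact: lt_nbhsr.
    have := cvg_within_near dc Pt.
    apply: filterS2 bn => s bs H Js.
    have -> : del s = cinv i (x s) by rewrite /del leNgt bs.
    exact: H.
  + subst t; rewrite delb; apply: within_near_cvg => P Pp.
    have H1 := within_continuous_near cI Ib Pp.
    have xp : x b = cmap i p by rewrite x0.
    have H2 := cvg_within_near (cinv_comp_cvg ip xp cx) Pp.
    apply: filterS2 H1 H2 => s h1 h2 Js; rewrite /del; case: leP => sb; last exact: h2.
    apply: h1; case: Js => //=; rewrite in_itv/= => /andP[bs _].
    by have -> : s = b by apply/le_anti; rewrite sb.
- have nvR t : b < t -> t < b + e -> is_deriv_in J (cmap i \o del) t (v t).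
    move=> bt te; have bte : b <= t < b + e by rewrite ltW.
    have [te1 ix] := in_e t bte; have [xt dt] := xdel t bte.
    apply: is_deriv_in_near (Hx t te1); first by rewrite /= xt.
    have n1 : \forall s \near t, b < s by exact: lt_nbhsr.
    have n2 : \forall s \near t, s < b + e by exact: lt_nbhsl.
    apply: filterS2 n1 n2 => s h1 h2 Js; split=> //=.
    by rewrite (xdel s _).1// ltW.
  (* Both one-sided derivatives at [b] are the velocity of [gam]: the left one by definition, the
     right one by the initial condition of the flow. *)
  have vb : is_deriv_in J (cmap i \o del) b (velocity i I gam b).
    have [_ /nbhs_singleton /(_ Ib) d1 _ _ _] := Gi.
    apply: (is_deriv_in_glue (derivable_in_is_deriv pI Ib d1) (w := x)).
    + by have := Hx b; rewrite v0 subrr normr0; exact.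
    + by rewrite /= delb.
    + by rewrite /= delb x0.
    + apply: filterS nJb => s sbe Js; case: leP => sb.
        split; last by rewrite /= /del sb.
        case: Js => //=; rewrite in_itv/= => /andP[bs _].
        by have -> : s = b by apply/le_anti; rewrite sb.
      by rewrite /= (xdel s _).1// (ltW sb) sbe.
  have nvL t : I t -> t < b -> derivable_in I (cmap i \o gam) t ->
      is_deriv_in J (cmap i \o del) t (velocity i I gam t).
    move=> It tb /(derivable_in_is_deriv pI It).
    apply: is_deriv_in_near; first by rewrite /= /del ltW.
    apply: filterS (It_lt t It tb) => s [h1 h2] Js; have Is := h1.1 Js.
    by rewrite /= h2.
  have [_ ni _ _ _] := Gi.
  have velR t : b < t -> t < b + e -> velocity i J del t = v t.
    by move=> bt te; apply: is_deriv_inE (nvR t bt te) => //; right; rewrite /= in_itv/= (ltW bt).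
  have velb : velocity i J del b = velocity i I gam b by exact: is_deriv_inE vb.
  move=> t Jt; have [tb|bt|tb] := ltgtP t b.
  + have It : I t by case: Jt => //=; rewrite in_itv/=; lra.
    have [j _ jt] := carI t It; exists j.
    apply: (geodesic_at_near pI pJ It Jt _ (It_lt t It tb) (geodesic_atP geoI It jt)).
    by rewrite /del ltW.
  + have bte := iJ t Jt bt; have [te1 ix] := in_e t bte; have [xt dt] := xdel t bte.
    have te : t < b + e by move: bte => /andP[].
    exists i.
    have n1 : \forall s \near t, b < s by exact: lt_nbhsr.
    have n2 : \forall s \near t, s < b + e by exact: lt_nbhsl.
    have vt : is_deriv_in J (velocity i J del) t (geo_field (in_coord g i) (x t) (v t)).
      apply: is_deriv_in_near (Hv t te1); first by rewrite velR.
      by apply: filterS2 n1 n2 => s h1 h2 Js; split=> //; rewrite velR.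
    have dG : differentiable (in_coord g i) (x t) by rewrite -xt; exact: in_coord_differentiable.
    have GU : in_coord g i (x t) \in unitmx by rewrite -xt in_coordE// (metric_unit riemg).
    split.
    * exact: dt.
    * apply: filterS2 n1 n2 => s h1 h2 Js; exists (v s); exact: nvR.
    * by eexists; exact: vt.
    * apply/(geodesic_eqP atlasC riemg J dt) => u.
      rewrite /acceleration (is_deriv_inE pJ Jt vt) xt velR//.
      exact: geo_field_form.
    * rewrite /qform velR// -(in_coordE dt) xt.
      pose Q s := (v s *m in_coord g i (x s) *m (v s)^T) 0 0.
      (* The squared speed is constant along the flow, and at [b] it is that of [gam]. *)
      have <- : Q b = 1.
        by rewrite /Q x0 v0 in_coordE// -ub /qform.
      apply: (@cst_MVT_in K `[b, b + e[%classic Q).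
      - exact: interval_is_interval.
      - move=> s; rewrite /= in_itv/= => bse; have [se1 ixs] := in_e s bse; have [xs ds] := xdel s bse.
        apply: deriv_unit_speed.
        + by rewrite -xs; exact: in_coord_differentiable.
        + by rewrite -xs in_coordE// (metric_unit riemg).
        + by rewrite -xs in_coordE// sg.
        + exact: is_deriv_inS (Hx s se1).
        + exact: is_deriv_inS (Hv s se1).
      - by rewrite /= in_itv/= (ltW bt).
      - by rewrite /= in_itv/= lexx ltrDl.
  + subst t; exists i.
    have aE := acceleration_geo_field ip eqb.
    have vt : is_deriv_in J (velocity i J del) b (acceleration i I gam b).
      apply: (is_deriv_in_glue (derivable_in_is_deriv pI Ib d2b) (w := v)).
      * have bb : `|b - b| < e1 by rewrite subrr normr0.
        (* As [gam] solves the geodesic equation at [b], its acceleration there is the value of the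
           field; so the second derivatives from both sides agree as well. *)
        have E : geo_field (in_coord g i) (x b) (v b) = deriv_in I (velocity i I gam) b.
          by rewrite x0 v0 -aE.
        by rewrite -E; exact: Hv.
      * exact: velb.
      * by rewrite velb v0.
      * apply: filterS2 nJb ni => s sbe ds Js; case: leP => sb; last by rewrite velR ?sbe.
        have Is : I s.
          case: Js => //=; rewrite in_itv/= => /andP[bs _].
          by have -> : s = b by apply/le_anti; rewrite sb.
        split; first exact: Is.
        have [->|sb'] := eqVneq s b; first exact: velb.
        have {sb'}sb' : s < b by rewrite lt_neqAle sb'.
        exact: is_deriv_inE pJ (or_introl Is) (nvL s Is sb' (ds Is)).
    split.
    * by rewrite delb.
    * apply: filterS2 nJb ni => s sbe ds Js; have [sb|bs|->] := ltgtP s b.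
      - have Is : I s by case: Js => //=; rewrite in_itv/=; lra.
        by eexists; apply: nvL => //; exact: ds.
      - by eexists; apply: nvR => //; exact: sbe.
      - by eexists; exact: vb.
    * by eexists; exact: vt.
    * apply/(geodesic_eqP atlasC riemg); first by rewrite delb.
      rewrite /acceleration (is_deriv_inE pJ Jt vt) velb delb.
      exact/(geodesic_eqP atlasC riemg).
    * by rewrite delb velb.
Unshelve. all: by end_near. Qed.

End LocalGeodesics.

(** * Continuation into an end outside the domain *)

Section LimitExtension.
Context {K : realType} {n : nat} {T : topologicalType} (C : charts K n T).
Variable g : tensor C.
Hypotheses (atlasC : smooth_atlas C) (riemg : riemannian C g) (hausT : hausdorff_space T).

Lemma left_limit_of_bound {W : normedModType K} (u : K -> W) l M a b : a < b ->
  (forall s, a <= s < b -> `|l - u s| <= M * (b - s)) -> u s @[s --> b^'-] --> l.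
Proof.
move=> ab H; apply/cvgrPdist_le => e e0.
have M1 : 0 < `|M| + 1 by rewrite ltr_wpDl.
near=> s.
have sb : s < b by near: s; exact: nbhs_left_lt.
have as_ : a < s by near: s; exact: nbhs_left_gt.
have se : b - e / (`|M| + 1) < s.
  by near: s; apply: nbhs_left_gt; rewrite ltrBlDr ltrDl divr_gt0.
apply: le_trans (H s _) _; first by rewrite ltW.
apply: (@le_trans _ _ ((`|M| + 1) * (b - s))).
  by rewrite ler_wpM2r ?subr_ge0 ?(ltW sb)//; apply: le_trans (ler_norm _) _; rewrite lerDl.
by rewrite mulrC -ler_pdivlMr//; lra.
Unshelve. all: by end_near. Qed.

Lemma cvg_row_mx {S : Type} (F : set_system S) {FF : Filter F} n1 n2
    (x : S -> 'rV[K]_n1) (v : S -> 'rV[K]_n2) x0 v0 :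
  x s @[s --> F] --> x0 -> v s @[s --> F] --> v0 ->
  (row_mx (x s) (v s) : 'rV[K]_(n1 + n2)) @[s --> F] --> (row_mx x0 v0 : 'rV[K]_(n1 + n2)).
Proof.
move=> xc vc; apply/cvgrPdist_le => e e0; near=> s.
have h1 : `|x0 - x s| <= e by near: s; move/cvgrPdist_le : xc; exact.
have h2 : `|v0 - v s| <= e by near: s; move/cvgrPdist_le : vc; exact.
apply: mx_norm_le => [|i j]; first exact: ltW.
rewrite ord1; case: (split_ordP j) => k ->; rewrite !mxE ?(unsplitK (inl _)) ?(unsplitK (inr _)).
  by have := le_trans (mx_entry_le (x0 - x s) 0 k) h1; rewrite !mxE.
by have := le_trans (mx_entry_le (v0 - v s) 0 k) h2; rewrite !mxE.
Unshelve. all: by end_near. Qed.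

Lemma geo_field_left_limit i p (x v : K -> 'rV[K]_n) v0 b : cdom i p ->
  x s @[s --> b^'-] --> cmap i p -> v s @[s --> b^'-] --> v0 ->
  geo_field (in_coord g i) (x s) (v s) @[s --> b^'-] --> geo_field (in_coord g i) (cmap i p) v0.
Proof.
move=> ip xc vc.
have U0 : in_coord g i (cmap i p) \in unitmx by rewrite (in_coordE g atlasC)// (metric_unit riemg).
have zc : (row_mx (x s) (v s) : 'rV[K]_(n + n)) @[s --> b^'-] --> (row_mx (cmap i p) v0 : 'rV[K]_(n + n)) by exact: cvg_row_mx.
apply/cvgrPdist_le => e e0.
have Hk k : \forall s \near b^'-, `|geo_field (in_coord g i) (cmap i p) v0 0 k -
    geo_field (in_coord g i) (x s) (v s) 0 k| <= e.
  have := locally_lipschitz_cvg (geo_field_lipschitz (metric_smooth_near atlasC riemg ip) U0 v0 k).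
  move=> /cvgrPdist_le/(_ e e0) H.
  have := zc _ H; rewrite nbhs_simpl/=; apply: filterS => s /= h.
  by rewrite !row_mxKl !row_mxKr in h; exact: h.
have : \forall s \near b^'-, forall k, `|geo_field (in_coord g i) (cmap i p) v0 0 k -
    geo_field (in_coord g i) (x s) (v s) 0 k| <= e by exact: filter_forall.
apply: filterS => s Hs; apply: mx_norm_le => [|j k]; first exact: ltW.
by have := Hs k; rewrite ord1 !mxE.
Qed.

Lemma geodesic_speed_bound i (I : set K) gam s M :
  geodesic C g I gam -> I s -> cdom i (gam s) ->
  (forall v : 'rV[K]_n, (v *m in_coord g i (cmap i (gam s)) *m v^T) 0 0 = 1 -> `|v| <= M) ->
  `|velocity i I gam s| <= M.
Proof.
move=> [_ _ _ H] Is ip; apply; have [_ _ _] := H s i Is ip.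
by rewrite /qform (in_coordE g atlasC).
Qed.

(** Inside the ball of radius [r] the coordinate speed is at most [M], so less than [r / 4] is
    travelled before [b], and a curve starting within [r / 4] of the centre stays within [r / 2].
    Interval induction shows that it cannot leave the chart: at a limit time the coordinates
    converge to a point of the chart image. *)
Lemma geodesic_trapped (I : set K) gam b t1 i x0 r M : geodesic C g I gam -> t1 < b ->
  (forall t, t1 <= t < b -> I t) -> 0 <= M -> 0 < r ->
  (forall x, `|x - x0| < r -> (cmap i @` cdom i) x /\
     forall v : 'rV[K]_n, (v *m in_coord g i x *m v^T) 0 0 = 1 -> `|v| <= M) ->
  cdom i (gam t1) -> `|cmap i (gam t1) - x0| < r / 4 -> M * (b - t1) < r / 4 ->
  forall t, t1 <= t < b -> cdom i (gam t) /\ `|cmap i (gam t) - x0| < r / 2.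
Proof.
move=> geoI t1b sub M0 r0 Hr ip1 x1 Mb.
have [pI cI carI HI] := geoI; have [_ cK _ _] := atlasC.
pose x s := cmap i (gam s).
pose P s := cdom i (gam s) /\ `|x s - x0| < r.
have lip t : t1 < t -> t <= b -> (forall s, t1 <= s < t -> P s) ->
    forall s s', t1 <= s < t -> t1 <= s' < t -> `|x s - x s'| <= M * `|s - s'|.
  move=> t1t tb HP s s' hs hs'.
  have iA : is_interval `[t1, t[%classic by exact: interval_is_interval.
  apply: (lipschitz_of_deriv_bound (u' := velocity i I gam) iA) => //.
  - move=> z; rewrite /= in_itv/= => hz; have [iz _] := HP _ hz.
    have Iz : I z by apply: sub; move: hz => /andP[-> /=]; move/lt_le_trans; exact.
    have [d1 _ _ _] := HI z i Iz iz.
    apply: (@is_deriv_inS _ _ I); last exact: derivable_in_is_deriv.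
    move=> w /=; rewrite in_itv/= => /andP[w1 w2]; apply: sub.
    by rewrite w1 (lt_le_trans w2).
  - move=> z; rewrite /= in_itv/= => hz; have [iz xz] := HP _ hz.
    have Iz : I z by apply: sub; move: hz => /andP[-> /=]; move/lt_le_trans; exact.
    by apply: (geodesic_speed_bound geoI Iz iz); exact: (Hr _ xz).2.
have half t : t1 < t -> t <= b -> (forall s, t1 <= s < t -> P s) ->
    forall s, t1 <= s < t -> `|x s - x0| < r / 2.
  move=> t1t tb HP s hs; rewrite -(subrKA (x t1)); apply: le_lt_trans (ler_normD _ _) _.
  have h1 : t1 <= t1 < t by rewrite lexx.
  have := lip t t1t tb HP s t1 hs h1; move: hs => /andP[s1 s2].
  rewrite ger0_norm ?subr_ge0// => h2.
  have : M * (s - t1) <= M * (b - t1) by rewrite ler_wpM2l// lerD2r ltW// (lt_le_trans s2).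
  move: x1; rewrite -/(x t1); lra.
have HP : forall t, t1 <= t < b -> P t.
  apply: interval_induction.
  - by split=> //; apply: lt_trans x1 _; lra.
  - move=> t tt [it xt]; have It := sub t tt.
    have n1 := within_continuous_near cI It (near_cdom atlasC it).
    have xr : \forall y \near x t, `|y - x0| < r.
      apply/nbhs_ballP; exists (r - `|x t - x0|) => /=; first by rewrite subr_gt0.
      move=> y; rewrite -ball_normE/= => h; rewrite -(subrKA (x t)); apply: le_lt_trans (ler_normD _ _) _.
      rewrite distrC; lra.
    have xr' : \forall q \near gam t, `|cmap i q - x0| < r by exact: (cmap_cvg atlasC it xr).
    have n2 := within_continuous_near cI It xr'.
    apply: filterS2 n1 n2 => s h1 h2 /andP[ts sb].
    have Is : I s by apply: sub; rewrite sb andbT; move: tt => /andP[t1t _]; exact: le_trans t1t ts.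
    by split; [exact: h1|exact: h2].
  - move=> t /andP[t1t tb] HPt.
    have [l Hl] := lipschitz_left_limit t1t (lip t t1t (ltW tb) HPt).
    have lx0 : `|l - x0| < r.
      rewrite -(subrKA (x t1)); apply: le_lt_trans (ler_normD _ _) _.
      have h1 : t1 <= t1 < t by rewrite lexx.
      have := Hl t1 h1.
      have : M * (t - t1) <= M * (b - t1) by rewrite ler_wpM2l// lerD2r ltW.
      move: x1; rewrite -/(x t1); lra.
    have [li _] := Hr _ lx0; have [xq iq] := image_cinv atlasC li.
    have It : I t by apply: sub; rewrite (ltW t1t).
    (* Both [gam t] and [cinv i l] are limits of [gam] at [t] from the left; Hausdorff separation
       identifies them. *)
    suff gt : gam t = cinv i l by rewrite /P /x gt; split=> //; rewrite xq.
    apply: hausT => A B nA nB.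
    have n1 := within_continuous_near cI It nA.
    have xl := left_limit_of_bound t1t Hl.
    have nB' : \forall y \near l, B (cinv i y).
      by have := near_chart atlasC iq nB; rewrite xq; apply: filterS => y [].
    have n2 := xl _ nB'.
    suff [s [h1 h2 h3 h4]] : exists s, [/\ t1 < s, s < t, I s -> A (gam s) & B (cinv i (x s))].
      have Is : I s by apply: sub; rewrite (ltW h1) (lt_trans h2).
      exists (gam s); split; first exact: h3.
      have hs : t1 <= s < t by rewrite (ltW h1).
      by have [is_ _] := HPt s hs; rewrite /x cK in h4.
    near t^'- => s; exists s; split.
    + by near: s; exact: nbhs_left_gt.
    + by near: s; exact: nbhs_left_lt.
    + by near: s; apply: filterS n1 => s h _.
    + by near: s.
move=> t tt; have [it _] := HP t tt; split=> //.
exact: (half b t1b (lexx b) HP).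
Unshelve. all: by end_near. Qed.

(** The added end satisfies all conditions of [geodesic], the second derivative included, because
    the acceleration is the continuous field [geo_field] evaluated at a converging position and a
    converging velocity. *)
Lemma geodesic_extend_limit (I : set K) gam b t0 p : geodesic C g I gam ->
  (forall t, I t -> t < b) -> t0 < b -> (forall t, t0 <= t < b -> I t) -> carrier C p ->
  (forall P : set T, nbhs p P -> forall t1, t1 < b -> exists t, [/\ t1 < t, t0 < t, t < b & P (gam t)]) ->
  exists2 del, geodesic C g (I `|` [set b]) del & {in I, del =1 gam}.
Proof.
move=> geoI Ib t0b sub [i _ ip] Hp.
have [pI cI carI HI] := geoI; have [_ cK _ _] := atlasC; have [sg _ _ _] := riemg.
have U0 : in_coord g i (cmap i p) \in unitmx by rewrite (in_coordE g atlasC)// (metric_unit riemg).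
have [M M0 nM] := unit_velocity_bound atlasC riemg ip.
have [B B0 nB] := geo_field_le (metric_smooth_near atlasC riemg ip) U0.
have : \forall x \near cmap i p, [/\ (cmap i @` cdom i) x,
   forall v : 'rV[K]_n, (v *m in_coord g i x *m v^T) 0 0 = 1 -> `|v| <= M &
   forall v, `|geo_field (in_coord g i) x v| <= B * (`|v| * `|v|)].
  by apply: filterS3 (near_image atlasC ip) nM nB.
move=> /nbhs_ballP[r /= r0 Hr'].
have Hr x : `|x - cmap i p| < r -> [/\ (cmap i @` cdom i) x,
   forall v : 'rV[K]_n, (v *m in_coord g i x *m v^T) 0 0 = 1 -> `|v| <= M &
   forall v, `|geo_field (in_coord g i) x v| <= B * (`|v| * `|v|)].
  by move=> xr; apply: Hr'; rewrite -ball_normE/= distrC.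
have r4 : 0 < r / 4 by rewrite divr_gt0.
have M1 : 0 < M + 1 by rewrite ltr_wpDl.
(* The time [t1] is so late that the remaining displacement, at most [M * (b - t1)], is below
   [r / 4]; the divisor [M + 1] covers [M = 0]. *)
have [t1 [bt1 t01 t1b [ip1 xp1]]] : exists t, [/\ b - (r / 4) / (M + 1) < t, t0 < t, t < b &
    cdom i (gam t) /\ `|cmap i (gam t) - cmap i p| < r / 4].
  apply: (Hp (fun q => cdom i q /\ `|cmap i q - cmap i p| < r / 4)); last first.
    by rewrite ltrBlDr ltrDl divr_gt0.
  apply: filterI; first exact: near_cdom.
  have := cmap_cvg atlasC ip => /cvgrPdist_lt/(_ _ r4); apply: filterS => q.
  by rewrite distrC.
have Mb : M * (b - t1) < r / 4.
  apply: (@le_lt_trans _ _ ((M + 1) * (b - t1))).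
    by rewrite ler_wpM2r ?lerDl// subr_ge0 ltW.
  by rewrite mulrC -ltr_pdivlMr//; lra.
have sub1 t : t1 <= t < b -> I t.
  by move=> /andP[h1 h2]; apply: sub; rewrite h2 andbT (le_trans (ltW t01)).
have trap : forall t, t1 <= t < b -> cdom i (gam t) /\ `|cmap i (gam t) - cmap i p| < r / 2.
  apply: (geodesic_trapped geoI t1b sub1 M0 r0 _ ip1 xp1 Mb) => x xr.
  by have [? ? _] := Hr x xr.
pose x s := cmap i (gam s); pose v := velocity i I gam.
have inr s : t1 <= s < b -> `|x s - cmap i p| < r.
  by move=> /trap[_ h]; apply: lt_trans h _; lra.
have dx s : t1 <= s < b -> is_deriv_in I x s (v s).
  move=> hs; have [is_ _] := trap s hs; have Is := sub1 s hs.
  by have [d1 _ _ _] := HI s i Is is_; exact: derivable_in_is_deriv.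
have dv s : t1 <= s < b -> is_deriv_in I v s (geo_field (in_coord g i) (x s) (v s)).
  move=> hs; have [is_ _] := trap s hs; have Is := sub1 s hs.
  have [_ d2 e _] := HI s i Is is_.
  by rewrite -(acceleration_geo_field atlasC riemg is_ e); exact: derivable_in_is_deriv.
have vM s : t1 <= s < b -> `|v s| <= M.
  move=> hs; have [is_ _] := trap s hs; have Is := sub1 s hs.
  by apply: (geodesic_speed_bound geoI Is is_); have [_ ? _] := Hr _ (inr s hs).
have aM s : t1 <= s < b -> `|geo_field (in_coord g i) (x s) (v s)| <= B * (M * M).
  move=> hs; have [_ _ /(_ (v s)) h] := Hr _ (inr s hs); apply: le_trans h _.
  by rewrite ler_wpM2l// ler_pM// vM.
have iA : is_interval `[t1, b[%classic by exact: interval_is_interval.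
have subA : `[t1, b[%classic `<=` I by move=> s; rewrite /= in_itv/=; exact: sub1.
have [xb Hxb] : exists l, forall s, t1 <= s < b -> `|l - x s| <= M * (b - s).
  apply: lipschitz_left_limit => // s s' hs hs'.
  apply: (lipschitz_of_deriv_bound (u' := v) iA) => //.
  - by move=> z; rewrite /= in_itv/= => hz; apply: is_deriv_inS (dx z hz).
have [vb Hvb] : exists l, forall s, t1 <= s < b -> `|l - v s| <= B * (M * M) * (b - s).
  apply: lipschitz_left_limit => // s s' hs hs'.
  apply: (lipschitz_of_deriv_bound (u' := fun s => geo_field (in_coord g i) (x s) (v s)) iA) => //.
  - by rewrite !mulr_ge0.
  - by move=> z; rewrite /= in_itv/= => hz; apply: is_deriv_inS (dv z hz).
have xbr : `|xb - cmap i p| < r.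
  have h1 : t1 <= t1 < b by rewrite lexx.
  rewrite -(subrKA (x t1)); apply: le_lt_trans (ler_normD _ _) _.
  have := Hxb t1 h1; move: xp1; rewrite -/(x t1); lra.
have [xbi _ _] := Hr _ xbr; have [xq iq] := image_cinv atlasC xbi.
set q := cinv i xb in xq iq.
have xc : x s @[s --> b^'-] --> xb by exact: left_limit_of_bound Hxb.
have vc : v s @[s --> b^'-] --> vb by exact: left_limit_of_bound Hvb.
have ac : geo_field (in_coord g i) (x s) (v s) @[s --> b^'-] --> geo_field (in_coord g i) xb vb.
  by rewrite -xq; apply: geo_field_left_limit => //; rewrite xq.
pose J := I `|` [set b].
(* The value at [b] is the point [q] of the chart with the limit coordinates [xb]. *)
pose del t := if t < b then gam t else q.
have delb : del b = q by rewrite /del ltxx.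
have delI : {in I, del =1 gam} by move=> t; rewrite inE => It; rewrite /del Ib.
have pJ : proper_interval J.
  move: pI => [iI [s0 [s1 [Is0 Is1 s01]]]]; split; last by exists s0, s1; split=> //; left.
  move=> a c Ja Jc z /andP[az zc].
  have [zb|bz] := ltP z b; last first.
    right; apply/le_anti; rewrite /= bz andbT (le_trans zc)//.
    by case: Jc => [/Ib/ltW|/= ->].
  have Ia : I a by case: Ja => //= ab; move: az; rewrite ab; lra.
  left; have [t0z|zt0] := leP t0 z; first by apply: sub; rewrite t0z.
  by apply: (iI a t0) => //; [apply: sub; rewrite lexx|rewrite az ltW].
have Jb : J b by right.
have J_le t : J t -> t <= b by move=> [/Ib/ltW|/= ->].
have It_lt t : I t -> \forall s \near t, (J s <-> I s) /\ (I s -> del s = gam s).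
  move=> /Ib tb; have : \forall s \near t, s < b by exact: lt_nbhsl.
  apply: filterS => s sb; split; last by move=> _; rewrite /del sb.
  by split; [case=> //= sb'; move: sb; rewrite sb' ltxx|left].
have dJ s : t1 <= s < b -> is_deriv_in J (cmap i \o del) s (v s).
  move=> hs; have Is := sub1 s hs.
  apply: is_deriv_in_near (dx s hs).
    by rewrite /= delI ?inE.
  apply: filterS (It_lt s Is) => z [h1 h2] Jz; have Iz := h1.1 Jz.
  by rewrite /= h2.
have dJb : is_deriv_in J (cmap i \o del) b vb.
  apply: (is_deriv_in_left_limit (a := t1) (I := I) (u := x) (u' := v)) => //.
  - by rewrite /= delb xq.
  - by move=> t /andP[_ tb]; rewrite /= /del tb.
have velE s : t1 <= s < b -> velocity i J del s = v s.
  by move=> hs; apply: is_deriv_inE (dJ s hs) => //; left; exact: sub1.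
have velb : velocity i J del b = vb by exact: is_deriv_inE dJb.
have aJb : is_deriv_in J (velocity i J del) b (geo_field (in_coord g i) xb vb).
  apply: (is_deriv_in_left_limit (a := t1) (I := I) (u := v)
    (u' := fun s => geo_field (in_coord g i) (x s) (v s))) => //.
  by rewrite velb.
have near_b : \forall s \near b, J s -> t1 <= s.
  by near=> s => _; apply: ltW; near: s; exact: lt_nbhsr.
have dG : differentiable (in_coord g i) xb.
  by rewrite -xq; exact: in_coord_differentiable.
exists del => //; apply: geodesic_of_local => //.
- move=> t [It|/= ->]; apply: within_near_cvg => P.
    rewrite delI ?inE// => Pg.
    have := within_continuous_near cI It Pg.
    apply: filterS2 (It_lt t It) => s [h1 h2] h3 Js.
    by have Is := h1.1 Js; rewrite (h2 Is); exact: h3.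
  rewrite delb => Pq.
  have dc := is_deriv_in_cvg dJb; rewrite /= delb xq in dc.
  have Pc : \forall y \near xb, P (cinv i y).
    by rewrite -xq; apply: (cinv_cvg atlasC iq).
  have := cvg_within_near dc Pc.
  apply: filterS2 near_b => s h1 h2 Js; have := h2 Js; rewrite /= cK//.
  have [sb|sb] := ltP s b; last by rewrite /del ltNge sb.
  by rewrite /del sb; apply: (trap _ _).1; rewrite sb (h1 Js).
- move=> t [It|/= ->].
    have [j _ jt] := carI t It; exists j.
    apply: (geodesic_at_near pI pJ It _ _ (It_lt t It) (geodesic_atP atlasC geoI It jt)).
      by left.
    by rewrite delI ?inE.
  exists i; split.
  + by rewrite delb.
  + apply: filterS near_b => s h Js; have := J_le s Js; rewrite le_eqVlt => /predU1P[->|sb].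
      by eexists; exact: dJb.
    by eexists; apply: dJ; rewrite sb (h Js).
  + by eexists; exact: aJb.
  + apply/(geodesic_eqP atlasC riemg); first by rewrite delb.
    rewrite /acceleration (is_deriv_inE pJ Jb aJb) velb delb xq => u.
    apply: geo_field_form => //.
    by rewrite -xq (in_coordE g atlasC)// (metric_unit riemg).
  + rewrite /qform delb velb -(in_coordE g atlasC iq) xq.
    have dGc : differentiable (in_coord g i) ((cmap i \o del) b) by rewrite /= delb xq.
    have := is_deriv_in_mulmx (is_deriv_in_mulmx aJb (is_deriv_in_comp dGc dJb)) (is_deriv_in_tr aJb).
    move=> /is_deriv_in_mxP/(_ 0 0)/is_deriv_in_cvg/=; rewrite delb velb xq => Ec.
    (* The squared speed at [b] is the limit of its values before [b], all equal to [1]. *)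
    apply/eqP; rewrite -subr_eq0 -normr_le0; apply/ler_addgt0Pr => e e0; rewrite add0r.
    move/cvgrPdist_le/(_ e e0) : Ec; rewrite near_withinE => Ec.
    have [s [sJ hs]] : exists s, (J s -> `|(vb *m in_coord g i xb *m vb^T) 0 0 -
        (velocity i J del s *m in_coord g i (cmap i (del s)) *m (velocity i J del s)^T) 0 0| <= e) /\ t1 < s < b.
      near b^'- => s; exists s; split; last first.
        by apply/andP; split; near: s; [exact: nbhs_left_gt|exact: nbhs_left_lt].
      by near: s; apply: filterS Ec => s h _.
    have hs' : t1 <= s < b by move: hs => /andP[/ltW -> ->].
    have Is := sub1 s hs'; have := sJ (or_introl Is).
    have [is_ _] := trap s hs'.
    rewrite (velE s hs') delI ?inE// (in_coordE g atlasC)//.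
    have [_ _ _] := HI s i Is is_; rewrite /qform -/v => ->; exact.
Unshelve. all: by end_near. Qed.

(** The two conclusions contradict maximality by the two continuations: past an end in the domain,
    and into an end outside it, where compactness of [Kc] supplies a cluster point. *)
Lemma maximal_geodesic_right_end (I : set K) gam b t0 (Kc : set T) : maximal_geodesic C g I gam ->
  (forall t, I t -> t <= b) -> (forall t, t0 <= t < b -> I t) -> I t0 ->
  compact Kc -> Kc `<=` carrier C ->
  ~ I b /\ ~ (forall t, t0 <= t < b -> Kc (gam t)).
Proof.
move=> [geoI maxI] Hb sub It0 cKc subK.
have nIb : ~ I b.
  move=> Ib; have [e [del [e0 geoJ delE]]] := geodesic_extend_closed atlasC riemg geoI Ib Hb.
  have := maxI _ _ geoJ (@subsetUl _ _ _) delE.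
  move=> /seteqP[/(_ (b + e / 2)) h _].
  have : I (b + e / 2) by apply: h; right; rewrite /= in_itv/=; apply/andP; split; lra.
  by move=> /Hb; lra.
have Ib t : I t -> t < b.
  by move=> It; rewrite lt_neqAle Hb// andbT; apply: contra_notN nIb => /eqP <-.
have t0b := Ib _ It0.
split=> // inK.
have FK : (gam @ b^'-) Kc.
  rewrite /= nbhs_simpl/=; near=> s; apply: inK; apply/andP; split; last by near: s; exact: nbhs_left_lt.
  by apply: ltW; near: s; exact: nbhs_left_gt.
have [p [Kp cp]] := cKc (gam @ b^'-) _ FK.
have [||del geoJ delE] := @geodesic_extend_limit I gam b t0 p geoI Ib t0b sub.
- exact: subK.
- move=> P nP t1 t1b.
  have F1 : (gam @ b^'-) (gam @` [set t | [/\ t1 < t, t0 < t & t < b]]).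
    rewrite /= nbhs_simpl/=; near=> s.
    have h1 : t1 < s by near: s; exact: nbhs_left_gt.
    have h2 : t0 < s by near: s; exact: nbhs_left_gt.
    have h3 : s < b by near: s; exact: nbhs_left_lt.
    by exists s.
  have [_ [[t [h1 h2 h3] <-] Pt]] := cp _ _ F1 nP.
  by exists t.
have := maxI _ _ geoJ (@subsetUl _ _ _) delE.
by move=> /seteqP[/(_ b) h _]; apply: nIb; apply: h; right.
Unshelve. all: by end_near. Qed.

End LimitExtension.

(** * Warped products *)

Section Cylinder.
Context {K : realType} {n : nat} {Y : topologicalType} (A : charts K n Y).
Hypothesis atlasA : smooth_atlas A.

Lemma hausdorff_prod {U V : topologicalType} :
  hausdorff_space U -> hausdorff_space V -> hausdorff_space (U * V)%type.
Proof.
move=> hU hV [p q] [p' q'] cl; congr pair.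
- apply: hU => P Q pP pQ.
  have [[x y] [/= Px Qx]] := cl _ _ (cvg_fst (F := nbhs p) (G := nbhs q) pP)
    (cvg_fst (F := nbhs p') (G := nbhs q') pQ).
  by exists x.
- apply: hV => P Q pP pQ.
  have [[x y] [/= Px Qx]] := cl _ _ (cvg_snd (F := nbhs p) (G := nbhs q) pP)
    (cvg_snd (F := nbhs p') (G := nbhs q') pQ).
  by exists y.
Qed.

Lemma open_prod {U V : topologicalType} (P : set U) (Q : set V) : open P -> open Q -> open (P `*` Q).
Proof.
move=> oP oQ; rewrite openE => -[p q] [/= Pp Qq].
by exists (P, Q) => //; split; apply: open_nbhs_nbhs; split.
Qed.

Lemma differentiable_mulmxr m1 m2 m3 (B : 'M[K]_(m2, m3)) (x : 'M[K]_(m1, m2)) :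
  differentiable (mulmxr B : 'M[K]_(m1, m2) -> 'M[K]_(m1, m3)) x.
Proof.
apply: linear_differentiable.
apply: (@lip_continuous _ _ _ _ (m2%:R * `|B| + 1)); first by rewrite ltr_wpDl// mulr_ge0.
move=> y z; rewrite /mulmxr -mulmxBl; apply: le_trans (mulmx_norm_le _ _) _.
rewrite mulrDl mul1r mulrCA mulrC; apply: ler_wpDr => //; rewrite -mulrA mulrCA.
Qed.

Lemma differentiable_row_mx {V : normedModType K} m1 m2 (a : V -> 'rV[K]_m1) (w : V -> 'rV[K]_m2) x :
  differentiable a x -> differentiable w x -> differentiable (fun y => row_mx (a y) (w y)) x.
Proof.
move=> da dw.
have -> : (fun y => row_mx (a y) (w y)) =
   (mulmxr (row_mx 1%:M 0) \o a) + (mulmxr (row_mx 0 1%:M) \o w).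
  apply/funext => y; rewrite !fctE/= !mul_mx_row !mulmx1 !mulmx0 add_row_mx addr0 add0r.
  by [].
apply: differentiableD; apply: differentiable_comp => //; exact: differentiable_mulmxr.
Qed.

Lemma derive_row_mx k m1 m2 (a : 'rV[K]_(k + m1) -> 'rV[K]_k) (w : 'rV[K]_m1 -> 'rV[K]_m2) x v :
  differentiable a x -> differentiable w (rsubmx x) ->
  'D_v (fun y => row_mx (a y) (w (rsubmx y))) x =
  row_mx ('D_v a x) ('D_(rsubmx v) w (rsubmx x)).
Proof.
move=> da dw.
have dG : differentiable (fun y : 'rV[K]_(k + m1) => row_mx (a y) (w (rsubmx y))) x.
  have dw' : differentiable (w \o rsubmx) x.
    by apply: differentiable_comp => //; exact: differentiable_rsubmx.
  exact: (differentiable_row_mx da dw').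
apply/rowP => j; rewrite (derive_entry v 0 j dG); case: (split_ordP j) => l ->.
  rewrite row_mxEl (derive_entry v 0 l da); congr ('D_v _ x); apply/funext => y.
  by rewrite row_mxEl.
rewrite row_mxEr (derive_entry _ 0 l dw) /derive.
have E h : rsubmx (h *: v + x) = h *: rsubmx v + rsubmx x by apply/matrixP => p q; rewrite !mxE.
congr lim; apply/funext => P /=.
by under eq_fun do rewrite !row_mxEr E.
Qed.

Lemma iter_derive_row_mx k m1 m2 (U : set 'rV[K]_m1) (phi : 'rV[K]_m1 -> 'rV[K]_m2) vs :
  open U -> smooth_on U phi ->
  exists2 a : 'rV[K]_(k + m1) -> 'rV[K]_k, a = lsubmx \/ (exists c, a = cst c) &
   forall x, U (rsubmx x) ->
    iter_derive vs (fun x : 'rV[K]_(k + m1) => row_mx (lsubmx x) (phi (rsubmx x))) x =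
    row_mx (a x) (iter_derive (map rsubmx vs) phi (rsubmx x)).
Proof.
move=> oU sm; elim: vs => [|v vs [a aE IH]]; first by exists lsubmx => //; left.
have da x : differentiable a x.
  by case: aE => [->|[c ->]]; [exact: differentiable_lsubmx|exact: differentiable_cst].
exists ('D_v a).
  right; case: aE => [->|[c ->]].
    exists (lsubmx v); apply/funext => x; rewrite deriveE; last exact: differentiable_lsubmx.
    by rewrite diff_lin//; exact: continuous_lsubmx.
  by exists 0; apply/funext => x; rewrite derive_cst.
move=> x Ux /=; rewrite -derive_row_mx//; last exact: sm.
apply: near_eq_derive.
have : \forall y \near x, U (rsubmx y).
  by apply: (@continuous_rsubmx K 1 k m1 x); apply: open_nbhs_nbhs; split.
by apply: filterS => y /IH.
Qed.

Lemma cylinder_carrier (R : K) r y : carrier (cylinder A R) (r, y) <-> 0 < r < R /\ carrier A y.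
Proof.
split; first by move=> [i _ [/=]]; rewrite in_itv/= => rR iy; split=> //; exists i.
by move=> [rR [i _ iy]]; exists i => //; split=> //=; rewrite in_itv.
Qed.

Definition slab (R : K) (S : set 'rV[K]_n) : set 'rV[K]_(1 + n) :=
  [set x | 0 < lsubmx x 0 0 < R /\ S (rsubmx x)].

Lemma open_slab R S : open S -> open (slab R S).
Proof.
move=> oS; rewrite openE => x [/andP[x0 xR] Sx].
have l : \forall y \near x, 0 < lsubmx y 0 0 /\ lsubmx y 0 0 < R.
  have c : (lsubmx y : 'M[K]_1) 0 0 @[y --> x] --> (lsubmx x : 'M[K]_1) 0 0.
    by under eq_fun do rewrite mxE; rewrite mxE; exact: coord_continuous.
  apply: filterI; first exact: (c _ (lt_nbhsr x0)).
  exact: (c _ (lt_nbhsl xR)).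
have r : \forall y \near x, S (rsubmx y).
  by apply: (@continuous_rsubmx K 1 1 n x); apply: open_nbhs_nbhs; split.
by apply: filterS2 l r => y [h1 h2] h3; split; rewrite ?h1.
Qed.

Lemma cylinder_image (R : K) (i : cidx A) (S : set Y) :
  (cmap (c := cylinder A R) i) @` (`]0, R[ `*` S) = slab R (cmap i @` S).
Proof.
apply/seteqP; split => [_ [[r y] [/= rR Sy] <-]|x [xR [y Sy yx]]].
  rewrite in_itv/= in rR; rewrite /slab/= row_mxKl row_mxKr mxE; split=> //.
  by exists y.
exists (lsubmx x 0 0, y); first by split=> //=; rewrite in_itv.
by rewrite /= yx -mx11_scalar hsubmxK.
Qed.

Lemma cylinder_atlas (R : K) : smooth_atlas (cylinder A R).
Proof.
have [oA cK cA smA] := atlasA; split=> [i|i [r y] [_ iy]|i|i j].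
- split; first exact: (open_prod (itv_open _ _) (oA i).1).
  by rewrite cylinder_image; apply: open_slab; exact: (oA i).2.
- by rewrite /= row_mxKl row_mxKr mxE cK.
- split.
    apply/subspace_continuousP => -[r y] [/= rR iy].
    have ci := cmap_cvg atlasA iy.
    apply: cvg_within_filter; apply: cvg_row_mx.
      apply: (cvg_comp _ _ (@cvg_fst _ _ (nbhs r) (nbhs y) _)) => /= P.
      move=> /nbhs_ballP[e /= e0 He]; apply/nbhs_ballP; exists e => //= s; rewrite -ball_normE/= => rs.
      apply: He; rewrite -ball_normE/=; apply: le_lt_trans rs.
      by apply: mx_norm_le => // k l; rewrite !mxE !ord1 mulr1n.
    exact: (cvg_comp _ _ (@cvg_snd _ _ (nbhs r) (nbhs y) _) ci).
  rewrite cylinder_image; apply/subspace_continuousP => x [xR [y iy yx]].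
  apply: cvg_within_filter => P /= [[U V] [/= nU nV] UV].
  have l : \forall z \near x, U (lsubmx z 0 0).
    have c : (lsubmx z : 'M[K]_1) 0 0 @[z --> x] --> (lsubmx x : 'M[K]_1) 0 0.
      by under eq_fun do rewrite mxE; rewrite mxE; exact: coord_continuous.
    exact: c.
  have r : \forall z \near x, V (cinv (c := A) i (rsubmx z)).
    have c : (cinv (c := A) i) z @[z --> rsubmx x] --> cinv (c := A) i (rsubmx x).
      by rewrite -yx cK//; exact: cinv_cvg.
    exact: (@continuous_rsubmx K 1 1 n x _ (c V nV)).
  by apply: filterS2 l r => z Uz Vz; exact: UV.
- have -> : cdom (c := cylinder A R) i `&` cdom (c := cylinder A R) j = `]0, R[ `*` (cdom (c := A) i `&` cdom (c := A) j).
    by apply/seteqP; split => [[r y] [[/= ? ?] [_ ?]]|[r y] [/= ? [? ?]]].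
  rewrite cylinder_image => vs x [xR xU].
  set S := cmap (c := A) i @` (cdom (c := A) i `&` cdom (c := A) j) in xU.
  have oS : open S.
    rewrite openE => _ [y [iy jy] <-]; apply: filterS (near_chart atlasA iy (near_cdom atlasA jy)) => z [zE iz jz].
    by exists (cinv (c := A) i z).
  have [a aE H] := iter_derive_row_mx (k := 1%N) vs oS (smA i j).
  have -> : cmap (c := cylinder A R) j \o cinv (c := cylinder A R) i =
      fun x : 'rV[K]_(1 + n) => row_mx (lsubmx x) ((cmap (c := A) j \o cinv (c := A) i) (rsubmx x)).
    by apply/funext => z; rewrite /= -mx11_scalar.
  have nS : \forall y \near x, S (rsubmx y).
    by apply: (@continuous_rsubmx K 1 1 n x); apply: open_nbhs_nbhs; split.
  have da z : differentiable a z.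
    by case: aE => [->|[c ->]]; [exact: differentiable_lsubmx|exact: differentiable_cst].
  apply: (near_differentiable (F := fun x => row_mx (a x) ((iter_derive (map rsubmx vs) (cmap (c := A) j \o cinv (c := A) i) \o rsubmx) x))).
    by apply: filterS nS => z Sz; rewrite H.
  apply: differentiable_row_mx => //.
  by apply: differentiable_comp; [exact: differentiable_rsubmx|exact: smA].
Qed.

Lemma smooth_onS {V W : normedModType K} (U U' : set V) (u : V -> W) :
  U' `<=` U -> smooth_on U u -> smooth_on U' u.
Proof. by move=> s H vs x /s; exact: H. Qed.

Lemma riemannian_shrink (R R' : K) (g : cidx A -> K * Y -> 'M[K]_(1 + n)) : R' <= R ->
  riemannian (cylinder A R) g -> riemannian (cylinder A R') g.
Proof.
move=> RR [g1 g2 g3 g4].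
have sub i : cdom (c := cylinder A R') i `<=` cdom (c := cylinder A R) i.
  move=> [r y] [/=]; rewrite !in_itv/= => /andP[r0 rR] iy; split=> //=.
  by rewrite r0 (lt_le_trans rR).
split=> [i p /sub|i p /sub|i|i j p /sub ip /sub jp]; [exact: g1|exact: g2| |exact: (g4 i j)].
by apply: smooth_onS (g3 i); apply: image_subset; exact: sub.
Qed.

Lemma cylinder_compact (R a b : K) : compact [set: Y] -> carrier A = [set: Y] -> 0 < a -> b < R ->
  compact (`[a, b] `*` [set: Y]) /\ `[a, b] `*` [set: Y] `<=` carrier (cylinder A R).
Proof.
move=> cY AY a0 bR; split; first by apply: compact_setX => //; exact: segment_compact.
move=> [r y] [/=]; rewrite in_itv/= => /andP[ar rb] _; apply/cylinder_carrier; rewrite AY; split=> //.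
by rewrite (lt_le_trans a0)// (le_lt_trans rb).
Qed.

End Cylinder.

(** The Euler-Lagrange form of the geodesic equation: the momentum [v G] has derivative
    [a G + v 'D_v G], the first two terms of [geo_form]. It is evaluated below on radial and on
    fibre directions [u], in which the derivative of the warped metric is explicit. *)
Lemma momentum_equation {K : realType} {n : nat} {T : topologicalType} (C : charts K n T)
    (g : tensor C) (I : set K) gam i t : smooth_atlas C -> riemannian C g ->
  geodesic C g I gam -> I t -> cdom i (gam t) ->
  exists2 P, is_deriv_in I (fun s => velocity i I gam s *m g i (gam s)) t P &
    forall u, (P *m u^T) 0 0 = 2^-1 * (velocity i I gam t *m
      'D_u (in_coord g i) (cmap i (gam t)) *m (velocity i I gam t)^T) 0 0.
Proof.
move=> atlasC riemg geoI It ip.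
have [pI cI carI HI] := geoI; have [d1 d2 e _] := HI t i It ip.
have dG := in_coord_differentiable riemg ip.
have dv := derivable_in_is_deriv pI It d2; have dx := derivable_in_is_deriv pI It d1.
have := is_deriv_in_mulmx dv (is_deriv_in_comp dG dx).
set P := (X in is_deriv_in _ _ _ X) => dP; exists P.
  apply: is_deriv_in_near dP; first by rewrite /= (in_coordE g atlasC).
  have := within_continuous_near cI It (near_cdom atlasC ip).
  by apply: filterS => s H Is; split=> //=; rewrite (in_coordE g atlasC)//; exact: H.
move=> u; have := (geodesic_eqP atlasC riemg I ip).1 e u.
rewrite /geo_form /P mulmxDl mx11D => /eqP; rewrite subr_eq0 => /eqP <-.
by [].
Qed.

Definition radial_velocity {K : realType} {Y : topologicalType} (I : set K)
  (gam : K -> (K * Y)%type) : K -> K := deriv_in I (fst \o gam).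

(** * The radial equation of a geodesic in a warped product *)

Section WarpedGeodesic.
Context {K : realType} {n : nat} {Y : topologicalType} (A : charts K n Y).
Variables (R : K) (f : K -> K) (h : K -> tensor A).
Hypotheses (atlasA : smooth_atlas A) (wpgh : generalized_warped_product R f h).

(** Estimates can thus be made on the cylinder of radius [R], whereas maximality refers to the
    smaller one. *)
Lemma geodesic_widen (R' : K) (I : set K) (gam : K -> K * Y) : R' <= R ->
  geodesic (cylinder A R') (warped_metric f h) I gam ->
  geodesic (cylinder A R) (warped_metric f h) I gam.
Proof.
move=> RR [pI cI carI HI]; split=> // [t It|t i It [_ /= iy]].
  have := carI t It; case: (gam t) => r y /cylinder_carrier[/andP[r0 rR] cy].
  by apply/cylinder_carrier; rewrite r0 (lt_le_trans rR).
apply: (HI t i It); split=> //=; have := carI t It; case: (gam t) => r z /cylinder_carrier[].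
by rewrite in_itv.
Qed.

Lemma block_form (V W : 'rV[K]_(1 + n)) (a : K) (B : 'M[K]_n) :
  (V *m block_mx (a%:M : 'M[K]_1) 0 0 B *m W^T) 0 0 =
  lsubmx V 0 0 * a * lsubmx W 0 0 + (rsubmx V *m B *m (rsubmx W)^T) 0 0.
Proof.
rewrite -{1}(hsubmxK V) -{1}(hsubmxK W) mul_row_block !mulmx0 addr0 add0r tr_row_mx mul_row_col mx11D.
congr (_ + _); rewrite mul_mx_scalar -scalemxAl mxE [X in _ * X]mxE big_ord1 [(lsubmx W)^T _ _]mxE.
by rewrite mulrCA mulrA.
Qed.

Lemma is_deriv_in_submx (I : set K) (X : K -> 'rV[K]_(1 + n)) t v : is_deriv_in I X t v ->
  is_deriv_in I (fun s => lsubmx (X s) 0 0 : K) t (lsubmx v 0 0) /\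
  is_deriv_in I (fun s => rsubmx (X s)) t (rsubmx v).
Proof.
move=> /is_deriv_in_mxP H; split.
  by rewrite mxE; under eq_fun do rewrite mxE; exact: H.
by apply/is_deriv_in_mxP => i j; rewrite mxE; under eq_fun do rewrite mxE; exact: H.
Qed.

Lemma proper_interval_oo : 0 < R -> proper_interval `]0, R[%classic.
Proof.
move=> R0; split; first exact: interval_is_interval.
by exists (R / 3), (R / 2); rewrite /= !in_itv/=; split; apply/andP || idtac; lra.
Qed.

Lemma proper_interval_co : 0 < R -> proper_interval `[0, R[%classic.
Proof.
move=> R0; split; first exact: interval_is_interval.
by exists (R / 3), (R / 2); rewrite /= !in_itv/=; split; apply/andP || idtac; lra.
Qed.

Definition warp_slope (r : K) : K := deriv_in `]0, R[ f r.

Lemma is_deriv_in_warp r : 0 < r < R -> is_deriv_in `]0, R[ f r (warp_slope r).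
Proof.
move=> rR; have [[[df _] _] _ _ _ _] := wpgh; have /andP[r0 rR'] := rR.
apply: derivable_in_is_deriv; first exact: proper_interval_oo (lt_trans r0 rR').
  by rewrite /= in_itv.
by apply: df; rewrite /= in_itv.
Qed.

Lemma is_deriv_in_metric r i y : 0 < r < R -> cdom i y ->
  is_deriv_in `]0, R[ (fun s => h s i y) r (dr_metric R h r i y).
Proof.
move=> rR iy; have [_ _ /(_ i)[dh _ _] _ _] := wpgh; have /andP[r0 rR'] := rR.
apply: (@is_deriv_inS _ _ `[0, R[%classic).
  by move=> s /=; rewrite !in_itv/= => /andP[/ltW -> ->].
have I0 : `[0, R[%classic r by rewrite /= in_itv/= (ltW r0).
apply: derivable_in_is_deriv => //; first exact: proper_interval_co (lt_trans r0 rR').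
exact: (dh (r, y)).
Qed.

Let g := warped_metric f h.
Let C := cylinder A R.

(** The metric is followed along the coordinate line of [r], where the [r]-derivatives of [f] and of
    [h] at fixed [y] suffice; uniqueness of the derivative identifies the directional derivative of
    the smooth tensor. *)
Lemma derive_warped_radial i r y (V : 'rV[K]_(1 + n)) : 0 < r < R -> cdom (c := A) i y ->
  (V *m 'D_(row_mx 1%:M 0) (in_coord (C := C) g i) (cmap (c := C) i (r, y)) *m V^T) 0 0 =
  2 * f r * warp_slope r * qform (h r) i y (rsubmx V) +
  f r ^+ 2 * qform (dr_metric R h r) i y (rsubmx V).
Proof.
move=> rR iy; have [_ cK _ _] := atlasA; have [_ _ _ _ riemg] := wpgh.
have /andP[r0 rR'] := rR; have R0 := lt_trans r0 rR'.
have Ir : `]0, R[%classic r by rewrite /= in_itv.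
have iC : cdom (c := C) i (r, y) by split.
have dG := in_coord_differentiable riemg iC.
pose c s : 'rV[K]_(1 + n) := row_mx s%:M (cmap (c := A) i y).
have dc : is_deriv_in `]0, R[ c r (row_mx 1%:M 0).
  apply/is_deriv_in_mxP => k j; rewrite /c ord1; case: (split_ordP j) => l ->.
    rewrite row_mxEl mxE ord1 mulr1n (_ : (fun s => _) = id); first exact: is_deriv_in_id.
    by apply/funext => s; rewrite row_mxEl mxE mulr1n.
  rewrite row_mxEr mxE (_ : (fun s => _) = cst (cmap (c := A) i y 0 l)); first exact: is_deriv_in_cst.
  by apply/funext => s; rewrite row_mxEr.
have := is_deriv_in_mulmx (is_deriv_in_mulmx (is_deriv_in_cst `]0, R[ V r) (is_deriv_in_comp dG dc))
  (is_deriv_in_cst `]0, R[ V^T r).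
rewrite mul0mx add0r mulmx0 addr0 => /is_deriv_in_mxP/(_ 0 0) H1.
have H2 : is_deriv_in `]0, R[ (fun s => lsubmx V 0 0 * 1 * lsubmx V 0 0 +
   f s * f s * (rsubmx V *m h s i y *m (rsubmx V)^T) 0 0) r
   (0 + ((warp_slope r * f r + f r * warp_slope r) * (rsubmx V *m h r i y *m (rsubmx V)^T) 0 0 +
    f r * f r * (rsubmx V *m dr_metric R h r i y *m (rsubmx V)^T) 0 0)).
  apply: is_deriv_inD; first exact: is_deriv_in_cst.
  have df := is_deriv_in_warp rR.
  apply: is_deriv_inM; first exact: is_deriv_inM.
  have := is_deriv_in_mulmx (is_deriv_in_mulmx (is_deriv_in_cst `]0, R[ (rsubmx V) r) (is_deriv_in_metric rR iy))
    (is_deriv_in_cst `]0, R[ (rsubmx V)^T r).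
  by rewrite mul0mx add0r mulmx0 addr0 => /is_deriv_in_mxP/(_ 0 0).
have E : (fun s => (V *m in_coord (C := C) g i (c s) *m V^T) 0 0) = (fun s => lsubmx V 0 0 * 1 * lsubmx V 0 0 +
   f s * f s * (rsubmx V *m h s i y *m (rsubmx V)^T) 0 0).
  apply/funext => s; rewrite /in_coord /g /warped_metric /c/= row_mxKl row_mxKr cK//.
  rewrite (_ : (s%:M : 'M[K]_1) 0 0 = s); last by rewrite mxE mulr1n.
  by rewrite block_form -scalemxAr -scalemxAl [X in _ + X = _]mxE expr2.
have H1' : is_deriv_in `]0, R[ (fun s => (V *m in_coord (C := C) g i (c s) *m V^T) 0 0) r
   ((V *m 'D_(row_mx 1%:M 0) (in_coord (C := C) g i) (cmap (c := C) i (r, y)) *m V^T) 0 0) by exact: H1.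
rewrite E in H1'; rewrite (is_deriv_in_unique (proper_interval_oo R0) Ir H1' H2) /qform; ring.
Qed.

Lemma warped_geodesic_chart (I : set K) gam i t : geodesic C g I gam -> I t -> cdom (c := A) i (gam t).2 ->
  let V := velocity (C := C) i I gam t in
  [/\ 0 < (gam t).1 < R, is_deriv_in I (fst \o gam) t (lsubmx V 0 0),
      is_deriv_in I (cmap i \o (snd \o gam)) t (rsubmx V) &
      lsubmx V 0 0 ^+ 2 + (f (gam t).1) ^+ 2 * qform (h (gam t).1) i (gam t).2 (rsubmx V) = 1].
Proof.
move=> geoI It iy V; have [pI cI carI HI] := geoI.
have rR : 0 < (gam t).1 < R by have := carI t It; case: (gam t) => r y /cylinder_carrier[].
have ip : cdom (c := C) i (gam t) by split=> //=; rewrite in_itv.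
have [d1 _ _ q1] := HI t i It ip.
have [dl dr] := is_deriv_in_submx (derivable_in_is_deriv pI It d1).
split=> //.
- apply: is_deriv_in_near dl; first by rewrite /= row_mxKl mxE mulr1n.
  by near=> s => Is; split=> //=; rewrite row_mxKl mxE mulr1n.
- apply: is_deriv_in_near dr; first by rewrite /= row_mxKr.
  by near=> s => Is; split=> //=; rewrite row_mxKr.
- rewrite -q1 /qform /g /warped_metric block_form -scalemxAr -scalemxAl [X in _ = _ + X]mxE mulr1 expr2.
  by [].
Unshelve. all: by end_near. Qed.

(** By the block form of the metric the radial component of the momentum is the radial velocity, so
    the momentum equation in the direction of [r] gives its derivative. *)
Lemma warped_geodesic_radial (I : set K) gam i t : geodesic C g I gam -> I t -> cdom (c := A) i (gam t).2 ->
  is_deriv_in I (deriv_in I (fst \o gam)) t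
    (f (gam t).1 * warp_slope (gam t).1 *
       qform (h (gam t).1) i (gam t).2 (rsubmx (velocity (C := C) i I gam t)) +
     2^-1 * (f (gam t).1 ^+ 2 *
       qform (dr_metric R h (gam t).1) i (gam t).2 (rsubmx (velocity (C := C) i I gam t)))).
Proof.
move=> geoI It iy; have [pI cI carI HI] := geoI.
have [rR _ _ _] := warped_geodesic_chart geoI It iy.
have ip : cdom (c := C) i (gam t) by split=> //=; rewrite in_itv.
have [_ _ _ _ riemg] := wpgh.
have [P dP HP] := momentum_equation (cylinder_atlas atlasA R) riemg geoI It ip.
have gE : gam t = ((gam t).1, (gam t).2) by case: (gam t).
have D := derive_warped_radial (velocity (C := C) i I gam t) rR iy; rewrite -gE in D.
have E := etrans (HP (row_mx 1%:M 0)) (congr1 (fun x => 2^-1 * x) D).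
have lE (M : 'rV[K]_(1 + n)) : (M *m (row_mx 1%:M 0)^T) 0 0 = lsubmx M 0 0.
  by rewrite -{1}(hsubmxK M) tr_row_mx mul_row_col trmx0 mulmx0 addr0 trmx1 mulmx1.
rewrite lE in E.
have [dl _] := is_deriv_in_submx dP.
rewrite (_ : _ + _ = lsubmx P 0 0); last by rewrite E; field.
have vE s : (lsubmx (velocity (C := C) i I gam s *m g i (gam s)) 0 0 : K) = lsubmx (velocity (C := C) i I gam s) 0 0.
  rewrite /g /warped_metric -[X in X *m _]hsubmxK mul_row_block row_mxKl mulmx1 mulmx0 addr0.
  by [].
have ni := within_continuous_near cI It (near_cdom (cylinder_atlas atlasA R) ip).
apply: is_deriv_in_near dl.
  have [_ d1 _ _] := warped_geodesic_chart geoI It iy.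
  by rewrite vE (is_deriv_inE pI It d1).
apply: filterS ni => s H Is; split=> //; have [_ is_] := H Is.
have [_ d1 _ _] := warped_geodesic_chart geoI Is is_.
by rewrite vE (is_deriv_inE pI Is d1).
Qed.

(** The inequality of [uniformly_C1_bound] with its constant exposed, so that warped products can
    use the constant [0]. *)
Definition log_deriv_bound (c : K) : Prop := forall r i y v, 0 < r < R -> cdom i y ->
    - (2 * c) * qform (h r) i y v <= qform (dr_metric R h r) i y v <= 2 * c * qform (h r) i y v.

Local Notation p := radial_velocity.

Lemma warped_geodesic_cdom (I : set K) gam t : geodesic C g I gam -> I t ->
  0 < (gam t).1 < R /\ exists i, cdom (c := A) i (gam t).2.
Proof.
move=> [_ _ carI _] It; have := carI t It; case: (gam t) => r y /cylinder_carrier[rR [i _ iy]].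
by split=> //; exists i.
Qed.

Lemma qform_ge0 r i y v : 0 < r < R -> cdom (c := A) i y -> 0 <= qform (h r) i y v.
Proof.
move=> /andP[r0 rR] iy; have [_ riemh _ _ _] := wpgh.
have [|_ pos _ _] := riemh r; first by rewrite ltW.
have [->|v0] := eqVneq v 0; last exact/ltW/pos.
by rewrite /qform mul0mx mul0mx mxE.
Qed.

Lemma qform_eq0 r i y v : 0 < r < R -> cdom (c := A) i y -> qform (h r) i y v = 0 -> v = 0.
Proof.
move=> /andP[r0 rR] iy q0; have [_ riemh _ _ _] := wpgh.
have [|_ pos _ _] := riemh r; first by rewrite ltW.
by apply/eqP; apply: contraPT q0 => v0; apply/eqP; rewrite gt_eqF// pos.
Qed.

Lemma warp_gt0 r : 0 < r < R -> 0 < f r.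
Proof. by have [[_ f0] _ _ _ _] := wpgh; exact: f0. Qed.

Lemma geodesic_horizontal_form (I : set K) gam i t : geodesic C g I gam -> I t ->
  cdom (c := A) i (gam t).2 ->
  1 - p I gam t ^+ 2 = (f (gam t).1) ^+ 2 *
    qform (h (gam t).1) i (gam t).2 (rsubmx (velocity (C := C) i I gam t)).
Proof.
move=> geoI It iy; have [pI _ _ _] := geoI.
have [rR dr _ E] := warped_geodesic_chart geoI It iy.
by rewrite /radial_velocity (is_deriv_inE pI It dr) -E addrAC subrr add0r.
Qed.

Lemma radial_motion (I : set K) gam t : geodesic C g I gam -> I t ->
  [/\ is_deriv_in I (fst \o gam) t (p I gam t),
      is_deriv_in I (p I gam) t (deriv_in I (p I gam) t),
      0 <= 1 - p I gam t ^+ 2 &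
      forall c, log_deriv_bound c ->
       `|deriv_in I (p I gam) t - warp_slope (gam t).1 / f (gam t).1 * (1 - p I gam t ^+ 2)|
         <= c * (1 - p I gam t ^+ 2)].
Proof.
move=> geoI It; have [pI _ _ _] := geoI.
have [rR [i iy]] := warped_geodesic_cdom geoI It.
have [_ dr _ _] := warped_geodesic_chart geoI It iy.
have dp := warped_geodesic_radial geoI It iy.
have f0 := warp_gt0 rR.
have EQ := geodesic_horizontal_form geoI It iy.
set q := qform (h _) _ _ _ in EQ.
have q0 : 0 <= q by exact: qform_ge0.
split.
- by rewrite /radial_velocity (is_deriv_inE pI It dr).
- by rewrite {2}/radial_velocity (is_deriv_inE pI It dp).
- by rewrite EQ mulr_ge0// sqr_ge0.
move=> c Hc; rewrite EQ {1}/radial_velocity (is_deriv_inE pI It dp) -/q.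
have /andP[] := Hc _ i (gam t).2 (rsubmx (velocity (C := C) i I gam t)) rR iy.
rewrite -/q; set d := qform (dr_metric _ _ _) _ _ _ => c1 c2.
have -> : f (gam t).1 * warp_slope (gam t).1 * q + 2^-1 * (f (gam t).1 ^+ 2 * d) -
    warp_slope (gam t).1 / f (gam t).1 * (f (gam t).1 ^+ 2 * q) = f (gam t).1 ^+ 2 * (2^-1 * d).
  by field; rewrite gt_eqF.
rewrite normrM (ger0_norm (sqr_ge0 _)) (mulrCA c) ler_wpM2l ?sqr_ge0//.
by rewrite ler_norml; apply/andP; split; lra.
Qed.

Lemma winding_horizontal (I : set K) gam : geodesic C g I gam ->
  winding A I gam <-> forall t, I t -> 0 < 1 - p I gam t ^+ 2.
Proof.
move=> geoI; have [pI _ _ _] := geoI; split=> [H t It|H t i It iy].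
  have [rR [i iy]] := warped_geodesic_cdom geoI It.
  have [v dv v0] := H t i It iy.
  have [_ _ dw _] := warped_geodesic_chart geoI It iy.
  rewrite (geodesic_horizontal_form geoI It iy) mulr_gt0 ?exprn_gt0 ?warp_gt0//.
  rewrite lt0r qform_ge0// andbT; apply/eqP => /(qform_eq0 rR iy) w0.
  by move: v0; rewrite (is_deriv_in_unique pI It dv dw) w0 eqxx.
have [rR _ dw _] := warped_geodesic_chart geoI It iy; exists (rsubmx (velocity (C := C) i I gam t)) => //.
have := H t It; rewrite (geodesic_horizontal_form geoI It iy); apply: contraTneq => ->.
by rewrite /qform mul0mx mul0mx mxE mulr0 ltxx.
Qed.

Lemma stationary_horizontal (I : set K) gam i t : geodesic C g I gam -> I t ->
  cdom (c := A) i (gam t).2 -> 1 - p I gam t ^+ 2 = 0 ->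
  is_deriv_in I (cmap i \o (snd \o gam)) t 0.
Proof.
move=> geoI It iy; have [rR _ dw _] := warped_geodesic_chart geoI It iy.
rewrite (geodesic_horizontal_form geoI It iy) => /eqP; rewrite mulf_eq0 expf_eq0 /=.
by rewrite gt_eqF ?warp_gt0//= => /eqP/(qform_eq0 rR iy) <-.
Qed.

End WarpedGeodesic.

(** * Radial and winding geodesics *)

Section Dichotomy.
Context {K : realType}.

Lemma is_deriv_in_comp_is_derive (I : set K) (F u : K -> K) t v w :
  is_derive (u t) 1 F w -> is_deriv_in I u t v -> is_deriv_in I (F \o u) t (v * w).
Proof.
move=> dF du; have dF' : differentiable F (u t) by apply/derivable1_diffP; exact: ex_derive.
by have := is_deriv_in_comp dF' du; rewrite deriveE// diff1E// derive1E derive_val.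
Qed.

Lemma is_deriv_in_exp (I : set K) k t : is_deriv_in I (fun s => expR (k * s)) t (k * expR (k * t)).
Proof.
have dk : is_deriv_in I (fun s : K => k * s) t k.
  by have := is_deriv_inZ (k := k) (is_deriv_in_id I t); rewrite [k *: 1]mulr1.
exact: is_deriv_in_comp_is_derive dk.
Qed.

(* Gronwall: [Q exp(-m t)] and [Q exp(m t)] are monotone where [m] bounds [M]. *)
Lemma gronwall_zero (I : set K) (Q Q' M : K -> K) t0 : is_interval I -> I t0 ->
  (forall t, I t -> is_deriv_in I Q t (Q' t)) -> (forall t, I t -> 0 <= Q t) ->
  (forall t, I t -> `|Q' t| <= M t * Q t) -> {within I, continuous M} ->
  Q t0 = 0 -> forall t, I t -> Q t = 0.
Proof.
move=> iI It0 dQ Q0 Q'M cM Qt0 t It.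
(* The number [m] is the maximum of [M] on [[a, b]]. With [k = - m] the product is nonincreasing,
   which serves times after [t0]; with [k = m] it is nondecreasing, which serves times before. *)
have main a b : I a -> I b -> a <= b -> exists m, forall k, k = m \/ k = - m ->
   forall s, a <= s <= b -> is_deriv_in `[a, b] (fun s => Q s * expR (k * s)) s ((Q' s + k * Q s) * expR (k * s)) /\
    (k = m -> 0 <= (Q' s + k * Q s) * expR (k * s)) /\ (k = - m -> (Q' s + k * Q s) * expR (k * s) <= 0).
  move=> Ia Ib ab.
  have sub : `[a, b]%classic `<=` I by move=> s; rewrite /= in_itv/=; exact: iI.
  have [z zab Hz] := @EVT_max K M a b ab (continuous_subspaceW sub cM).
  exists (M z) => k Hk s sab; have Is : I s by apply: sub; rewrite /= in_itv.
  split; last first.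
    have h1 : `|Q' s| <= M z * Q s.
      by apply: le_trans (Q'M s Is) _; rewrite ler_wpM2r ?Q0// Hz// in_itv.
    move: h1; rewrite ler_norml => /andP[h1 h2]; have e0 := expR_ge0 (k * s).
    split=> kE.
      by rewrite mulr_ge0// kE; lra.
    by rewrite mulr_le0_ge0// kE; lra.
  have := is_deriv_inM (is_deriv_inS sub (dQ s Is)) (@is_deriv_in_exp `[a, b] k s).
  by rewrite mulrDl mulrA [Q s * k]mulrC.
apply: le_anti; rewrite Q0// andbT.
have iS a b : is_interval (`[a, b]%classic : set K) by exact: interval_is_interval.
have [tt0|/ltW tt0] := leP t0 t.
  have [m Hm] := main t0 t It0 It tt0.
  have : - (Q t0 * expR (- m * t0)) <= - (Q t * expR (- m * t)).
    apply: (@le_MVT_in K `[t0, t] (fun s => - (Q s * expR (- m * s)))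
     (fun s => - ((Q' s + - m * Q s) * expR (- m * s))) _ _ (iS _ _)) => //.
    - by move=> s; rewrite /= in_itv/= => hs; apply: is_deriv_inN; exact: (Hm _ (or_intror erefl) s hs).1.
    - by rewrite /= in_itv/= lexx.
    - by rewrite /= in_itv/= lexx andbT.
    - by move=> s hs; rewrite oppr_ge0; exact: (Hm _ (or_intror erefl) s hs).2.2.
  by rewrite Qt0 mul0r oppr0 oppr_ge0 pmulr_lle0 ?expR_gt0.
have [m Hm] := main t t0 It It0 tt0.
have : Q t * expR (m * t) <= Q t0 * expR (m * t0).
  apply: (@le_MVT_in K `[t, t0] (fun s => Q s * expR (m * s))
   (fun s => (Q' s + m * Q s) * expR (m * s)) _ _ (iS _ _)) => //.
  - by move=> s; rewrite /= in_itv/= => hs; exact: (Hm _ (or_introl erefl) s hs).1.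
  - by rewrite /= in_itv/= lexx.
  - by rewrite /= in_itv/= lexx andbT.
  - by move=> s hs; exact: (Hm _ (or_introl erefl) s hs).2.1.
by rewrite Qt0 mul0r pmulr_lle0 ?expR_gt0.
Qed.

End Dichotomy.

Section DichotomyWarped.
Context {K : realType} {n : nat} {Y : topologicalType} (A : charts K n Y).
Variables (R : K) (f : K -> K) (h : K -> tensor A).
Hypotheses (atlasA : smooth_atlas A) (wpgh : generalized_warped_product R f h).

Let g := warped_metric f h.
Let C := cylinder A R.
Local Notation p := radial_velocity.

Lemma log_slope_within_continuous (I : set K) gam : geodesic C g I gam ->
  {within I, continuous (fun t => warp_slope R f (gam t).1 / f (gam t).1)}.
Proof.
move=> geoI; apply/subspace_continuousP => t It.
have [rR _] := warped_geodesic_cdom geoI It; have /andP[r0 r1] := rR.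
have [dr _ _ _] := radial_motion atlasA wpgh geoI It.
have rc : (gam s).1 @[s --> within I (nbhs t)] --> (gam t).1 := is_deriv_in_cvg dr.
have [[[df cf] f0] _ _ _ _] := wpgh.
have Ir : `]0, R[%classic (gam t).1 by rewrite /= in_itv.
have nI : \forall x \near (gam t).1, `]0, R[%classic x.
  by apply: open_nbhs_nbhs; split=> //; exact: itv_open.
have c1 : warp_slope R f x @[x --> (gam t).1] --> warp_slope R f (gam t).1.
  move=> P nP; have := within_continuous_near cf Ir nP.
  by apply: filterS2 nI => x h1 h2; exact: h2.
have c2 : f x @[x --> (gam t).1] --> f (gam t).1.
  have cf' := is_deriv_in_cvg (is_deriv_in_warp wpgh rR).
  by move=> P nP; have := cvg_within_near cf' nP; apply: filterS2 nI => x h1 h2; exact: h2.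
apply: (cvg_comp _ (fun x => warp_slope R f x / f x) rc).
by apply: cvgM => //; apply: cvgV => //; rewrite gt_eqF// f0.
Qed.

Lemma horizontal_dichotomy (I : set K) gam t0 : geodesic C g I gam -> I t0 ->
  1 - p I gam t0 ^+ 2 = 0 -> forall t, I t -> 1 - p I gam t ^+ 2 = 0.
Proof.
move=> geoI It0 Qt0; have [pI _ _ _] := geoI; have [iI _] := pI.
have [_ _ _ [c c0 Hc] _] := wpgh.
apply: (@gronwall_zero _ I (fun t => 1 - p I gam t ^+ 2) (fun t => 0 - (deriv_in I (p I gam) t * p I gam t +
    p I gam t * deriv_in I (p I gam) t))
  (fun t => 2 * (`|warp_slope R f (gam t).1 / f (gam t).1| + c)) t0) => //.
- move=> t It; have [_ dp _ _] := radial_motion atlasA wpgh geoI It.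
  by apply: is_deriv_inB; [exact: is_deriv_in_cst|exact: is_deriv_inM].
- by move=> t It; have [_ _ ? _] := radial_motion atlasA wpgh geoI It.
- move=> t It; have [_ _ Q0 /(_ c Hc)] := radial_motion atlasA wpgh geoI It.
  set P := deriv_in I (p I gam) t; set u := p I gam t; set s := _ / _; set Q := 1 - _.
  move=> H1.
  have u1 : `|u| <= 1.
    by rewrite -(@ler_pXn2r _ 2)// ?nnegrE// expr1n real_normK ?num_real// -subr_ge0.
  have P1 : `|P| <= (`|s| + c) * Q.
    rewrite -(subrK (s * Q) P) mulrDl addrC; apply: le_trans (ler_normD _ _) _.
    by rewrite lerD// normrM (ger0_norm Q0).
  rewrite sub0r normrN; apply: le_trans (ler_normD _ _) _; rewrite (normrM P) (normrM u).
  have : `|P| * `|u| <= `|P| by rewrite ler_piMr.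
  rewrite (mulrC `|u|); lra.
- have cs := log_slope_within_continuous geoI.
  apply/subspace_continuousP => t It; move/subspace_continuousP : cs => /(_ t It) cst.
  apply: cvgM; first exact: cvg_cst.
  by apply: cvgD; [exact: cvg_norm cst|exact: cvg_cst].
Qed.

(** The indicator function of the times at which [y] takes the value [y t] is locally constant,
    hence has derivative zero; the mean value theorem plays the part of connectedness. *)
Lemma locally_constant_on (I : set K) {T : Type} (y : K -> T) : is_interval I ->
  (forall t, I t -> \forall s \near t, I s -> y s = y t) ->
  forall s t, I s -> I t -> y s = y t.
Proof.
move=> iI H s t Is It.
pose u (z : K) : K := if pselect (y z = y t) is left _ then 1 else 0.
have : u s = u t.
  apply: (cst_MVT_in iI) => // z Iz.
  apply: (is_deriv_in_near (u := cst (u z))); [by []| |exact: is_deriv_in_cst].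
  by apply: filterS (H z Iz) => x /[apply] E; split=> //; rewrite /u E.
rewrite /u; case: pselect => // _; case: pselect => // _ /eqP.
by rewrite eq_sym oner_eq0.
Qed.

Lemma stationary_constant (I : set K) (y : K -> Y) : is_interval I -> {within I, continuous y} ->
  (forall t, I t -> carrier A (y t)) ->
  (forall t i, I t -> cdom (c := A) i (y t) -> is_deriv_in I (cmap i \o y) t 0) ->
  forall s t, I s -> I t -> y s = y t.
Proof.
move=> iI cy cA H; apply: locally_constant_on => // t It; have [i _ iy] := cA t It.
have [_ cK _ _] := atlasA.
have := within_continuous_near cy It (near_cdom atlasA iy).
move=> /nbhs_ballP[e /= e0 He].
(* On [J] the curve stays in one chart, where vanishing coordinate velocities make the coordinates
   constant. *)
pose J := I `&` `]t - e, t + e[%classic.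
have iJ : is_interval J.
  move=> a b [Ia Ja] [Ib Jb] z zab; split; first exact: (iI a b).
  move: Ja Jb zab; rewrite /= !in_itv/= => /andP[a1 a2] /andP[b1 b2] /andP[z1 z2].
  by rewrite (lt_le_trans a1)// (le_lt_trans z2).
have inJ z : J z -> I z /\ cdom (c := A) i (y z).
  move=> [Iz]; rewrite /= in_itv/= => /andP[z1 z2]; split=> //; apply: He => //.
  by rewrite -ball_normE/= ltr_norml; apply/andP; split; lra.
have Jt : J t by split=> //; rewrite /= in_itv/=; apply/andP; split; lra.
apply/nbhs_ballP; exists e => // s; rewrite -ball_normE/= ltr_norml => /andP[s1 s2] Is.
have Js : J s by split=> //; rewrite /= in_itv/=; apply/andP; split; lra.
have [_ is_] := inJ s Js.
rewrite -(cK _ _ is_) -(cK _ _ iy); congr cinv; apply/rowP => k.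
apply: (cst_MVT_in (u := fun s => cmap i (y s) 0 k) iJ) => // z Jz.
have [Iz iz] := inJ z Jz.
have /is_deriv_in_mxP/(_ 0 k) := H z i Iz iz; rewrite mxE.
by apply: is_deriv_inS => x [].
Qed.

Lemma radial_or_winding (I : set K) gam : geodesic C g I gam -> radial I gam \/ winding A I gam.
Proof.
move=> geoI; have [pI cI carI _] := geoI; have [iI [a [_ [Ia _ _]]]] := pI.
have [H|H] := pselect (forall t, I t -> 0 < 1 - p I gam t ^+ 2).
  by right; exact: (winding_horizontal wpgh geoI).2.
left; have Q0 : forall t, I t -> 1 - p I gam t ^+ 2 = 0.
  have [t0 [It0 Qt0]] : exists t, I t /\ ~ 0 < 1 - p I gam t ^+ 2.
    by apply: contra_notP H => H t It; apply: contra_notP H => H; exists t.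
  apply: (horizontal_dichotomy geoI It0).
  have [_ _ Q0 _] := radial_motion atlasA wpgh geoI It0.
  by apply/le_anti; rewrite Q0 andbT leNgt; apply/negP.
have [_ _ _ [c c0 Hc] _] := wpgh.
(* With [Q = 0] the inequality of [radial_motion] forces the radial acceleration to vanish, so [p]
   keeps one of the values [1] and [-1]. *)
have dp t : I t -> is_deriv_in I (p I gam) t 0.
  move=> It; have [_ + _ /(_ c Hc)] := radial_motion atlasA wpgh geoI It.
  by rewrite Q0// !mulr0 subr0 normr_le0 => + /eqP E; rewrite E.
have pc t : I t -> p I gam t = p I gam a by move=> It; exact: (cst_MVT_in iI dp).
split.
  apply: (stationary_constant iI) => //.
  - apply/subspace_continuousP => t It; move/subspace_continuousP : cI => /(_ t It) cgt.
    exact: (cvg_comp _ _ cgt (@cvg_snd _ _ (nbhs (gam t).1) (nbhs (gam t).2) _)).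
  - by move=> t It; have [_ [i iy]] := warped_geodesic_cdom geoI It; exists i.
  - by move=> t i It iy; exact: (stationary_horizontal wpgh geoI It iy (Q0 t It)).
have : (p I gam a - 1) * (p I gam a + 1) = 0 by have := Q0 a Ia; rewrite expr2 => e; lra.
move=> /eqP; rewrite mulf_eq0 => /orP[]; rewrite ?subr_eq0 ?addr_eq0 => /eqP pE; [left|right] => t It;
  by rewrite -pE -(pc t It); have [] := radial_motion atlasA wpgh geoI It.
Qed.

End DichotomyWarped.

(** * Winding geodesics for small radius *)

Section RadialAnalysis.
Context {K : realType}.

(** Convexity between [0] and [r] gives [F x <= (x / r) * F r], so the difference quotients of [F]
    at [r] from the left are at least [F r / r]. *)
Lemma convex_slope (R : K) (F : K -> K) r v : F 0 = 0 ->
  convex_function (`[0, R[%classic : set K^o) F -> 0 < r < R ->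
  is_deriv_in `]0, R[ F r v -> F r / r <= v.
Proof.
move=> F0 cF /andP[r0 rR] /is_deriv_inP dF; apply/ler_addgt0Pr => e e0.
have cvx s : 0 < s < 1 -> F (s * r) <= s * F r.
  move=> /andP[s0 s1].
  have := cF (Itv01 (ltW s0) (ltW s1)) r 0.
  rewrite /= !inE/= !in_itv/= lexx (ltW r0) rR (lt_trans r0 rR) => /(_ isT isT).
  have -> : conv (Itv01 (ltW s0) (ltW s1)) (r : convex_lmodType K^o) 0 = s * r.
    by transitivity (s * r + (1 - s) * 0); [by []|ring].
  by rewrite convRE/= F0 mulr0 addr0.
near r^'- => x.
have xr : x < r by near: x; exact: nbhs_left_lt.
have x0 : 0 < x by near: x; exact: nbhs_left_gt.
have H : `]0, R[%classic x -> `|F x - F r - (x - r) *: v| <= e * `|x - r|.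
  near: x; rewrite /at_left near_withinE; have := dF e e0.
  by apply: filterS => z h _.
have {}H := H ltac:(by rewrite /= in_itv/= x0 (lt_trans xr)).
have := cvx (x / r); rewrite divr_gt0//= ltr_pdivrMr// mul1r xr divfK ?gt_eqF// => /(_ isT) Hx.
move: H; rewrite (_ : (x - r) *: v = (x - r) * v)// (ltr0_norm (x := x - r)) ?subr_lt0// ler_norml => /andP[H _].
rewrite -mulrA (mulrC _ (F r)) in Hx; set q := F r / r in Hx *.
have Fr : F r = r * q by rewrite /q mulrCA mulfV ?mulr1// gt_eqF.
have : (r - x) * q <= (r - x) * (v + e) by rewrite Fr in H; lra.
by rewrite ler_pM2l// subr_gt0.
Unshelve. all: by end_near. Qed.

Variables (I : set K) (r p a : K -> K) (R : K).
Hypotheses (iI : is_interval I)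
  (dr : forall t, I t -> is_deriv_in I r t (p t))
  (dp : forall t, I t -> is_deriv_in I p t (a t))
  (r0 : forall t, I t -> 0 < r t < R)
  (Q0 : forall t, I t -> 0 < 1 - p t ^+ 2)
  (aQ : forall t, I t -> ((2 * r t)^-1 + 1) * (1 - p t ^+ 2) <= a t).

(** The summand [1] of [aQ] taken alone; it makes [p] increase and bounds the length of the
    domain. *)
Lemma horizontal_le_accel t : I t -> 1 - p t ^+ 2 <= a t.
Proof.
move=> It; apply: le_trans (aQ It); rewrite mulrDl mul1r lerDr mulr_ge0//; last exact/ltW/Q0.
by rewrite invr_ge0 mulr_ge0// ltW//; have /andP[] := r0 It.
Qed.

(** The summand [(2 * r t)^-1] of [aQ] taken alone; it is the amount that makes [(1 - p ^+ 2) * r]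
    nondecreasing while [p <= 0]. *)
Lemma horizontal_le_accel_radius t : I t -> 1 - p t ^+ 2 <= 2 * r t * a t.
Proof.
move=> It; have /andP[rt0 _] := r0 It; have Qt := Q0 It.
apply: (@le_trans _ _ (2 * r t * (((2 * r t)^-1 + 1) * (1 - p t ^+ 2)))); last first.
  by rewrite ler_wpM2l ?aQ// mulr_ge0// ltW.
set q := 1 - _ in Qt *; have -> : 2 * r t * (((2 * r t)^-1 + 1) * q) = q + 2 * r t * q.
  by field; rewrite gt_eqF.
by rewrite lerDl !mulr_ge0// ltW.
Qed.

Lemma radial_velocity_increasing s t : I s -> I t -> s < t -> p s < p t.
Proof.
apply: (lt_MVT_in iI dp) => z Iz.
exact: lt_le_trans (Q0 Iz) (horizontal_le_accel Iz).
Qed.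

(** The mean slopes of [r] on the two sides of the intermediate point are values of the increasing
    function [p]. *)
Lemma radial_strictly_convex : strictly_convex_on I r.
Proof.
move=> s t k Is It st k0 k1; set m := k * s + (1 - k) * t.
have ms : m - s = (1 - k) * (t - s) by rewrite /m; ring.
have tm : t - m = k * (t - s) by rewrite /m; ring.
have sm : s < m by rewrite -subr_gt0 ms mulr_gt0// subr_gt0.
have mt : m < t by rewrite -subr_gt0 tm mulr_gt0// subr_gt0.
have Im : I m by apply: (iI Is It); rewrite !ltW.
have [c1 /andP[sc1 c1m] e1] := MVT_in iI dr Is Im sm.
have [c2 /andP[mc2 c2t] e2] := MVT_in iI dr Im It mt.
have Ic1 : I c1 by apply: (iI Is Im); rewrite !ltW.
have Ic2 : I c2 by apply: (iI Im It); rewrite !ltW.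
have p12 : p c1 < p c2 by apply: radial_velocity_increasing => //; exact: lt_trans mc2.
rewrite -subr_gt0 (_ : _ - _ = k * (1 - k) * (t - s) * (p c2 - p c1)).
  by rewrite !mulr_gt0// subr_gt0.
have -> : k * r s + (1 - k) * r t - r m = (1 - k) * (r t - r m) - k * (r m - r s) by ring.
rewrite e1 e2 ms tm; ring.
Qed.

Lemma ge_MVT_in (u u' : K -> K) k : (forall t, I t -> is_deriv_in I u t (u' t)) ->
  forall t1, I t1 -> (forall t, I t -> t1 <= t -> k <= u' t) ->
  forall t, I t -> t1 <= t -> u t1 + k * (t - t1) <= u t.
Proof.
move=> du t1 It1 Hu t It t1t.
have : u t1 - k * t1 <= u t - k * t.
  apply: (@le_MVT_in K I (fun s => u s - k * s) (fun s => u' s - k)) => //.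
  - move=> s Is; apply: is_deriv_inB; first exact: du.
    by have := is_deriv_inZ (k := k) (is_deriv_in_id I s); rewrite [k *: 1]mulr1.
  - by move=> s /andP[ts st]; rewrite subr_ge0 Hu//; apply: (iI It1 It); rewrite ts.
lra.
Qed.

Lemma radial_velocity_bound t : I t -> -1 < p t < 1.
Proof.
by move=> It; rewrite -ltr_norml -(@ltr_pXn2r _ 2)// ?nnegrE// expr1n real_normK ?num_real// -subr_gt0 Q0.
Qed.

(** If [p] is positive at [t1], then [r] grows afterwards at least with slope [p t1] and has to stay
    below [R]. Otherwise [p <= 0] throughout, so [1 - p ^+ 2] does not decrease, [p] grows at least
    with slope [1 - p t0 ^+ 2], and it has less than [1] to climb from above [-1] to [0]. *)
Lemma radial_interval_bounded t0 : I t0 -> exists b, forall t, I t -> t <= b.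
Proof.
move=> It0; have [[t1 [It1 p1]]|H] := pselect (exists t, I t /\ 0 < p t).
  exists (t1 + R / p t1) => t It; have [|/ltW t1t] := leP t t1.
    move=> /le_trans; apply; rewrite lerDl divr_ge0 ?ltW//.
    by have /andP[h1 h2] := r0 It1; exact: lt_trans h1 h2.
  rewrite -lerBlDl ler_pdivlMr// mulrC.
  have := ge_MVT_in dr It1 (k := p t1) _ It t1t.
  have /andP[h1 h2] := r0 It1; have /andP[h3 h4] := r0 It.
  have Hp s : I s -> t1 <= s -> p t1 <= p s.
    by rewrite le_eqVlt => Is /predU1P[->//|ts]; exact/ltW/radial_velocity_increasing.
  move=> /(_ Hp); lra.
have pn t : I t -> p t <= 0 by move=> It; rewrite leNgt; apply/negP => pt; apply: H; exists t.
have q0 := Q0 It0; exists (t0 + (1 - p t0 ^+ 2)^-1) => t It; have [|/ltW t0t] := leP t t0.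
  by move=> /le_trans; apply; rewrite lerDl invr_ge0 ltW.
rewrite -lerBlDl -[leRHS]mul1r ler_pdivlMr// mulrC.
have Hp s : I s -> t0 <= s -> 1 - p t0 ^+ 2 <= a s.
  move=> Is t0s; apply: le_trans (horizontal_le_accel Is); rewrite lerD2l lerN2.
  have : p t0 <= p s by move: t0s; rewrite le_eqVlt => /predU1P[->//|ts]; exact/ltW/radial_velocity_increasing.
  have := pn _ Is; have := pn _ It0 => h1 h2 h3; rewrite -(sqrrN (p s)) -(sqrrN (p t0)).
  by rewrite ler_pXn2r ?nnegrE ?oppr_ge0// lerN2.
have := ge_MVT_in dp It0 Hp It t0t; have /andP[h1 h2] := radial_velocity_bound It0.
have := pn _ It; lra.
Qed.

(* While [p <= 0], the function [(1 - p ^+ 2) * r] is nondecreasing and at most [r], so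
   [r] stays away from [0]. *)
Lemma radial_right_alternative t0 b : I t0 -> (forall t, I t -> t < b) ->
  (forall t, t0 <= t < b -> I t) ->
  r t @[t --> b^'-] --> R \/
  exists t1 a0 b0, [/\ t0 <= t1 < b, 0 < a0, b0 < R & forall t, t1 <= t < b -> a0 <= r t <= b0].
Proof.
move=> It0 Ib sub; have t0b := Ib _ It0.
have [[t1 [t01 p1]]|H] := pselect (exists t, t0 <= t < b /\ 0 < p t).
  have It1 := sub _ t01; have /andP[t0t1 t1b] := t01.
  have It t : t1 <= t < b -> I t by move=> /andP[h1 h2]; apply: sub; rewrite h2 (le_trans t0t1).
  have rmono s t : t1 <= s -> s <= t -> t < b -> r s <= r t.
    move=> ts st tb; apply: (le_MVT_in iI dr) => //.
    - by apply: It; rewrite ts (le_lt_trans st).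
    - by apply: It; rewrite tb (le_trans ts).
    move=> z /andP[sz zt]; apply: le_trans (ltW p1) _.
    have := le_trans ts sz; rewrite le_eqVlt => /predU1P[->//|tz].
    by apply/ltW/radial_velocity_increasing => //; apply: It; rewrite (ltW tz) (le_lt_trans zt).
  have [[b0 [b0R Hb]]|nb] := pselect (exists b0, b0 < R /\ forall t, t1 <= t < b -> r t <= b0).
    right; exists t1, (r t1), b0; split=> //; first by have /andP[] := r0 It1.
    by move=> t /andP[h1 h2]; rewrite rmono//= Hb// h1.
  left; apply/cvgrPdist_le => e e0.
  have [t2 [t12 rt2]] : exists t, t1 <= t < b /\ R - e < r t.
    apply: contra_notP nb => nt; exists (R - e); rewrite ltrBlDr ltrDl e0; split=> // t tt.
    by rewrite leNgt; apply/negP => h; apply: nt; exists t.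
  have /andP[t1t2 t2b] := t12.
  near=> s.
  have s2 : t2 < s by near: s; exact: nbhs_left_gt.
  have sb : s < b by near: s; exact: nbhs_left_lt.
  have h1 : t1 <= s < b by rewrite sb (le_trans t1t2 (ltW s2)).
  have /andP[_ sR] := r0 (It _ h1).
  rewrite ger0_norm; last by rewrite subr_ge0 ltW.
  by have := rmono _ _ t1t2 (ltW s2) sb; lra.
(* Here [p <= 0], so [r] stays below its initial value; the lower bound is the initial value of
   [(1 - p ^+ 2) * r]. *)
right; exists t0, ((1 - p t0 ^+ 2) * r t0), (r t0).
have pn t : t0 <= t < b -> p t <= 0 by move=> It; rewrite leNgt; apply/negP => pt; apply: H; exists t.
have /andP[r00 r0R] := r0 It0.
split=> //; [by rewrite lexx|by rewrite mulr_gt0// Q0|].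
move=> t tt; have /andP[t0t tb] := tt; have It := sub _ tt; have /andP[rt0 rtR] := r0 It.
have pz z : t0 <= z <= t -> p z <= 0.
  by move=> /andP[z1 z2]; apply: pn; rewrite z1 (le_lt_trans z2).
apply/andP; split; last first.
  rewrite -lerN2; apply: (@le_MVT_in K I (fun s => - r s) (fun s => - p s)) => //.
  - by move=> z Iz; apply: is_deriv_inN; exact: dr.
  - by move=> z /pz; rewrite oppr_ge0.
apply: (@le_trans _ _ ((1 - p t ^+ 2) * r t)); last first.
  by rewrite ler_piMl ?(ltW rt0)// lerBlDl lerDr sqr_ge0.
apply: (@le_MVT_in K I (fun s => (1 - p s ^+ 2) * r s)
   (fun s => (0 - (a s * p s + p s * a s)) * r s + (1 - p s ^+ 2) * p s)) => //.
- move=> z Iz; apply: is_deriv_inM; last exact: dr.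
  by apply: is_deriv_inB; [exact: is_deriv_in_cst|apply: is_deriv_inM; exact: dp].
- move=> z tz; have := horizontal_le_accel_radius (iI It0 It tz).
  set q := 1 - _ => qz; rewrite (_ : _ + _ = - p z * (2 * r z * a z - q)); last by ring.
  by rewrite mulr_ge0// ?oppr_ge0 ?pz// subr_ge0.
Unshelve. all: by end_near. Qed.

End RadialAnalysis.

(** * Time reversal *)

Section Reversal.
Context {K : realType} {n : nat} {T : topologicalType} (C : charts K n T).
Variable g : tensor C.
Hypothesis atlasC : smooth_atlas C.
Implicit Types (I : set K) (gam : K -> T).

Lemma opp_preimageK (I : set K) : -%R @^-1` (-%R @^-1` I) = I.
Proof. by apply/funext => t; rewrite /preimage/= opprK. Qed.

Lemma proper_interval_reverse (I : set K) : proper_interval I -> proper_interval (-%R @^-1` I).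
Proof.
move=> [iI [s [t [Is It st]]]]; split; last by exists (- t), (- s); rewrite /= !opprK ltrN2.
move=> a b Ia Ib z /andP[az zb]; apply: (iI _ _ Ib Ia).
by rewrite !lerN2 zb.
Qed.

(** The velocity changes sign and the acceleration does not; the Christoffel term and the unit speed
    condition are quadratic in the velocity. *)
Lemma geodesic_reverse I gam : geodesic C g I gam -> geodesic C g (-%R @^-1` I) (gam \o -%R).
Proof.
move=> [pI cI carI HI]; have pI' := proper_interval_reverse pI.
have cgt t P : I t -> nbhs (gam t) P -> \forall s \near - t, I (- s) -> P (gam (- s)).
  by move=> It nP; exact: near_opp (within_continuous_near cI It nP).
split=> //.
- apply/subspace_continuousP => t It; apply: within_near_cvg => P nP.
  by have := cgt _ _ It nP; rewrite opprK.
- by move=> t It; exact: carI.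
move=> t i It ip; have [d1 d2 e q] := HI _ i It ip.
have dx s : I (- s) -> cdom i (gam (- s)) ->
    is_deriv_in (-%R @^-1` I) (cmap i \o (gam \o -%R)) s (- velocity i I gam (- s)).
  move=> Is is_; have [d _ _ _] := HI _ i Is is_.
  by have := is_deriv_in_reverse (derivable_in_is_deriv pI Is d); rewrite opprK.
have vE s : I (- s) -> cdom i (gam (- s)) ->
    velocity i (-%R @^-1` I) (gam \o -%R) s = - velocity i I gam (- s).
  by move=> Is is_; exact: is_deriv_inE (dx s Is is_).
have dv : is_deriv_in (-%R @^-1` I) (velocity i (-%R @^-1` I) (gam \o -%R)) t (acceleration i I gam (- t)).
  have := is_deriv_in_reverse (derivable_in_is_deriv pI It d2) => /is_deriv_inN; rewrite !opprK.
  apply: is_deriv_in_near; first by rewrite /= vE.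
  have := cgt _ _ It (near_cdom atlasC ip); rewrite opprK; apply: filterS => s H Is; split=> //=.
  by rewrite vE//; exact: H.
have oE (w : 'rV[K]_n) j : (- w) 0 j = - w 0 j by rewrite mxE.
split.
- by eexists; exact: dx.
- by eexists; exact: dv.
- move=> k; rewrite /acceleration (is_deriv_inE pI' It dv) vE// -[RHS](e k); congr (_ + _).
  apply: eq_bigr => a _; apply: eq_bigr => b _; rewrite !oE.
  by rewrite -mulrA mulrNN mulrA.
- by rewrite -q vE// /qform linearN/= mulmxN !mulNmx opprK.
Qed.

Lemma maximal_geodesic_reverse I gam : maximal_geodesic C g I gam ->
  maximal_geodesic C g (-%R @^-1` I) (gam \o -%R).
Proof.
move=> [geoI maxI]; split=> [|J del geoJ sub E]; first exact: geodesic_reverse.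
rewrite -[J]opp_preimageK; congr (_ @^-1` _).
apply: (maxI _ _ (geodesic_reverse geoJ)).
  by move=> t It; apply: sub; rewrite /= opprK.
by move=> t; rewrite inE => It; rewrite /= E ?inE/= opprK.
Qed.

End Reversal.

(** * Convexity, finite length and ends of winding geodesics *)

Section SmallRadius.
Context {K : realType} {n : nat} {Y : topologicalType} (A : charts K n Y).
Variables (R : K) (f : K -> K) (h : K -> tensor A).
Hypotheses (closedA : closed_manifold A) (wpgh : generalized_warped_product R f h)
  (cvxf : extends_convexly R f).
Variables (c R' : K).
Hypotheses (c0 : 0 <= c) (Hc : log_deriv_bound R h c) (RR : R' <= R)
  (cR : R' * (2 * c + 2) <= 1).
Let g := warped_metric f h.
Let C := cylinder A R'.
Local Notation p := radial_velocity.

Let atlasA : smooth_atlas A. Proof. by have [] := closedA. Qed.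

Lemma warp_slope_ge r : 0 < r < R -> r^-1 <= warp_slope R f r / f r.
Proof.
move=> rR; have f0 := warp_gt0 wpgh rR; have [F [Ff _ F0 cF]] := cvxf.
have dF : is_deriv_in `]0, R[ F r (warp_slope R f r).
  apply: is_deriv_in_near (is_deriv_in_warp wpgh rR); first by rewrite Ff.
  by near=> s => sR; split=> //; rewrite Ff//; move: sR; rewrite /= in_itv.
by rewrite ler_pdivlMr// mulrC -Ff//; exact: convex_slope F0 cF rR dF.
Unshelve. all: by end_near. Qed.

(** Convexity of [f] contributes [1 / r], and the variation of [h] costs [c]. For [r < R'] the
    condition on [R'] gives [c + 1 <= 1 / (2 r)], so half of [1 / r] pays for [c] and for the
    summand [1], and the other half remains. *)
Lemma radial_acceleration_bound (I : set K) gam t : geodesic C g I gam -> I t ->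
  0 < (gam t).1 < R' /\
  ((2 * (gam t).1)^-1 + 1) * (1 - p I gam t ^+ 2) <= deriv_in I (p I gam) t.
Proof.
move=> geoI It; have [rR' _] := warped_geodesic_cdom geoI It; split=> //.
have geoR := geodesic_widen RR geoI.
have [rR _] := warped_geodesic_cdom geoR It.
have [_ _ Q0 /(_ c Hc)] := radial_motion atlasA wpgh geoR It.
have := warp_slope_ge rR.
move: rR'; set r := (gam t).1; set s := _ / _; set Q := 1 - _; move=> /andP[r0 rR'] sr.
rewrite ler_norml => /andP[H _].
apply: (@le_trans _ _ ((s - c) * Q)); last by lra.
apply: ler_wpM2r => //.
have : c + 1 <= (2 * r)^-1.
  rewrite -[leRHS]mul1r ler_pdivlMr ?mulr_gt0//.
  apply: le_trans cR; rewrite -subr_ge0 (_ : _ - _ = 2 * (c + 1) * (R' - r)); last by ring.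
  by apply: mulr_ge0; [apply: mulr_ge0 => //; exact: addr_ge0|rewrite subr_ge0 ltW].
have : r^-1 = 2 * (2 * r)^-1 by field; rewrite gt_eqF.
lra.
Qed.

Section Winding.
Variables (I : set K) (gam : K -> K * Y).
Hypotheses (geoI : geodesic C g I gam) (windI : winding A I gam).

Let iI : is_interval I. Proof. by have [[]] := geoI. Qed.
Let dr t : I t -> is_deriv_in I (fst \o gam) t (p I gam t).
Proof. by move=> It; have [] := radial_motion atlasA wpgh (geodesic_widen RR geoI) It. Qed.
Let dp t : I t -> is_deriv_in I (p I gam) t (deriv_in I (p I gam) t).
Proof. by move=> It; have [] := radial_motion atlasA wpgh (geodesic_widen RR geoI) It. Qed.
Let rR t : I t -> 0 < (fst \o gam) t < R'.
Proof. by move=> It; have [] := radial_acceleration_bound geoI It. Qed.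
Let Q0 t : I t -> 0 < 1 - p I gam t ^+ 2.
Proof. exact: (winding_horizontal wpgh (geodesic_widen RR geoI)).1. Qed.
Let aQ t : I t -> ((2 * (fst \o gam) t)^-1 + 1) * (1 - p I gam t ^+ 2) <= deriv_in I (p I gam) t.
Proof. by move=> It; have [] := radial_acceleration_bound geoI It. Qed.

Lemma winding_strictly_convex : strictly_convex_on I (fst \o gam).
Proof. exact: (radial_strictly_convex iI dr dp rR Q0 aQ). Qed.

Lemma winding_right_end : maximal_geodesic C g I gam -> exists Tp,
  [/\ forall t, I t -> t < Tp, forall t0 t, I t0 -> t0 <= t < Tp -> I t &
    (fst \o gam) t @[t --> Tp^'-] --> R'].
Proof.
move=> maxI; have [pI _ _ _] := geoI; have [_ [t0 [_ [It0 _ _]]]] := pI.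
have [M HM] := radial_interval_bounded iI dr dp rR Q0 aQ It0.
have supI : has_sup I by split; [exists t0|exists M => t It; exact: HM].
pose b := sup I.
have Ib t : I t -> t <= b by exact: sup_upper_bound.
have sub t1 t : I t1 -> t1 <= t < b -> I t.
  move=> It1 /andP[t1t tb]; have bt : 0 < b - t by rewrite subr_gt0.
  have [s Is] := sup_adherent bt supI; rewrite -/b => ts.
  apply: (iI It1 Is); rewrite t1t/=; lra.
have [_ AY hY cY] := closedA; have [_ _ _ _ riemg] := wpgh.
have riemg' := riemannian_shrink RR riemg.
have hKY : hausdorff_space (K * Y)%type by apply: hausdorff_prod => //; exact: norm_hausdorff.
have rend := maximal_geodesic_right_end (cylinder_atlas atlasA R') riemg' hKY maxI Ib.
(* Applied to the empty compact set, the statement still gives that [b] does not belong to [I]. *)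
have [nIb _] := rend t0 set0 (fun t => sub t0 t It0) It0 compact0 (@sub0set _ _).
have Ib' t : I t -> t < b.
  by move=> It; rewrite lt_neqAle Ib// andbT; apply: contra_notN nIb => /eqP <-.
exists b; split=> //.
have [//|[t1 [a [b0 [/andP[t01 t1b] a0 b0R Hab]]]]] :=
  radial_right_alternative iI dr dp rR Q0 aQ It0 Ib' (fun t => sub t0 t It0).
have It1 : I t1 by apply: (sub t0) => //; rewrite t01.
have [cK subK] := cylinder_compact cY AY a0 b0R.
have [_ []] := rend t1 _ (fun t => sub t1 t It1) It1 cK subK.
by move=> t tt; split=> //=; rewrite in_itv/=; exact: Hab.
Qed.

End Winding.

Lemma winding_reverse (I : set K) gam : winding A I gam -> winding A (-%R @^-1` I) (gam \o -%R).
Proof.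
move=> H t i It iy; have [v dv v0] := H _ i It iy; exists (- v); last by rewrite oppr_eq0.
by have := is_deriv_in_reverse dv; rewrite opprK.
Qed.

Lemma winding_maximal_geodesic (I : set K) gam : maximal_geodesic C g I gam -> winding A I gam ->
  strictly_convex_on I (fst \o gam) /\
  exists Tm Tp : K,
    [/\ I = `]Tm, Tp[%classic,
        (fst \o gam) t @[t --> Tm^'+] --> R' &
        (fst \o gam) t @[t --> Tp^'-] --> R'].
Proof.
move=> maxI windI; have [geoI _] := maxI; split; first exact: winding_strictly_convex.
have [pI _ _ _] := geoI; have [iI [t0 [_ [It0 _ _]]]] := pI.
have maxI' := maximal_geodesic_reverse (cylinder_atlas atlasA R') maxI.
have [Tp [Ip subp limp]] := winding_right_end geoI windI maxI.
have [Tm [Im subm limm]] := winding_right_end maxI'.1 (winding_reverse windI) maxI'.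
exists (- Tm), Tp; split=> //.
  apply/seteqP; split=> t /=; rewrite in_itv/=.
    move=> It; rewrite Ip// andbT ltrNl; apply: Im; by rewrite /= opprK.
  move=> /andP[tm tp]; have [t0t|/ltW tt0] := leP t0 t.
    by apply: (subp t0) => //; rewrite t0t.
  rewrite -[t]opprK; apply: (subm (- t0)); first by rewrite /= opprK.
  by rewrite lerN2 tt0/= ltrNl.
by apply/cvg_at_rightNP; rewrite opprK.
Qed.

End SmallRadius.

(** * Projection to the fibre of a warped product *)

Section Inverse.
Context {K : realType}.
Variables (I : set K) (tau sigma : K -> K).
Hypotheses (pI : proper_interval I) (dtau : forall t, I t -> is_deriv_in I tau t (sigma t))
  (sigma0 : forall t, I t -> 0 < sigma t).

Let iI : is_interval I. Proof. by case: pI. Qed.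

Lemma pos_deriv_increasing s t : I s -> I t -> s < t -> tau s < tau t.
Proof. exact: (lt_MVT_in iI dtau sigma0). Qed.

Lemma proper_interval_image : proper_interval (tau @` I).
Proof.
have [_ [a [b [Ia Ib ab]]]] := pI; split; last first.
  by exists (tau a), (tau b); split; [exists a|exists b|exact: pos_deriv_increasing].
move=> _ _ [s Is <-] [t It <-] z /andP[sz zt].
have [st|ts] := leP s t; last first.
  have := pos_deriv_increasing It Is ts; have := le_trans sz zt; lra.
have sub : `[s, t]%classic `<=` I by move=> x; rewrite /= in_itv/=; exact: iI.
have [] := @IVT K tau s t z st.
- by apply: continuous_subspaceW sub _; exact: is_deriv_in_within_continuous dtau.
- by rewrite min_l ?max_r ?sz ?(le_trans sz).
by move=> c cst cz; exists c => //; apply: sub.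
Qed.

(** A total function: the default value [0] of [xget] is taken off the image of [I] only. *)
Definition interval_inverse (z : K) : K := xget 0 [set s | I s /\ tau s = z].
Local Notation rho := interval_inverse.

Lemma interval_inverseK s : I s -> rho (tau s) = s.
Proof.
move=> Is; rewrite /rho; case: xgetP => [t _ [It E]|/(_ s)[]//].
case: (ltgtP s t) => // st; have := pos_deriv_increasing _ _ st => /(_ ltac:(done) ltac:(done));
  by rewrite E ltxx.
Qed.

(** As [tau] increases, values between [tau (t - e)] and [tau (t + e)] come from times within [e] of
    [t]. If [t + e] or [t - e] is not in [I], no time of the interval lies beyond it on that
    side. *)
Lemma interval_inverse_cvg t : I t -> rho z @[z --> within (tau @` I) (nbhs (tau t))] --> t.
Proof.
move=> It; apply/cvgrPdist_le => e e0; rewrite near_withinE.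
have n1 : \forall z \near tau t, I (t + e) -> z < tau (t + e).
  have [Ie|nIe] := pselect (I (t + e)); last by apply: filterE.
  have h : tau t < tau (t + e) by apply: pos_deriv_increasing => //; rewrite ltrDl.
  by apply: filterS (lt_nbhsl h).
have n2 : \forall z \near tau t, I (t - e) -> tau (t - e) < z.
  have [Ie|nIe] := pselect (I (t - e)); last by apply: filterE.
  have h : tau (t - e) < tau t by apply: pos_deriv_increasing => //; rewrite ltrBlDr ltrDl.
  by apply: filterS (lt_nbhsr h).
apply: filterS2 n1 n2 => z h1 h2 [s Is sz]; move: h1 h2; rewrite -{}sz interval_inverseK// => h1 h2.
rewrite ler_norml; apply/andP; split; rewrite leNgt; apply/negP => h.
  have Ie : I (t + e) by apply: (iI It Is); apply/andP; split; lra.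
  have := h1 Ie; have : tau (t + e) < tau s by apply: pos_deriv_increasing => //; lra.
  lra.
have Ie : I (t - e) by apply: (iI Is It); apply/andP; split; lra.
have := h2 Ie; have : tau s < tau (t - e) by apply: pos_deriv_increasing => //; lra.
lra.
Qed.

Lemma pos_deriv_C1_on : {within I, continuous sigma} -> C1_on I tau.
Proof.
move=> cs; split; first by move=> t It; exists (sigma t); exact: dtau.
apply/subspace_continuousP => t It.
suff c : deriv_in I tau s @[s --> within I (nbhs t)] --> deriv_in I tau t by exact: c.
rewrite (is_deriv_inE pI It (dtau It)); apply: within_near_cvg => P nP.
have := within_continuous_near cs It nP.
by apply: filterS => s H Is; rewrite (is_deriv_inE pI Is (dtau Is)); exact: H.
Qed.

End Inverse.

Section WarpedProduct.
Context {K : realType} {n : nat} {Y : topologicalType} (A : charts K n Y).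
Variables (R : K) (f : K -> K) (h : K -> tensor A) (h0 : tensor A).
Hypotheses (atlasA : smooth_atlas A) (wpgh : generalized_warped_product R f h)
  (hh0 : warped_product_case R h h0) (R0 : 0 < R).
Let g := warped_metric f h.
Let C := cylinder A R.
Local Notation p := radial_velocity.

Lemma warped_product_log_deriv : log_deriv_bound R h 0.
Proof.
move=> r i y v rR iy; have /andP[r0 rR'] := rR.
have E : dr_metric R h r i y = 0.
  apply: (is_deriv_inE (proper_interval_co R0)); first by rewrite /= in_itv/= (ltW r0).
  apply: is_deriv_in_near (is_deriv_in_cst `[0, R[ (h0 i y) r); first by rewrite hh0 ?(ltW r0).
  by near=> s => sR; split=> //; rewrite hh0//; move: sR; rewrite /= in_itv.
by rewrite [qform (dr_metric _ _ _) _ _ _]/qform E mulmx0 mul0mx mxE !mulr0 oppr0 !mul0r lexx.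
Unshelve. all: by end_near. Qed.

(** The tensor [h0] is known through its agreement with [h] on chart domains; its properties are
    read off at [r = 0], where [h] is Riemannian by assumption. *)
Lemma fiber_metric i y : cdom i y -> [/\ (h0 i y)^T = h0 i y, h0 i y \in unitmx &
   differentiable (in_coord h0 i) (cmap i y)].
Proof.
move=> iy; have [_ riemh _ _ _] := wpgh; have [|sg _ _ _] := riemh 0; first by rewrite lexx.
have rh : riemannian A (h 0) by apply: riemh; rewrite lexx.
have E z : cdom i z -> h 0 i z = h0 i z by move=> iz; rewrite hh0// lexx.
split; [by rewrite -E// sg|by rewrite -E// (metric_unit rh)|].
apply: (near_differentiable (F := in_coord (h 0) i)); last exact: in_coord_differentiable.
by apply: filterS (near_image atlasA iy) => x /(image_cinv atlasA)[_ ix]; exact: E.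
Qed.

(** The metric is followed along a line of the fibre chart, on which [r], and hence the factor
    [f r ^+ 2], is constant. *)
Lemma derive_warped_tangential i r y (V : 'rV[K]_(1 + n)) u : 0 < r < R -> cdom (c := A) i y ->
  (V *m 'D_(row_mx 0 u) (in_coord (C := C) g i) (cmap (c := C) i (r, y)) *m V^T) 0 0 =
  f r ^+ 2 * (rsubmx V *m 'D_u (in_coord h0 i) (cmap i y) *m (rsubmx V)^T) 0 0.
Proof.
move=> rR iy; have [_ cK _ _] := atlasA; have [_ _ _ _ riemg] := wpgh.
have /andP[r0 rR'] := rR; have [_ _ dH] := fiber_metric iy.
have iC : cdom (c := C) i (r, y) by split=> //=; rewrite in_itv.
have dG := in_coord_differentiable riemg iC.
have l1 := @is_deriv_in_line _ _ _ setT (in_coord (C := C) g i) (cmap (c := C) i (r, y)) (row_mx 0 u) 0.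
have l2 := @is_deriv_in_line _ _ _ setT (in_coord h0 i) (cmap i y) u 0.
rewrite !scale0r !addr0 in l1 l2.
have {}l1 := l1 ltac:(exact: diff_derivable); have {}l2 := l2 ltac:(exact: diff_derivable).
have := is_deriv_in_mulmx (is_deriv_in_mulmx (is_deriv_in_cst setT V 0) l1) (is_deriv_in_cst setT V^T 0).
rewrite mul0mx add0r mulmx0 addr0 => /is_deriv_in_mxP/(_ 0 0) H1.
have := is_deriv_in_mulmx (is_deriv_in_mulmx (is_deriv_in_cst setT (rsubmx V) 0) l2) (is_deriv_in_cst setT (rsubmx V)^T 0).
rewrite mul0mx add0r mulmx0 addr0 => /is_deriv_in_mxP/(_ 0 0)/(is_deriv_inZ (k := f r ^+ 2)) H2.
have H3 := is_deriv_inD (is_deriv_in_cst setT (lsubmx V 0 0 * 1 * lsubmx V 0 0) 0) H2.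
rewrite add0r in H3.
apply: (is_deriv_in_unique proper_intervalT (I : setT 0) H1).
have E x : (cmap (c := A) i @` cdom i) x ->
    lsubmx V 0 0 * 1 * lsubmx V 0 0 + f r ^+ 2 *: (rsubmx V *m in_coord h0 i x *m (rsubmx V)^T) 0 0 =
    (V *m in_coord (C := C) g i (row_mx r%:M x) *m V^T) 0 0.
  move=> /(image_cinv atlasA)[_ ix]; rewrite /in_coord /g /warped_metric/= row_mxKl row_mxKr.
  rewrite (_ : (r%:M : 'M[K]_1) 0 0 = r); last by rewrite mxE mulr1n.
  by rewrite block_form -scalemxAr -scalemxAl [X in _ = _ + X]mxE hh0 ?(ltW r0).
have lE s : cmap (c := C) i (r, y) + s *: row_mx 0 u = row_mx r%:M (cmap (c := A) i y + s *: u).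
  by rewrite /= scale_row_mx scaler0 add_row_mx addr0.
have nI : \forall s \near (0 : K), setT s -> (cmap (c := A) i @` cdom i) (cmap (c := A) i y + s *: u).
  have dl := @is_deriv_in_affine _ _ setT (cmap (c := A) i y) u 0.
  apply: (cvg_within_near (is_deriv_in_cvg dl)); rewrite scale0r addr0.
  exact: near_image.
apply: is_deriv_in_near H3.
  by rewrite lE E//; exact: nbhs_singleton nI _.
by apply: filterS nI => s H _; split=> //; rewrite lE E//; exact: H.
Qed.

Lemma is_deriv_inMZ {m : nat} (I : set K) (k : K -> K) (w : K -> 'rV[K]_m) t a b :
  is_deriv_in I k t a -> is_deriv_in I w t b ->
  is_deriv_in I (fun s => k s *: w s) t (a *: w t + k t *: b).
Proof.
move=> dk /is_deriv_in_mxP dw; apply/is_deriv_in_mxP => i j; rewrite !mxE.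
rewrite (_ : (fun s => _) = fun s => k s * w s i j); first exact: is_deriv_inM.
by apply/funext => s; rewrite mxE.
Qed.

Section Reparametrisation.
Variables (I : set K) (gam : K -> K * Y).
Hypotheses (geoI : geodesic C g I gam) (windI : winding A I gam).

Let pI : proper_interval I. Proof. by have [] := geoI. Qed.
Let iI : is_interval I. Proof. by case: pI. Qed.

Lemma is_deriv_in_warp_comp t : I t ->
  is_deriv_in I (fun s => f (gam s).1) t (p I gam t * warp_slope R f (gam t).1).
Proof.
move=> It; have [rR _] := warped_geodesic_cdom geoI It.
have [dr _ _ _] := radial_motion atlasA wpgh geoI It.
have nI : \forall x \near (gam t).1, `]0, R[%classic x.
  by apply: open_nbhs_nbhs; split; [exact: itv_open|rewrite /= in_itv].
have d := is_deriv_in_is_derive nI (is_deriv_in_warp wpgh rR).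
exact: (is_deriv_in_comp_is_derive d dr).
Qed.

(* Clairaut's relation: the angular momentum [f^2 sqrt (1 - p^2)] is conserved. *)
Lemma angular_momentum_constant : exists2 a, 0 < a & forall t, I t ->
  (f (gam t).1) ^+ 2 * (1 - p I gam t ^+ 2) = a ^+ 2.
Proof.
have [_ [t0 [_ [It0 _ _]]]] := pI.
have [rR0 _] := warped_geodesic_cdom geoI It0.
have Q0 := (winding_horizontal wpgh geoI).1 windI.
pose m t := (f (gam t).1 * f (gam t).1) * (1 - p I gam t ^+ 2).
have m0 : 0 < m t0 by rewrite mulr_gt0 ?Q0// mulr_gt0// (warp_gt0 wpgh).
exists (Num.sqrt (m t0)); first by rewrite sqrtr_gt0.
move=> t It; rewrite (sqr_sqrtr (ltW m0)).
transitivity (m t); first by rewrite /m -expr2.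
apply: (cst_MVT_in iI) => // s Is.
have [rR _] := warped_geodesic_cdom geoI Is; have f0 := warp_gt0 wpgh rR.
have [_ dp _ /(_ 0 warped_product_log_deriv)] := radial_motion atlasA wpgh geoI Is.
(* With the constant [0] the inequality of [radial_motion] is the equality [p' = (f'/f) Q], and the
   derivative [2 p f f' Q - 2 f^2 p p'] of [f^2 Q] vanishes. *)
rewrite mul0r normr_le0 subr_eq0 => /eqP aE; rewrite aE in dp.
have df := is_deriv_in_warp_comp Is.
have := is_deriv_inM (is_deriv_inM df df) (is_deriv_inB (@is_deriv_in_cst K K I 1 s) (is_deriv_inM dp dp)).
set d := (X in is_deriv_in _ _ _ X); suff -> : d = 0 by [].
by rewrite /d; field; rewrite gt_eqF.
Qed.

Lemma warped_product_reparam_geodesic : reparam_geodesic A h0 I (snd \o gam).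
Proof.
have [a a0 aE] := angular_momentum_constant.
have [_ [t0 [_ [It0 _ _]]]] := pI.
have [_ cI carI HI] := geoI; have [_ cK _ _] := atlasA; have atlasC := cylinder_atlas atlasA R.
have [_ _ _ _ riemg] := wpgh.
(* The new parameter [tau] has derivative [sigma = a / f^2], the speed of [snd \o gam]
   for [h0]. *)
pose k s := a^-1 * (f (gam s).1 * f (gam s).1).
pose sigma s := (k s)^-1.
have f0 t : I t -> 0 < f (gam t).1.
  by move=> It; have [rR _] := warped_geodesic_cdom geoI It; exact: warp_gt0 wpgh _ rR.
have k0 t : I t -> 0 < k t by move=> It; rewrite mulr_gt0 ?invr_gt0// mulr_gt0// f0.
have sigma0 t : I t -> 0 < sigma t by move=> It; rewrite invr_gt0 k0.
have dk t : I t -> exists k', is_deriv_in I k t k'.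
  move=> It; have df := is_deriv_in_warp_comp It.
  by eexists; apply: is_deriv_inZ; exact: (is_deriv_inM df df).
have csigma : {within I, continuous sigma}.
  apply/subspace_continuousP => t It; have [k' dk'] := dk t It.
  by apply: cvgV; [rewrite gt_eqF// k0|exact: is_deriv_in_cvg dk'].
have [tau _ dtau] := primitive_interval iI It0 csigma.
pose rho := interval_inverse I tau.
have rhoK t : I t -> rho (tau t) = t by exact: (interval_inverseK pI dtau sigma0).
have rhoc t : I t -> rho z @[z --> within (tau @` I) (nbhs (tau t))] --> t.
  exact: (interval_inverse_cvg pI dtau sigma0).
exists (tau @` I), tau, ((snd \o gam) \o rho); split => //; last first.
- by move=> t; rewrite inE/= => It; rewrite rhoK.
- by move=> t It; rewrite (is_deriv_inE pI It (dtau t It)) sigma0.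
- exact: (pos_deriv_C1_on pI dtau csigma).
have pJ : proper_interval (tau @` I) by exact: (proper_interval_image pI dtau sigma0).
have It_rho z : (tau @` I) z -> I (rho z) by move=> [s Is <-]; rewrite rhoK.
have nz t (P : set Y) : I t -> nbhs (gam t).2 P ->
    \forall z \near tau t, (tau @` I) z -> P (gam (rho z)).2.
  move=> It nP; move/subspace_continuousP : cI => /(_ t It) c.
  have cy : (gam s).2 @[s --> within I (nbhs t)] --> (gam t).2.
    exact: (cvg_comp _ _ c (@cvg_snd _ _ (nbhs (gam t).1) (nbhs (gam t).2) _)).
  have := cvg_within_near (rhoc t It) (cvg_within_near cy nP).
  by apply: filterS => z H Jz; apply: (H Jz); exact: It_rho.
split=> //.
- apply/subspace_continuousP => _ [t It <-].
  suff c : (gam (rho z)).2 @[z --> within (tau @` I) (nbhs (tau t))] --> (gam (rho (tau t))).2 by exact: c.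
  by rewrite rhoK//; apply: within_near_cvg => P nP; exact: nz.
- by move=> _ [t It <-]; rewrite /= rhoK//; have [_ [i iy]] := warped_geodesic_cdom geoI It; exists i.
move=> _ i [t It <-]; rewrite /= rhoK// => iy.
have [rR _ _ _] := warped_geodesic_chart geoI It iy.
have ip : cdom (c := C) i (gam t) by split=> //=; rewrite in_itv.
pose V := velocity (C := C) i I gam.
pose x := cmap i \o (snd \o gam); pose w s := rsubmx (V s); pose v s := k s *: w s.
pose H := in_coord h0 i.
have dx s : I s -> cdom i (gam s).2 -> is_deriv_in I x s (w s).
  by move=> Is is_; have [_ _ ? _] := warped_geodesic_chart geoI Is is_.
pose z := (snd \o gam) \o rho.
have dz s : I s -> cdom i (gam s).2 -> is_deriv_in (tau @` I) (cmap i \o z) (tau s) (v s).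
  move=> Is is_; have := is_deriv_in_reparam (lt0r_neq0 (sigma0 s Is)) rhoK Is erefl (rhoc s Is)
    (dx s Is is_) (dtau s Is).
  by rewrite invrK.
have velE s : I s -> cdom i (gam s).2 -> velocity i (tau @` I) z (tau s) = v s.
  by move=> Is is_; apply: is_deriv_inE (dz s Is is_) => //; exists s.
have [_ d2 _ _] := HI t i It ip.
have [_ dw] := is_deriv_in_submx (derivable_in_is_deriv pI It d2).
have [k' dk'] := dk t It.
have := is_deriv_inMZ dk' dw; set v' := (X in is_deriv_in _ _ _ X) => dv.
have dvel : is_deriv_in (tau @` I) (velocity i (tau @` I) z) (tau t) (k t *: v').
  have := is_deriv_in_reparam (lt0r_neq0 (sigma0 t It)) rhoK It erefl (rhoc t It) dv (dtau t It).
  rewrite invrK; apply: is_deriv_in_near; first by rewrite /= rhoK// velE.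
  apply: filterS (nz t _ It (near_cdom atlasA iy)) => q Hs [s Is sq]; rewrite -{q}sq in Hs *; split; first by exists s.
  have := Hs (ex_intro2 _ _ s Is erefl); rewrite /= rhoK// => is_.
  by rewrite velE.
have Jt : (tau @` I) (tau t) by exists t.
have [symH uH dH] := fiber_metric iy.
split.
- by eexists; exact: dz.
- by eexists; exact: dvel.
- have GF := (geo_form_christoffel symH uH (cK _ _ iy) dH (v t) (k t *: v')).2.
  move=> l; rewrite /acceleration (is_deriv_inE pJ Jt dvel) velE//= rhoK//.
  apply: GF => {l} u.
  have [P dP HP] := momentum_equation atlasC riemg geoI It ip.
  have [_ dPr] := is_deriv_in_submx dP.
  have xE s : cdom i (gam s).2 -> H (x s) = h0 i (gam s).2 by move=> is_; rewrite /H /in_coord /x/= cK.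
  have kE s : k s = a^-1 * f (gam s).1 ^+ 2 by rewrite /k expr2.
  (* Divided by [a], the fibre momentum of [gam] for [g] is the momentum for [h0] of the
     reparametrised curve, whose velocity is [v = k w] with [k = f^2 / a]. The momentum equation
     thus carries over, whatever the derivative of [k] is. *)
  have mE s : I s -> cdom i (gam s).2 ->
      a^-1 *: rsubmx (V s *m g i (gam s)) = v s *m H (x s).
    move=> Is is_; have [rRs _] := warped_geodesic_cdom geoI Is; have /andP[rs0 rsR] := rRs.
    rewrite xE// /v -scalemxAl kE /g /warped_metric -[X in X *m block_mx _ _ _ _]hsubmxK.
    rewrite mul_row_block row_mxKr mulmx0 add0r -scalemxAr scalerA.
    by rewrite hh0 ?(ltW rs0).
  have D1 := is_deriv_in_mulmx dv (is_deriv_in_comp (dH : differentiable H (x t)) (dx t It iy)).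
  have D2 : is_deriv_in I (fun s => v s *m H (x s)) t (a^-1 *: rsubmx P).
    have := is_deriv_inZ (k := a^-1) dPr; apply: is_deriv_in_near; first by rewrite mE.
    have := within_continuous_near cI It (near_cdom atlasC ip).
    by apply: filterS => s Hs Is; split=> //; rewrite mE//; exact: (Hs Is).2.
  have E := is_deriv_in_unique pI It D1 D2.
  have E2 : (rsubmx P *m u^T) 0 0 =
      2^-1 * (f (gam t).1 ^+ 2 * (w t *m 'D_u H (cmap i (gam t).2) *m (w t)^T) 0 0).
    have := derive_warped_tangential (V t) u rR iy.
    rewrite (_ : ((gam t).1, (gam t).2) = gam t); last by case: (gam t).
    move=> D; rewrite -[in RHS]D; apply: etrans (HP (row_mx 0 u)).
    by rewrite -{2}(hsubmxK P) tr_row_mx mul_row_col trmx0 mulmx0 add0r.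
  rewrite /geo_form.
  have -> : 'D_(v t) H (cmap i (gam t).2) = k t *: 'D_(w t) H (cmap i (gam t).2).
    by rewrite deriveE// /v linearZ/= -deriveE.
  have -> : (k t *: v' *m H (cmap i (gam t).2) *m u^T) 0 0 +
     (v t *m (k t *: 'D_(w t) H (cmap i (gam t).2)) *m u^T) 0 0 =
     k t * a^-1 * (rsubmx P *m u^T) 0 0.
    rewrite -mx11D -mulmxDl -scalemxAl -scalemxAr -scalerDr -scalemxAl [LHS]mxE -mulrA; congr (_ * _).
    by rewrite [X in (X *m _) _ _]E -scalemxAl [LHS]mxE.
  have -> : (v t *m 'D_u H (cmap i (gam t).2) *m (v t)^T) 0 0 =
     k t * k t * (w t *m 'D_u H (cmap i (gam t).2) *m (w t)^T) 0 0.
    by rewrite /v -!scalemxAl linearZ/= -scalemxAr scalerA [LHS]mxE.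
  (* The two remaining terms cancel since [k * a^-1 * f^2 = k * k]. *)
  rewrite E2 !kE; ring.
- rewrite velE// /z/= /qform.
  have -> : (v t *m h0 i (gam t).2 *m (v t)^T) 0 0 = k t * k t * qform h0 i (gam t).2 (w t).
    by rewrite /v -!scalemxAl linearZ/= -scalemxAr scalerA [LHS]mxE.
  (* Clairaut's relation reads [f^4 q = a^2], and the squared speed of the new curve is
     [k^2 q = a^-2 f^4 q]. *)
  have := aE t It; rewrite (geodesic_horizontal_form geoI It iy) -/V -/(w t).
  have /andP[rt0 rtR] := rR; rewrite /qform hh0 ?(ltW rt0)// -/(qform h0 i (gam t).2 (w t)) => e.
  rewrite /k; set q := qform _ _ _ _ in e *; set F := f _ in e *.
  rewrite (_ : _ * _ * q = a^-1 * a^-1 * (F ^+ 2 * (F ^+ 2 * q))); last by ring.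
  by rewrite e; field; rewrite gt_eqF.
Qed.

End Reparametrisation.
End WarpedProduct.

Theorem theoremA (K : realType) (n : nat) (Y : topologicalType)
    (A : charts K n Y) (R : K) (f : K -> K) (h : K -> tensor A) :
  closed_manifold A -> 0 < R -> generalized_warped_product R f h ->
  [/\ forall (I : set K) (gam : K -> K * Y),
        geodesic (cylinder A R) (warped_metric f h) I gam ->
        radial I gam \/ winding A I gam,
      extends_convexly R f ->
        exists R0 : K, (0 < R0 <= R) /\
          forall R' : K, 0 < R' <= R0 ->
          forall (I : set K) (gam : K -> K * Y),
            maximal_geodesic (cylinder A R') (warped_metric f h) I gam ->
            winding A I gam ->
            strictly_convex_on I (fst \o gam) /\
            exists Tm Tp : K,
              [/\ I = `]Tm, Tp[%classic,
                  (fst \o gam) t @[t --> Tm^'+] --> R' &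
                  (fst \o gam) t @[t --> Tp^'-] --> R'] &
      forall h0 : tensor A, warped_product_case R h h0 ->
        forall (I : set K) (gam : K -> K * Y),
          geodesic (cylinder A R) (warped_metric f h) I gam ->
          winding A I gam ->
          reparam_geodesic A h0 I (snd \o gam)].
Proof.
move=> closedA R0 wpgh; have [atlasA _ _ _] := closedA; have [_ _ _ [c c0 Hc] _] := wpgh.
split=> [I gam|cvxf|h0 hh0 I gam geoI windI].
- exact: radial_or_winding.
- have c2 : 0 < 2 * c + 2 by lra.
  (* The constant [c] belongs to the given radius [R] and serves every smaller one; for [r] below
     [(2 * c + 2)^-1], [1 / (2 r)] exceeds [c + 1]. *)
  exists (Num.min R (2 * c + 2)^-1); split.
    by rewrite lt_min R0 invr_gt0 c2 ge_min lexx.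
  move=> R' /andP[R'0]; rewrite le_min => /andP[R'R R'c] I gam maxI windI.
  apply: (winding_maximal_geodesic closedA wpgh cvxf c0 Hc R'R _ maxI windI).
  by rewrite -ler_pdivlMr// mul1r.
- exact: (warped_product_reparam_geodesic atlasA wpgh hh0 R0 geoI windI).
Qed.
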